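(* Let $n\ge1$. The Lie algebroid of the groupoid $\mathrm{BDiff}(S^1,n)\rightrightarrows B$ is $\mathrm{BVect}_n(S^1)$. That is: for each $p\in B$ the tangent space at the identity to the source fiber over $p$ is the space of vector fields with breaks at $p_1,\dots,p_n$; the differential of the target map on it is the anchor $u\,\partial_x\mapsto\sum_i u(p_i)\,\partial_{p_i}$; and the Lie bracket on smooth sections induced from the group of bisections of $\mathrm{BDiff}(S^1,n)$ is $$[\![\mathbf u,\mathbf v]\!]=\bigl(u v_x-v u_x\bigr)\partial_x+\sum_{i=1}^n\bigl(u(p_i,p)\,v_{p_i}(x,p)-v(p_i,p)\,u_{p_i}(x,p)\bigr)\partial_x$$ for $\mathbf u=u(x,p)\partial_x$, $\mathbf v=v(x,p)\partial_x$.
   Context: Base. $S^1=\mathbb R/\mathbb Z$ with coordinate $x$; $B\subset (S^1)^n$ is the manifold of $n$-tuples $p=(p_1,\dots,p_n)$ of distinct cyclically ordered points; $p_{n+1}:=p_1$; $[p_i,p_{i+1}]$ is the positively oriented arc from $p_i$ to $p_{i+1}$ (for $n=1$, the whole circle cut at $p_1$). $\widetilde{S^1\times B}$ is the manifold with boundary obtained by cutting $S^1\times B$ along the hypersurfaces $\{x=p_i\}$. Broken vector fields. A vector field with breaks at $p_1,\dots,p_n$ is a continuous vector field $u(x)\partial_x$ on $S^1$ smooth up to the boundary on each arc $[p_i,p_{i+1}]$. $\mathrm{BVect}_n(S^1)\to B$ is the vector bundle whose fiber over $p$ is the space of such fields. A smooth section is a family $u(x,p)\partial_x$ with $u$ continuous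 on $S^1\times B$ and smooth on $\widetilde{S^1\times B}$. Subscripts denote partial derivatives. Groupoid. An arrow of $\mathrm{BDiff}(S^1,n)$ with source $p\in B$ is an orientation-preserving homeomorphism $\phi$ of $S^1$ whose restriction to each closed arc $[p_j,p_{j+1}]$ is a smooth diffeomorphism onto its image; $\mathrm{src}(\phi)=p$, $\mathrm{trg}(\phi)=\phi(p)=(\phi(p_1),\dots,\phi(p_n))$; composition is composition of homeomorphisms, defined when source and target match. Smooth curves $\phi^t$ in the source fiber over $p$ are those for which $\phi^t(x)$ is smooth in $(t,x)$ on each $[p_j,p_{j+1}]$ (up to the boundary). Bisections. A bisection is a family $\phi(x,p)$, continuous on $S^1\times B$ and smooth on $\widetilde{S^1\times B}$, such that for every $p$ the map $\phi(\cdot,p)$ is an arrow with source $p$ and $p\mapsto\phi(p,p):=(\phi(p_1,p),\dots,\phi(p_n,p))$ is a diffeomorphism of $B$. Bisections form a group under $(\phi\psi)(x,p)=\phi(\psi(x,p),\psi(p,p))$, with identity $\mathrm{id}(x,p)=x$. The Lie algebroid of the groupoid has fiber over $p$ the tangent space at the identity to the source fiber over $p$, anchor $d(\mathrm{trg})$, and bracket on sections that of the Lie algebra of the bisection group, with the sign convention for which the Lie algebra of a diffeomorphism group carries the standard bracket of vector fields: if $\phi^t,\psi^s$ are smooth curves of bisections through the identity with $\partial_t|_{0}\phi^t=u$, $\partial_s|_{0}\psi^s=v$, the bracket of $u\partial_x,v\partial_x$ is $-\frac{\partial^2}{\partial t\,\partial s}\big|_{t=s=0}\bigl(\phi^t\psi^s(\phi^t)^{-1}\bigr)\,\partial_x$,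 for $x\notin\{p_1,\dots,p_n\}$, extended by continuity. *)

(* Defs.v *)
From HB Require Import structures.
From mathcomp Require Import all_boot all_order all_algebra.
From mathcomp Require Import generic_quotient.
From mathcomp Require Import all_classical all_reals all_analysis.

Set Implicit Arguments.
Unset Strict Implicit.
Unset Printing Implicit Defensive.

Import Order.TTheory GRing.Theory Num.Theory.
Import numFieldNormedType.Exports.

Local Open Scope classical_set_scope.
Local Open Scope ring_scope.

Section CircleType.
Variable R : realType.

Definition int_diff (x y : R) : bool := x - y \is a Num.int.

Lemma int_diff_equiv : equiv_class_of int_diff.
Proof.
split=> [x|x y|y x z]; rewrite /int_diff.
- by rewrite subrr rpred0.
- by rewrite -opprB rpredN.
- by move=> xy yz; rewrite -(subrKA y); exact: rpredD.
Qed.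

Canonical int_diff_equivRel := EquivRelPack int_diff_equiv.

Definition circle : Type := quotient_topology {eq_quot int_diff}%qT.

Definition cpi (x : R) : circle := (\pi_circle x)%qT.

End CircleType.

Section Smooth.
Variable R : realType.

(* [U] is meant to be open and [V] finite-dimensional. *)
Fixpoint Ck (V : normedModType R) (k : nat) (U : set V) (f : V -> R) : Prop :=
  match k with
  | 0%N => forall x, U x -> {for x, continuous f}
  | k'.+1 => (forall x, U x -> differentiable f x) /\
             (forall v : V, Ck k' U (fun x => 'D_v f x))
  end.

Definition smooth_on (V : normedModType R) (U : set V) (f : V -> R) : Prop :=
  forall k, Ck k U f.

(* Smoothness up to the boundary on an arbitrary subset [A]: [f] locally
   agrees on [A] with C^oo functions defined on open sets of [V]. *)
Definition smooth_upto (V : normedModType R) (A : set V) (f : V -> R) : Prop :=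
  forall a, A a -> exists (U : set V) (g : V -> R),
    [/\ open U, U a, smooth_on U g & forall z, A z -> U z -> f z = g z].

(* The same for maps to the circle; the charts of R/Z are the local inverses
   of [cpi]. *)
Definition csmooth_upto (V : normedModType R) (A : set V) (f : V -> circle R)
    : Prop :=
  forall a, A a -> exists (U : set V) (g : V -> R),
    [/\ open U, U a, smooth_on U g & forall z, A z -> U z -> f z = cpi (g z)].

(* The curve [c] in the circle has velocity [a] at the time [t0], where
   tangent vectors of the circle are written in the coordinate x. *)
Definition cvelocity (c : R -> circle R) (t0 a : R) : Prop :=
  exists g : R -> R, (\forall t \near t0, c t = cpi (g t)) /\ is_derive t0 1 g a.

End Smooth.

Section Base.
Variables (R : realType) (n : nat).

Definition config := 'rV[circle R]_n.

Definition proj (q : 'rV[R]_n) : config := map_mx (@cpi R) q.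

(* For a lift [q] of p, the lift of p_(i+1) that ends the arc starting at
   [q 0 i]: it is q_(i+1) if i is not the last index, and q_1 + 1 otherwise. *)
Definition nextpt (q : 'rV[R]_n) (i : 'I_n) : R :=
  q 0 (ordS i) + (i.+1 == n)%:R.

(* q_1 < q_2 < ... < q_n < q_1 + 1; these lifts form a covering of B. *)
Definition Bcover : set 'rV[R]_n :=
  [set q : 'rV[R]_n | forall i, q 0 i < nextpt q i].

Definition Bset : set config := [set p | exists2 q, Bcover q & proj q = p].

(* The lift to R * Bcover of the i-th closed piece {x in [p_i, p_(i+1)]} of
   the manifold obtained by cutting S^1 * B along {x = p_1}, ..., {x = p_n}. *)
Definition piece (i : 'I_n) : set (R * 'rV[R]_n) :=
  [set z | Bcover z.2 /\ z.2 0 i <= z.1 <= nextpt z.2 i].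

Definition S1B : set (circle R * config) := [set z | Bset z.2].

End Base.

Arguments Bcover {R n}.
Arguments Bset {R n}.
Arguments S1B {R n}.
Arguments piece {R n}.

Section BVect.
Variables (R : realType) (n : nat).

(* [u] stands for the vector field u(x) d/dx. *)
Definition BVect (p : config R n) (u : circle R -> R) : Prop :=
  continuous u /\
  forall q, Bcover q -> proj q = p -> forall i : 'I_n,
    smooth_upto `[q 0 i, nextpt q i] (fun x => u (cpi x)).

(* Functions of p only matter on B. *)
Definition smooth_section (u : circle R -> config R n -> R) : Prop :=
  {within S1B, continuous (fun z => u z.1 z.2)} /\
  forall i, smooth_upto (piece i) (fun z => u (cpi z.1) (proj z.2)).

End BVect.

Section Groupoid.
Variables (R : realType) (n : nat).

Definition homeomorphism (T : topologicalType) (f : T -> T) : Prop :=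
  exists g : T -> T, [/\ continuous f, continuous g, cancel f g & cancel g f].

Definition increasing_lift (f : circle R -> circle R) (F : R -> R) : Prop :=
  [/\ continuous F, {homo F : x y / x < y} & forall x, f (cpi x) = cpi (F x)].

Definition diffeo_on_arc (F : R -> R) (a b : R) : Prop :=
  smooth_upto `[a, b] F /\
  exists G : R -> R, smooth_upto (F @` `[a, b]) G /\
    (forall x, x \in `[a, b] -> G (F x) = x).

(* [f] is an arrow with source [p]. Orientation is preserved iff [f] has an
   increasing lift. *)
Definition arrow (p : config R n) (f : circle R -> circle R) : Prop :=
  [/\ Bset p, homeomorphism f &
    exists F, increasing_lift f F /\
      forall q, Bcover q -> proj q = p -> forall i,
        diffeo_on_arc F (q 0 i) (nextpt q i)].

Definition trg (p : config R n) (f : circle R -> circle R) : config R n :=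
  map_mx f p.

(* A smooth curve in the source fiber over [p], passing through the identity
   at time 0. *)
Definition source_curve (p : config R n) (f : R -> circle R -> circle R)
    : Prop :=
  exists2 e : R, 0 < e &
    [/\ forall t, `|t| < e -> arrow p (f t),
        forall x, f 0 x = x &
        forall q, Bcover q -> proj q = p -> forall i,
          csmooth_upto [set z : R * R | `|z.1| < e /\ q 0 i <= z.2 <= nextpt q i]
            (fun z => f z.1 (cpi z.2))].

Definition has_velocity (f : R -> circle R -> circle R) (u : circle R -> R)
    : Prop :=
  forall x, cvelocity (fun t => f t x) 0 (u x).

(* The fiber of the Lie algebroid: the tangent space to the source fiber at
   the identity arrow of [p]; d/dt f^t at t = 0 is written as u(x) d/dx. *)
Definition tangent_source_fiber (p : config R n) : set (circle R -> R) :=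
  [set u | exists2 f, source_curve p f & has_velocity f u].

(* The differential of trg at the identity sends the tangent vector [u] to
   sum_i w_i d/dp_i. *)
Definition dtrg (p : config R n) (u : circle R -> R) (w : 'rV[R]_n) : Prop :=
  forall f, source_curve p f -> has_velocity f u ->
    forall i, cvelocity (fun t => trg p (f t) 0 i) 0 (w 0 i).

Definition anchor (p : config R n) (u : circle R -> R) : 'rV[R]_n :=
  \row_i u (p 0 i).

End Groupoid.

Section Bisections.
Variables (R : realType) (n : nat).

Local Notation family := (circle R -> config R n -> circle R).

Definition smooth_on_B (tau : config R n -> config R n) : Prop :=
  forall i, csmooth_upto Bcover (fun q => tau (proj q) 0 i).

Definition diffeo_of_B (tau : config R n -> config R n) : Prop :=
  exists sigma : config R n -> config R n,
    [/\ forall p, Bset p -> Bset (tau p) /\ sigma (tau p) = p,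
        forall p, Bset p -> Bset (sigma p) /\ tau (sigma p) = p,
        smooth_on_B tau & smooth_on_B sigma].

Definition btrg (f : family) (p : config R n) : config R n :=
  trg p (fun x => f x p).

Definition bisection (f : family) : Prop :=
  [/\ {within S1B, continuous (fun z => f z.1 z.2)},
      forall i, csmooth_upto (piece i) (fun z => f (cpi z.1) (proj z.2)),
      forall p, Bset p -> arrow p (fun x => f x p) &
      diffeo_of_B (btrg f)].

Definition bmul (f g : family) : family := fun x p => f (g x p) (btrg g p).

(* The inverse in the group of bisections: f^-1(x, p) is the y such that
   f(y, q) = x, where q is the point of B with f(q, q) = p. *)
Definition binv (f : family) : family := fun x p =>
  (xget (x, p) [set z | [/\ Bset z.2, f z.1 z.2 = x & btrg f z.2 = p]]).1.

Lemma binvP (f : family) y q : bisection f -> Bset q ->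
  binv f (f y q) (btrg f q) = y.
Proof.
case=> _ _ arr [s [s1 _ _ _]] Bq; rewrite /binv.
case: xgetP => [z _ [Bz fz tz]|/(_ (y, q)) []//].
have zq : z.2 = q by rewrite -(s1 _ Bz).2 tz (s1 _ Bq).2.
have [_ [g [_ _ fg _]] _] := arr _ Bq.
by rewrite -[LHS]fg -[RHS]fg; congr g; rewrite -fz zq.
Qed.

Lemma bmulVb (f : family) x p : bisection f -> Bset p ->
  bmul (binv f) f x p = x.
Proof. by move=> bf Bp; rewrite /bmul binvP. Qed.

Lemma bmulbV (f : family) x p : bisection f -> Bset p ->
  bmul f (binv f) x p = x.
Proof.
move=> bf Bp; have [_ _ arr [s [_ s2 _ _]]] := bf.
have [Bs tsp] := s2 _ Bp; have [_ [g [_ _ _ gf]] _] := arr _ Bs.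
rewrite /bmul; have -> : btrg (binv f) p = s p.
  apply/rowP => i; rewrite mxE -{1 2}tsp.
  by rewrite -[RHS](binvP (s p 0 i) bf Bs) /btrg /trg mxE.
have := binvP (g x) bf Bs; rewrite tsp.
by rewrite gf => ->; exact: gf.
Qed.

(* A smooth curve of bisections through the identity at time 0, with
   velocity [u] at time 0. *)
Definition bisection_curve (u : circle R -> config R n -> R) (f : R -> family)
    : Prop :=
  [/\ exists2 e : R, 0 < e &
        (forall t, `|t| < e -> bisection (f t)) /\
        (forall i, csmooth_upto
           [set z : R * (R * 'rV[R]_n) | `|z.1| < e /\ piece i z.2]
           (fun z => f z.1 (cpi z.2.1) (proj z.2.2))),
      forall x p, Bset p -> f 0 x p = x &
      forall x p, Bset p -> cvelocity (fun t => f t x p) 0 (u x p)].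

(* [a] is d^2/dt ds at t = s = 0 of (f^t g^s (f^t)^-1)(x, p). As this
   is x at s = 0 for all t, its s-derivative at s = 0 lies in the tangent line
   at x and is a real-valued function of t. *)
Definition conj_mixed_derivative (f g : R -> family) (x : circle R)
    (p : config R n) (a : R) : Prop :=
  exists w : R -> R,
    (\forall t \near (0 : R),
       cvelocity (fun s => bmul (bmul (f t) (g s)) (binv (f t)) x p) 0 (w t)) /\
    is_derive (0 : R) 1 w a.

Definition off_breaks (x : circle R) (p : config R n) : Prop :=
  forall i, x <> p 0 i.

(* [w] is the bracket of the sections [u] and [v] induced from the group of
   bisections: [u] and [v] are velocities of smooth curves of bisections, and
   all such curves give [w] away from the breaks. The values of [w] at the
   breaks are determined by the continuity of [w]. *)
Definition bisection_bracket (u v w : circle R -> config R n -> R) : Prop :=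
  [/\ smooth_section w,
      exists f, bisection_curve u f,
      exists g, bisection_curve v g &
      forall f g, bisection_curve u f -> bisection_curve v g ->
        forall x p, Bset p -> off_breaks x p ->
          conj_mixed_derivative f g x p (- w x p)].

(* The partial derivatives u_x and u_(p_i), computed in the coordinates given
   by arbitrary lifts of x and p. *)
Definition d_x (u : circle R -> config R n -> R) (x : circle R)
    (p : config R n) : R :=
  derive1 (fun y : R => u (cpi y) p) (repr x).

Definition d_p (i : 'I_n) (u : circle R -> config R n -> R) (x : circle R)
    (p : config R n) : R :=
  'D_(delta_mx 0 i) (fun q : 'rV[R]_n => u x (proj q)) (map_mx repr p).

Definition bracket_formula (u v : circle R -> config R n -> R)
    (x : circle R) (p : config R n) : R :=
  (u x p * d_x v x p - v x p * d_x u x p) +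
  \sum_(i < n) (u (p 0 i) p * d_p i v x p - v (p 0 i) p * d_p i u x p).

End Bisections.

(* Main.v *)
From HB Require Import structures.
Require Import Defs.
From mathcomp Require Import all_boot all_order all_algebra.
From mathcomp Require Import generic_quotient.
From mathcomp Require Import all_classical all_reals all_analysis.
From mathcomp Require Import ring lra zify.
Set Implicit Arguments.
Unset Strict Implicit.
Unset Printing Implicit Defensive.
Import Order.TTheory GRing.Theory Num.Theory.
Import numFieldNormedType.Exports.
Local Open Scope classical_set_scope.
Local Open Scope ring_scope.

(** A vector field with breaks at p is tangent to a curve of arrows, namely the
    maps x + t u(x) for small t: on each closed arc u has a bounded slope, so that
    these maps are Lipschitz perturbations of the identity with constant 1/2, hence
    homeomorphisms, and they are diffeomorphisms of the closed arcs by the inverse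
    function theorem ([arrow_of_field]). Conversely, the velocity of a curve of
    arrows is, in local lifts, a partial derivative of a function that is smooth on
    the closed arcs. This gives [tangent_source_fiberE], and then [dtrg_anchor] only
    reads off the velocities of the breaks.

    For the bracket, the points (x, p) of the circle times the base are lifted to
    R * 'rV[R]_n. A curve of bisections f^t through the identity with velocity u
    acts there near a point off the breaks by z = (x, q) |-> (F(t, z), F_j(t, q)),
    and its velocity at t = 0 is the vector field
    [vel u] z = (u(x, p), u(p_1, p), ..., u(p_n, p)). If z(t) is the image of z
    under (f^t)^-1, then the conjugate of g^s by f^t has the s-derivative
    A(t, z(t)), with A(t, z) the derivative of F(t, .) at z along [vel v]. Its
    derivative at t = 0 is the sum of the derivative of A in t, which is the
    derivative of u along [vel v] by the symmetry of second derivatives, and of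
    the derivative of A(0, .) = v along z'(0) = - [vel u]. Up to the sign this is
    the bracket formula, which thus is the derivative of v along [vel u] minus the
    derivative of u along [vel v] ([conj_mixed]).

    It remains to see that the bracket exists, which needs two things. First, the
    formula extends to a smooth section ([bracket_section_smooth]): it makes sense on
    each closed piece with local smooth extensions of u and v, and the values on the
    two sides of a break agree since [vel u] is tangent to the hypersurface
    x = p_j, so that only the functions q |-> u(p_j, p) and v(p_j, p) of the base
    enter there. Second, every smooth section u is the velocity of a curve of
    bisections ([bisection_curve_exists]). As the base is not compact, x + t u(x, p)
    is a bisection for no t > 0 in general; t is replaced by a function of t and p
    that equals t to first order at t = 0 but never exceeds a positive smooth
    function eps(p). If eps and its gradient are small enough compared with u and
    its first derivatives at p, then for all t the breaks move by a Lipschitz map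
    with constant 1/2 that vanishes at the boundary of the base, and therefore by a
    diffeomorphism of the base. Such an eps is a function of the sum of the
    reciprocal lengths of the arcs, a proper function on the base
    ([section_bound]). *)

(** * Smooth functions and smooth maps *)

Section SmoothCalculus.
Variable R : realType.
Implicit Types U V W : normedModType R.

Lemma differentiableW V W (f : V -> W) (df : V -> W) (x : V) :
  linear df -> continuous df ->
  (forall e, 0 < e -> \forall h \near 0, `|f (h + x) - f x - df h| <= e * `|h|) ->
  differentiable f x /\ 'd f x = df :> (V -> W).
Proof.
move=> ldf cdf fe.
pose A' : {linear V -> W} := HB.pack df (GRing.isLinear.Build _ _ _ _ df ldf).
have E : f \o shift x = cst (f x) + (A' : V -> W) +o_ 0 id.
  apply/eqaddoP => e e0; apply: filterS (fe e e0) => h.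
  by rewrite /= -[(_ - _) h]/(f (h + x) - (f x + df h)) opprD addrA.
have dg : 'd f x = A' :> (V -> W) by apply: diff_unique.
by split=> //; apply/diff_locallyP; rewrite dg.
Qed.

Lemma differentiable_littleo V W (f : V -> W) (x : V) : differentiable f x ->
  forall e, 0 < e ->
  \forall h \near 0, `|f (h + x) - f x - 'd f x h| <= e * `|h|.
Proof.
move=> /diff_locallyP[_ /eqaddoP fe] e e0; apply: filterS (fe e e0) => h.
by rewrite /= -[(_ - _) h]/(f (h + x) - (f x + 'd f x h)) opprD addrA.
Qed.

Lemma near_eq_differentiable V W (f g : V -> W) (x : V) :
  (\near x, f x = g x) -> differentiable f x -> differentiable g x.
Proof.
move=> fg df; have fgx : f x = g x by exact: nbhs_singleton fg.
apply: (@differentiableW _ _ g ('d f x) x _ _ _).1 => [||e e0].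
- exact: linearP.
- exact: diff_continuous.
have fg0 : \forall h \near (0 : V), f (h + x) = g (h + x).
  by move: fg; rewrite (near_shift 0) /= subr0.
by apply: filterS2 fg0 (differentiable_littleo df e0) => h <-; rewrite fgx.
Qed.

Lemma linear_fun_differentiable V W (A : V -> W) x :
  linear A -> continuous A -> differentiable A x.
Proof.
move=> lA cA.
pose A' : {linear V -> W} := HB.pack A (GRing.isLinear.Build _ _ _ _ A lA).
exact: (@linear_differentiable R V W A').
Qed.

Lemma derive_linear_fun V W (A : V -> W) x v :
  linear A -> continuous A -> 'D_v A x = A v.
Proof.
move=> lA cA; rewrite deriveE; last exact: linear_fun_differentiable.
pose A' : {linear V -> W} := HB.pack A (GRing.isLinear.Build _ _ _ _ A lA).
by rewrite (_ : A = A')// diff_lin.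
Qed.

Lemma derive_comp U V W (f : V -> W) (phi : U -> V) x v :
  differentiable phi x -> differentiable f (phi x) ->
  'D_v (f \o phi) x = 'd f (phi x) ('D_v phi x).
Proof.
move=> dphi df; rewrite !deriveE//; last exact: differentiable_comp.
by rewrite diff_comp.
Qed.

Lemma open_near V (U : set V) x : open U -> U x -> \forall y \near x, U y.
Proof. by move=> oU Ux; apply: open_nbhs_nbhs. Qed.

Lemma Ck_ext V k (U : set V) (f g : V -> R) : open U ->
  (forall x, U x -> f x = g x) -> Ck k U f -> Ck k U g.
Proof.
move=> oU; elim: k f g => [|k IH] f g fg /=.
  move=> cf x Ux; have nfg : \near x, f x = g x.
    by apply: filterS (open_near oU Ux) => y /fg.
  have := cf x Ux; rewrite /prop_for /continuous_at -fg// => fx.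
  by apply: cvg_trans fx; apply: near_eq_cvg.
move=> [df cdf]; split=> [x Ux|v].
  apply: near_eq_differentiable (df x Ux).
  by apply: filterS (open_near oU Ux) => y /fg.
apply: IH (cdf v) => x Ux; apply: near_eq_derive.
by apply: filterS (open_near oU Ux) => y /fg.
Qed.

Lemma Ck_sub V k (U U' : set V) (f : V -> R) :
  U `<=` U' -> Ck k U' f -> Ck k U f.
Proof.
move=> UU'; elim: k f => [|k IH] f /= => [cf x /UU'|[df cf]]; first exact: cf.
by split=> [x /UU' /df//|v]; exact: IH.
Qed.

Lemma Ck_pred V k (U : set V) (f : V -> R) : Ck k.+1 U f -> Ck k U f.
Proof.
elim: k f => [|k IH] f [df cf].
  by move=> x Ux; apply: differentiable_continuous; exact: df.
by split=> // v; apply: IH; exact: cf.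
Qed.

Lemma Ck_cst V k (U : set V) (c : R) : Ck k U (fun=> c).
Proof.
elim: k c => [|k IH] c; first by move=> x _; exact: cst_continuous.
split=> [x _|v]; first exact: differentiable_cst.
by under eq_fun do rewrite derive_cst.
Qed.

Lemma Ck_linear V k (U : set V) (f : V -> R) :
  linear f -> continuous f -> Ck k U f.
Proof.
move=> lf cf; case: k => [|k]; first by move=> x _; exact: cf.
split=> [x _|v]; first exact: linear_fun_differentiable.
by under eq_fun do rewrite derive_linear_fun//; exact: Ck_cst.
Qed.

Lemma Ck_add V k (U : set V) (f g : V -> R) : open U ->
  Ck k U f -> Ck k U g -> Ck k U (fun x => f x + g x).
Proof.
move=> oU; elim: k f g => [|k IH] f g.
  by move=> cf cg x Ux; apply: cvgD; [exact: cf|exact: cg].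
move=> [df cf] [dg cg]; split=> [x Ux|v].
  by apply: differentiableD; [exact: df|exact: dg].
apply: Ck_ext (IH _ _ (cf v) (cg v)) => // x Ux.
by rewrite (@deriveD _ _ _ f g)//; apply: diff_derivable; [exact: df|exact: dg].
Qed.

Lemma Ck_mul V k (U : set V) (f g : V -> R) : open U ->
  Ck k U f -> Ck k U g -> Ck k U (fun x => f x * g x).
Proof.
move=> oU; elim: k f g => [|k IH] f g.
  by move=> cf cg x Ux; apply: cvgM; [exact: cf|exact: cg].
move=> Cf Cg; have Cf' := Ck_pred Cf; have Cg' := Ck_pred Cg.
case: Cf => df cf; case: Cg => dg cg; split=> [x Ux|v].
  by apply: differentiableM; [exact: df|exact: dg].
apply: Ck_ext (Ck_add oU (IH _ _ Cf' (cg v)) (IH _ _ Cg' (cf v))) => // x Ux.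
by rewrite (@deriveM _ _ f g)//; apply: diff_derivable; [exact: df|exact: dg].
Qed.

Lemma Ck_opp V k (U : set V) (f : V -> R) : open U ->
  Ck k U f -> Ck k U (fun x => - f x).
Proof.
move=> oU Cf; apply: Ck_ext (Ck_mul oU (Ck_cst k U (-1)) Cf) => // x _.
by rewrite mulN1r.
Qed.

Lemma Ck_inv V k (U : set V) (f : V -> R) : open U ->
  (forall x, U x -> f x != 0) -> Ck k U f -> Ck k U (fun x => (f x)^-1).
Proof.
move=> oU f0; elim: k => [|k IH] => [cf x Ux|Cf].
  by apply: cvgV; [exact: f0|exact: cf].
have Cf' := IH (Ck_pred Cf).
case: Cf => df cf; split=> [x Ux|v].
  by apply: differentiableV; [exact: df|exact: f0].
apply: Ck_ext (Ck_opp oU (Ck_mul oU (Ck_mul oU Cf' Cf') (cf v))) => // x Ux.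
rewrite (@deriveV _ _ f x v (f0 _ Ux)); last exact: diff_derivable (df _ Ux).
by rewrite /GRing.scale/= mulNr expr2 invfM.
Qed.

Lemma Ck_sum V k (U : set V) (I : Type) (r : seq I) (P : pred I) (f : I -> V -> R) :
  open U -> (forall i, P i -> Ck k U (f i)) ->
  Ck k U (fun x => \sum_(i <- r | P i) f i x).
Proof.
move=> oU Cf; elim: r => [|i r IH].
  by under eq_fun do rewrite big_nil; exact: Ck_cst.
under eq_fun do rewrite big_cons; case Pi : (P i) => //.
by apply: Ck_add => //; exact: Cf.
Qed.

Lemma Ck_prod V k (U : set V) (I : Type) (r : seq I) (P : pred I) (f : I -> V -> R) :
  open U -> (forall i, P i -> Ck k U (f i)) ->
  Ck k U (fun x => \prod_(i <- r | P i) f i x).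
Proof.
move=> oU Cf; elim: r => [|i r IH].
  by under eq_fun do rewrite big_nil; exact: Ck_cst.
under eq_fun do rewrite big_cons; case Pi : (P i) => //.
by apply: Ck_mul => //; exact: Cf.
Qed.

(** Maps of class C^k between possibly infinite-dimensional spaces, restricted to
    finite sums of elementary terms. The derivative of a composition with such a
    map only involves derivatives of the outer function in fixed directions, the
    ones that [Ck] controls. *)
Inductive smap V W (k : nat) (U : set V) : (V -> W) -> Prop :=
| smap_lin A : linear A -> continuous A -> smap k U A
| smap_cst c : smap k U (fun=> c)
| smap_scale a e : Ck k U a -> smap k U (fun x => a x *: e)
| smap_add phi psi : smap k U phi -> smap k U psi ->
    smap k U (fun x => phi x + psi x).

Lemma smap_pred V W k (U : set V) (phi : V -> W) :
  smap k.+1 U phi -> smap k U phi.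
Proof.
elim=> [A lA cA|c|a e Ca|f g _ IHf _ IHg].
- exact: smap_lin.
- exact: smap_cst.
- exact/smap_scale/Ck_pred.
- exact: smap_add.
Qed.

Lemma smap_differentiable V W k (U : set V) (phi : V -> W) x :
  smap k.+1 U phi -> U x -> differentiable phi x.
Proof.
move=> + Ux; elim=> [A lA cA|c|a e [da _]|f g _ IHf _ IHg].
- exact: linear_fun_differentiable.
- exact: differentiable_cst.
- by apply: differentiableZl; exact: da.
- exact: differentiableD.
Qed.

Lemma smap_continuous V W k (U : set V) (phi : V -> W) x :
  smap k U phi -> U x -> {for x, continuous phi}.
Proof.
move=> + Ux; elim=> [A lA cA|c|a e Ca|f g _ IHf _ IHg].
- exact: cA.
- exact: cst_continuous.
- apply: cvgZr_tmp; case: k Ca => [|k [da _]]; first exact.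
  by apply: differentiable_continuous; exact: da.
- exact: cvgD.
Qed.

(** By the chain rule the derivative of the composition is a sum over the elementary
    terms of the inner map. A term A(x) or a(x) e contributes a derivative of the
    outer function in a fixed direction, composed with the inner map and multiplied
    by a coefficient of class C^k, so that the induction hypothesis applies. *)
Lemma Ck_comp V W k (U : set V) (U' : set W) (f : W -> R) (phi : V -> W) :
  open U -> (forall x, U x -> U' (phi x)) -> smap k U phi -> Ck k U' f ->
  Ck k U (fun x => f (phi x)).
Proof.
move=> oU UU'; elim: k f => [|k IH] f.
  move=> sphi cf x Ux; apply: continuous_comp; first exact: smap_continuous sphi Ux.
  exact/cf/UU'.
move=> sphi [df cf]; split=> [x Ux|v].
  apply: differentiable_comp; first exact: smap_differentiable sphi Ux.
  exact/df/UU'.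
have sphi' := smap_pred sphi.
have D w : Ck k U (fun x => 'd f (phi x) w).
  apply: Ck_ext (IH _ sphi' (cf w)) => // x Ux.
  by rewrite deriveE//; exact/df/UU'.
suff : forall psi : V -> W, smap k.+1 U psi ->
    Ck k U (fun x => 'd f (phi x) ('D_v psi x)).
  move=> /(_ _ sphi); apply: Ck_ext => // x Ux.
  by rewrite -derive_comp//; [exact: smap_differentiable sphi Ux|exact/df/UU'].
move=> psi; elim=> [A lA cA|c|a e Ca|g h sg IHg sh IHh].
- by under eq_fun do rewrite derive_linear_fun//.
- under eq_fun do rewrite derive_cst linear0; exact: Ck_cst.
- case: (Ca) => da ca; apply: Ck_ext (Ck_mul oU (ca v) (D e)) => // x Ux.
  have -> : 'D_v (fun x => a x *: e) x = 'D_v a x *: e.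
    rewrite !deriveE//; [|exact: da|by apply: differentiableZl; exact: da].
    by rewrite (@diffZl _ _ _ a e x) //; exact: da.
  by rewrite linearZ.
- apply: Ck_ext (Ck_add oU IHg IHh) => // x Ux.
  rewrite (@deriveD _ _ _ g h)// ?linearD//; apply: diff_derivable.
    exact: smap_differentiable sg Ux.
  exact: smap_differentiable sh Ux.
Qed.

End SmoothCalculus.

Section SmoothOn.
Variable R : realType.
Implicit Types U V W : normedModType R.

Lemma near_ball V (x : V) (P : V -> Prop) : (\forall y \near x, P y) ->
  exists2 r, 0 < r & forall y, `|x - y| < r -> P y.
Proof.
move=> nP; have /nbhs_ballP[r r0 br] : nbhs x P by exact: nP.
by exists r => // y xy; apply: br; rewrite -ball_normE.
Qed.

Lemma smooth_ext V (U : set V) (f g : V -> R) : open U ->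
  (forall x, U x -> f x = g x) -> smooth_on U f -> smooth_on U g.
Proof. by move=> oU fg sf k; exact: Ck_ext (sf k). Qed.

Lemma smooth_sub V (U U' : set V) (f : V -> R) :
  U `<=` U' -> smooth_on U' f -> smooth_on U f.
Proof. by move=> UU' sf k; exact: Ck_sub (sf k). Qed.

Lemma smooth_differentiable V (U : set V) (f : V -> R) x :
  smooth_on U f -> U x -> differentiable f x.
Proof. by move=> /(_ 1%N)[df _]; exact: df. Qed.

Lemma smooth_continuous V (U : set V) (f : V -> R) x :
  smooth_on U f -> U x -> {for x, continuous f}.
Proof. by move=> /(_ 0%N); exact. Qed.

Lemma smooth_derive V (U : set V) (f : V -> R) v :
  smooth_on U f -> smooth_on U ('D_v f).
Proof. by move=> sf k; case: (sf k.+1) => _; exact. Qed.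

Lemma smooth_cst V (U : set V) c : smooth_on U (fun=> c).
Proof. by move=> k; exact: Ck_cst. Qed.

Lemma smooth_linear V (U : set V) (f : V -> R) :
  linear f -> continuous f -> smooth_on U f.
Proof. by move=> lf cf k; exact: Ck_linear. Qed.

Lemma smooth_add V (U : set V) (f g : V -> R) : open U ->
  smooth_on U f -> smooth_on U g -> smooth_on U (fun x => f x + g x).
Proof. by move=> oU sf sg k; exact: Ck_add. Qed.

Lemma smooth_opp V (U : set V) (f : V -> R) : open U ->
  smooth_on U f -> smooth_on U (fun x => - f x).
Proof. by move=> oU sf k; exact: Ck_opp. Qed.

Lemma smooth_sum V (U : set V) (I : Type) (r : seq I) (P : pred I) (f : I -> V -> R) :
  open U -> (forall i, P i -> smooth_on U (f i)) ->
  smooth_on U (fun x => \sum_(i <- r | P i) f i x).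
Proof. by move=> oU sf k; apply: Ck_sum => // i Pi; exact: sf. Qed.

Lemma smooth_mul V (U : set V) (f g : V -> R) : open U ->
  smooth_on U f -> smooth_on U g -> smooth_on U (fun x => f x * g x).
Proof. by move=> oU sf sg k; exact: Ck_mul. Qed.

Lemma smooth_inv V (U : set V) (f : V -> R) : open U ->
  (forall x, U x -> f x != 0) -> smooth_on U f ->
  smooth_on U (fun x => (f x)^-1).
Proof. by move=> oU f0 sf k; exact: Ck_inv. Qed.

Lemma smooth_local V (U : set V) (f : V -> R) :
  (forall a, U a -> exists N, [/\ open N, N a & smooth_on N f]) -> smooth_on U f.
Proof.
move=> loc k; have {}loc a : U a -> exists N, [/\ open N, N a & Ck k N f].
  by move=> /loc[N [oN Na sN]]; exists N.
elim: k f loc => [|k IH] f loc /=.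
  by move=> x /loc[N [_ Nx]]; exact.
split=> [x /loc[N [_ Nx [df _]]]|v]; first exact: df.
apply: IH => a Ua; have [N [oN Na [_ cf]]] := loc a Ua; exists N.
by split=> //; exact: cf.
Qed.

Definition smooth_map V W (U : set V) (phi : V -> W) := forall k, smap k U phi.

Lemma smooth_comp V W (U : set V) (U' : set W) (f : W -> R) (phi : V -> W) :
  open U -> (forall x, U x -> U' (phi x)) -> smooth_map U phi -> smooth_on U' f ->
  smooth_on U (fun x => f (phi x)).
Proof. by move=> oU UU' sp sf k; exact: (Ck_comp oU UU' (sp k) (sf k)). Qed.

Lemma smooth_map_linear V W (U : set V) (A : V -> W) :
  linear A -> continuous A -> smooth_map U A.
Proof. by move=> lA cA k; exact: smap_lin. Qed.

Lemma smooth_map_cst V W (U : set V) (c : W) : smooth_map U (fun=> c).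
Proof. by move=> k; exact: smap_cst. Qed.

Lemma smooth_map_add V W (U : set V) (phi psi : V -> W) :
  smooth_map U phi -> smooth_map U psi -> smooth_map U (fun x => phi x + psi x).
Proof. by move=> s1 s2 k; exact: smap_add. Qed.

Lemma smooth_map_scale V W (U : set V) (a : V -> R) (e : W) :
  smooth_on U a -> smooth_map U (fun x => a x *: e).
Proof. by move=> s k; exact: smap_scale. Qed.

Lemma smooth_map_real V (U : set V) (a : V -> R) :
  smooth_on U a -> smooth_map U a.
Proof.
move=> sa; rewrite (_ : a = fun x => a x *: (1 : R)); last first.
  by apply/funext => x; rewrite /GRing.scale/= mulr1.
exact: smooth_map_scale.
Qed.

Lemma smap_post_linear U V W k (S : set U) (L : V -> W) (phi : U -> V) :
  linear L -> continuous L -> smap k S phi -> smap k S (fun x => L (phi x)).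
Proof.
move=> lL cL; pose L' : {linear V -> W} := HB.pack L (GRing.isLinear.Build _ _ _ _ L lL).
elim=> [A lA cA|c|a e Ca|f g _ IHf _ IHg].
- apply: smap_lin => [a x y|x]; first by rewrite lA lL.
  exact: (continuous_comp (cA x) (cL (A x))).
- exact: smap_cst.
- rewrite (_ : (fun x => _) = fun x => a x *: L e); first exact: smap_scale.
  by apply/funext => x; rewrite -[L]/(L' : V -> W) linearZ.
- rewrite (_ : (fun x => _) = fun x => L (f x) + L (g x)); first exact: smap_add.
  by apply/funext => x; rewrite -[L]/(L' : V -> W) linearD.
Qed.

Lemma linear_fst V W : linear (fst : V * W -> V). Proof. by []. Qed.
Lemma linear_snd V W : linear (snd : V * W -> W). Proof. by []. Qed.
Lemma continuous_fst V W : continuous (fst : V * W -> V).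
Proof. by move=> x; exact: cvg_fst. Qed.
Lemma continuous_snd V W : continuous (snd : V * W -> W).
Proof. by move=> x; exact: cvg_snd. Qed.

Lemma smooth_map_fst U V W (S : set U) (phi : U -> V * W) :
  smooth_map S phi -> smooth_map S (fun x => (phi x).1).
Proof.
move=> sp k; apply: smap_post_linear (sp k); [exact: linear_fst|exact: continuous_fst].
Qed.

Lemma smooth_map_snd U V W (S : set U) (phi : U -> V * W) :
  smooth_map S phi -> smooth_map S (fun x => (phi x).2).
Proof.
move=> sp k; apply: smap_post_linear (sp k); [exact: linear_snd|exact: continuous_snd].
Qed.

Lemma smooth_map_id V (S : set V) : smooth_map S (fun x => x).
Proof. by apply: smooth_map_linear => // x; exact: cvg_id. Qed.

Lemma smooth_map_pair U V W (S : set U) (phi : U -> V) (psi : U -> W) :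
  smooth_map S phi -> smooth_map S psi -> smooth_map S (fun x => (phi x, psi x)).
Proof.
move=> s1 s2; rewrite (_ : (fun x => _) = fun x => (phi x, 0) + (0, psi x)); last first.
  by apply/funext => x; congr pair; rewrite /= ?addr0 ?add0r.
apply: smooth_map_add => k.
- apply: (@smap_post_linear U V (V * W)%type k S (fun v => (v, 0)) _ _ _ (s1 k)).
    by move=> a x y; congr pair; rewrite /= scaler0 addr0.
  by move=> x; apply: cvg_pair; [exact: cvg_id|exact: cvg_cst].
- apply: (@smap_post_linear U W (V * W)%type k S (fun v => (0, v)) _ _ _ (s2 k)).
    by move=> a x y; congr pair; rewrite /= scaler0 addr0.
  by move=> x; apply: cvg_pair; [exact: cvg_cst|exact: cvg_id].
Qed.

Lemma smooth_map_sum V W (U : set V) (I : Type) (r : seq I) (phi : I -> V -> W) :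
  (forall i, smooth_map U (phi i)) -> smooth_map U (fun x => \sum_(i <- r) phi i x).
Proof.
move=> sp; elim: r => [|i r IH].
  by under eq_fun do rewrite big_nil; exact: smooth_map_cst.
by under eq_fun do rewrite big_cons; exact: smooth_map_add.
Qed.

Lemma smooth_map_row V n (U : set V) (phi : V -> 'rV[R]_n) :
  (forall i, smooth_on U (fun x => phi x 0 i)) -> smooth_map U phi.
Proof.
move=> sp; rewrite (_ : phi = fun x => \sum_j phi x 0 j *: delta_mx 0 j).
  by apply: smooth_map_sum => i; exact: smooth_map_scale.
by apply/funext => x; exact: row_sum_delta.
Qed.

Lemma smooth_coord n (U : set 'rV[R]_n) j : smooth_on U (fun q : 'rV[R]_n => q 0 j).
Proof.
apply: smooth_linear => [a x y|]; first by rewrite !mxE.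
exact: coord_continuous.
Qed.

(** * Mean values and symmetry of second derivatives *)

Lemma differentiable_affine V (a v : V) (s : R) :
  differentiable (fun s : R => a + s *: v) s.
Proof.
apply: differentiableD; first exact: differentiable_cst.
apply: linear_fun_differentiable; last exact: scalel_continuous.
by move=> k x y; rewrite scalerDl scalerA.
Qed.

Lemma derive_affine V (a v : V) (s : R) : 'D_1 (fun s : R => a + s *: v) s = v.
Proof.
have L : linear (fun s : R => s *: v) by move=> k x y; rewrite scalerDl scalerA.
have C : continuous (fun s : R => s *: v) by exact: scalel_continuous.
rewrite (@deriveD _ _ _ (cst a) (fun s : R => s *: v)); first last.
- exact/diff_derivable/linear_fun_differentiable.
- exact: derivable_cst.
by rewrite derive_cst add0r derive_linear_fun// scale1r.
Qed.

Lemma is_derive_line V (f : V -> R) (a v : V) (s : R) :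
  differentiable f (a + s *: v) ->
  is_derive s 1 (fun s : R => f (a + s *: v)) ('D_v f (a + s *: v)).
Proof.
move=> df; apply: DeriveDef.
  apply: diff_derivable.
  by apply: differentiable_comp; [exact: differentiable_affine|exact: df].
rewrite (@derive_comp _ _ _ _ f (fun s : R => a + s *: v))//.
by rewrite derive_affine deriveE.
Qed.

Lemma segment_mvt V (f : V -> R) (a v : V) :
  (forall s : R, 0 <= s <= 1 -> differentiable f (a + s *: v)) ->
  exists2 s : R, 0 <= s <= 1 & f (a + v) - f a = 'D_v f (a + s *: v).
Proof.
move=> df; pose g (s : R) := f (a + s *: v).
have dg (s : R) : 0 <= s <= 1 -> is_derive s 1 g ('D_v f (a + s *: v)).
  by move=> s01; apply: is_derive_line; exact: df.
have [||s s01] := @MVT_segment R g (fun s => 'D_v f (a + s *: v)) 0 1 ler01.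
- by move=> s; rewrite in_itv/= => /andP[s0 s1]; apply: dg; rewrite !ltW.
- apply: derivable_within_continuous => s; rewrite in_itv/= => s01.
  by have [] := dg s s01.
rewrite /g scale0r addr0 scale1r subr0 mulr1 => E; exists s => //.
Qed.

Lemma derive_translate V W (f : V -> W) c x v :
  'D_v (fun y => f (y + c)) x = 'D_v f (x + c).
Proof.
rewrite /derive; set A := (fun h : R => _); set B := (fun h : R => _).
suff -> : A = B by [].
by apply/funext => h; rewrite /A /B /= addrA.
Qed.

Lemma differentiable_translate V W (f : V -> W) c x :
  differentiable f (x + c) -> differentiable (fun y => f (y + c)) x.
Proof.
by move=> df; apply: (@differentiable_comp _ _ _ _ (fun y => y + c) f).
Qed.

(** The mean value theorem is applied to F(y + w) - F(y) in the direction v, and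
    then to the derivative of F along v in the direction w. *)
Lemma second_difference V (U : set V) (F : V -> R) z v w : open U ->
  smooth_on U F ->
  (forall s t : R, 0 <= s <= 1 -> 0 <= t <= 1 -> U (z + s *: v + t *: w)) ->
  exists s t : R, [/\ 0 <= s <= 1, 0 <= t <= 1 &
    F (z + v + w) - F (z + v) - (F (z + w) - F z) =
    'D_w ('D_v F) (z + s *: v + t *: w)].
Proof.
move=> oU sF Ubox.
have i0 : 0 <= (0 : R) <= 1 by rewrite lexx ler01.
have i1 : 0 <= (1 : R) <= 1 by rewrite lexx ler01.
have [|s s01 E] := @segment_mvt V (fun y => F (y + w) - F y) z v.
  move=> s s01; apply: differentiableB.
    apply: differentiable_translate; apply: smooth_differentiable sF _.
    by have := Ubox _ _ s01 i1; rewrite scale1r.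
  apply: smooth_differentiable sF _.
  by have := Ubox _ _ s01 i0; rewrite scale0r addr0.
have [|t t01 E2] := @segment_mvt V ('D_v F) (z + s *: v) w.
  by move=> t t01; apply: smooth_differentiable (smooth_derive v sF) _; exact: Ubox.
exists s, t; split=> //; rewrite -E2 E.
rewrite (@deriveB _ _ _ (fun y => F (y + w)) F) ?derive_translate//; apply: diff_derivable.
  apply: differentiable_translate; apply: smooth_differentiable sF _.
  by have := Ubox _ _ s01 i1; rewrite scale1r.
apply: smooth_differentiable sF _.
by have := Ubox _ _ s01 i0; rewrite scale0r addr0.
Qed.

Lemma derive_scale_dir V (f : V -> R) x (h : R) v : differentiable f x ->
  'D_(h *: v) f x = h * 'D_v f x.
Proof. by move=> df; rewrite !deriveE// linearZ. Qed.

Lemma derive_scale_fun V (f : V -> R) x (h : R) v : differentiable f x ->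
  'D_v (fun y => h * f y) x = h * 'D_v f x.
Proof.
move=> df; rewrite (@deriveM _ _ (cst h) f) ?derive_cst ?scaler0 ?addr0//.
exact: diff_derivable.
Qed.

(** The second difference in the directions h v and h w is symmetric in v and w. For
    a small h, [second_difference] writes it as h^2 times each of the two second
    derivatives at points near z, and these are continuous. *)
Lemma derive_symmetric V (U : set V) (F : V -> R) z v w : open U ->
  smooth_on U F -> U z -> 'D_v ('D_w F) z = 'D_w ('D_v F) z.
Proof.
move=> oU sF Uz; apply/eqP; rewrite -subr_eq0 -normr_le0; apply/ler_addgt0Pr => e e0.
rewrite add0r.
have e20 : 0 < e / 2 by rewrite divr_gt0.
have tri (a b c : R) : `|a - c| < e / 2 -> `|b - c| < e / 2 -> `|a - b| <= e.
  move=> ac bc; rewrite (le_trans (ler_distD c _ _))// (distrC c) (splitr e).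
  by rewrite lerD// ltW.
have c1 := smooth_continuous (smooth_derive v (smooth_derive w sF)) Uz.
have c2 := smooth_continuous (smooth_derive w (smooth_derive v sF)) Uz.
have n1 : \forall y \near z, `|'D_v ('D_w F) z - 'D_v ('D_w F) y| < e / 2.
  by move/cvgrPdist_lt : c1; apply.
have n2 : \forall y \near z, `|'D_w ('D_v F) z - 'D_w ('D_v F) y| < e / 2.
  by move/cvgrPdist_lt : c2; apply.
have [r r0 br] := near_ball (filterI (open_near oU Uz) (filterI n1 n2)).
pose h := r / (`|v| + `|w| + 1).
have d0 : 0 < `|v| + `|w| + 1 by rewrite ltr_wpDl// addr_ge0.
have h0 : 0 < h by rewrite divr_gt0.
have hE : h * (`|v| + `|w| + 1) = r by rewrite /h divfK// gt_eqF.
clearbody h.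
have box (s t : R) : 0 <= s <= 1 -> 0 <= t <= 1 ->
    `|z - (z + s *: (h *: v) + t *: (h *: w))| < r.
  move=> /andP[s0 s1] /andP[t0 t1]; rewrite -addrA opprD addrA subrr sub0r normrN.
  rewrite (le_lt_trans (ler_normD _ _))// !normrZ !ger0_norm ?(ltW h0)//.
  have v0 := normr_ge0 v; have w0 := normr_ge0 w.
  have : s * (h * `|v|) <= h * `|v| by rewrite ler_piMl// mulr_ge0// ltW.
  have : t * (h * `|w|) <= h * `|w| by rewrite ler_piMl// mulr_ge0// ltW.
  by rewrite -hE !mulrDr mulr1; lra.
have [s [t [s01 t01 E1]]] := @second_difference V U F z (h *: v) (h *: w) oU sF
  (fun s t hs ht => (br _ (box s t hs ht)).1).
have [|s' [t' [s'01 t'01 E2]]] := @second_difference V U F z (h *: w) (h *: v) oU sF.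
  move=> s' t' hs ht; apply: (br _ _).1.
  by rewrite (addrAC z (s' *: _)); exact: box.
have inner a b y : U y -> 'D_(h *: a) ('D_(h *: b) F) y = h * (h * 'D_a ('D_b F) y).
  move=> Uy.
  have -> : 'D_(h *: a) ('D_(h *: b) F) y = 'D_(h *: a) (fun y => h * 'D_b F y) y.
    apply: near_eq_derive; apply: filterS (open_near oU Uy) => x Ux.
    by rewrite derive_scale_dir//; exact: smooth_differentiable sF Ux.
  have dd : differentiable ('D_b F) y by exact: smooth_differentiable (smooth_derive b sF) Uy.
  rewrite derive_scale_dir; last by apply: differentiableM.
  by rewrite derive_scale_fun.
have [Uy [y1 y2]] := br _ (box _ _ s01 t01).
have := br _ (box _ _ t'01 s'01); rewrite addrAC => -[Uy' [y1' y2']].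
have hh : h * (h * 'D_w ('D_v F) (z + s *: (h *: v) + t *: (h *: w))) =
          h * (h * 'D_v ('D_w F) (z + s' *: (h *: w) + t' *: (h *: v))).
  apply: etrans (esym (inner w v _ Uy)) (etrans (esym E1) (etrans _ (etrans E2 (inner v w _ Uy')))).
  have sw (a b c d : R) : a - b - (c - d) = a - c - (b - d) by ring.
  by rewrite (addrAC z (h *: w)); exact: sw.
have {}hh := mulfI (lt0r_neq0 h0) (mulfI (lt0r_neq0 h0) hh).
by move: y2 y1'; rewrite hh => y2 y1'; exact: tri y1' y2.
Qed.

End SmoothOn.

(** * Perturbations of the identity *)

(* Row vectors are to be used as a complete normed space. *)
HB.instance Definition _ (R : realType) m n := Complete.on 'M[R]_(m, n).

Section Contraction.
Variables (R : realType) (E : completeNormedModType R).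

(** The map z |-> y - w z is a contraction of the closed ball into itself. *)
Lemma local_solve (w : E -> E) (z0 y : E) (r : R) : 0 < r ->
  (forall x x', `|x - z0| <= r -> `|x' - z0| <= r ->
     `|w x - w x'| <= 2^-1 * `|x - x'|) ->
  `|y - w z0 - z0| <= r / 2 ->
  exists z, [/\ `|z - z0| <= r, z + w z = y & `|z - z0| <= 2 * `|y - w z0 - z0|].
Proof.
move=> r0 lw yr; pose U : set E := closed_ball z0 r.
have UE z : U z <-> `|z - z0| <= r.
  by rewrite /U closed_ballE// /closed_ball_ /= distrC.
have z0U : U z0 by apply/UE; rewrite subrr normr0 ltW.
have TU : {homo (fun z => y - w z) : z / U z >-> U z}.
  move=> z /UE zr; apply/UE.
  have -> : y - w z - z0 = (y - w z0 - z0) + (w z0 - w z).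
    by rewrite [y - w z0 - z0]addrAC subrKA addrAC.
  rewrite (le_trans (ler_normD _ _))// (splitr r) lerD//.
  rewrite (le_trans (lw _ _ _ zr)) ?subrr ?normr0 ?(ltW r0)//.
  by rewrite mulrC ler_wpM2r ?invr_ge0// distrC.
have [|||z /UE zr zE] := @banach_fixed_point R E U (mkfun TU).
- exists 2^-1%:nng; split; first by rewrite /= invf_lt1 ?ltr1n.
  move=> [a b] /= [/UE ar /UE br].
  rewrite /mkfun (_ : _ - _ = w b - w a); first by rewrite (distrC a); exact: lw.
  by rewrite opprB addrC addrA subrK.
- exact: closed_ball_closed.
- by exists z0.
have {}zE : z = y - w z by exact: zE.
exists z; split=> //; first by rewrite {1}zE subrK.
have : `|z - z0| <= `|y - w z0 - z0| + 2^-1 * `|z - z0|.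
  have {1}-> : z - z0 = (y - w z0 - z0) + (w z0 - w z).
    by rewrite {1}zE [y - w z0 - z0]addrAC subrKA addrAC.
  rewrite (le_trans (ler_normD _ _))// lerD2l (le_trans (lw _ _ _ zr)) 1?distrC//.
  by rewrite subrr normr0 ltW.
by lra.
Qed.

Lemma id_plus_contraction_bijective (w : E -> E) :
  (forall x x', `|w x - w x'| <= 2^-1 * `|x - x'|) ->
  exists sigma : E -> E, [/\ forall y, sigma y + w (sigma y) = y,
    forall x, sigma (x + w x) = x &
    forall y y', `|sigma y - sigma y'| <= 2 * `|y - y'|].
Proof.
move=> lw.
(* The radius is large enough for the ball around y to be preserved. *)
have ex y : exists z, z + w z = y.
  have r0 : 0 < 2 * `|y - w y - y| + 1 by rewrite ltr_wpDl// mulr_ge0.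
  have [||z [_ zE _]] := @local_solve w y y _ r0; last by exists z.
    by move=> x x' _ _; exact: lw.
  by lra.
have [sigma sE] := choice ex.
have lip x x' : `|x - x'| <= 2 * `|(x + w x) - (x' + w x')|.
  have : `|x - x'| <= `|(x + w x) - (x' + w x')| + `|w x' - w x|.
    have {1}-> : x - x' = (x + w x - (x' + w x')) + (w x' - w x).
      by apply/eqP; rewrite -subr_eq opprB addrACA -opprD.
    exact: ler_normD.
  have := lw x' x; rewrite (distrC x' x); lra.
exists sigma; split=> // [x|y y'].
  apply/eqP; rewrite -subr_eq0 -normr_le0 (le_trans (lip _ _))//.
  by rewrite sE subrr normr0 mulr0.
by rewrite (le_trans (lip _ _))// !sE.
Qed.

End Contraction.

Section SmoothInverse.
Variable R : realType.

Lemma differentiable_combination (V W : normedModType R) m (a : 'I_m -> V -> R)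
    (e : 'I_m -> W) x : (forall j, differentiable (a j) x) ->
  differentiable (fun z => \sum_j a j z *: e j) x /\
  forall v, 'D_v (fun z => \sum_j a j z *: e j) x = \sum_j 'D_v (a j) x *: e j.
Proof.
move=> da; have dae j : differentiable (fun z => a j z *: e j) x.
  exact: differentiableZl.
have -> : (fun z => \sum_j a j z *: e j) = \sum_j (fun z => a j z *: e j).
  by rewrite fct_sumE.
split=> [|v]; first exact: differentiable_sum.
rewrite derive_sum; last by move=> j; exact: diff_derivable.
by apply: eq_bigr => j _; rewrite deriveE// diffZl// -deriveE.
Qed.

Lemma Ck_det (V : normedModType R) k (U : set V) m (A : V -> 'M[R]_m) : open U ->
  (forall i j, Ck k U (fun x => A x i j)) -> Ck k U (fun x => \det (A x)).
Proof.
move=> oU CA; apply: Ck_sum => // s _; apply: Ck_mul => //; first exact: Ck_cst.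
by apply: Ck_prod.
Qed.

Lemma Ck_invmx (V : normedModType R) k (U : set V) m (A : V -> 'M[R]_m) : open U ->
  (forall x, U x -> A x \in unitmx) ->
  (forall i j, Ck k U (fun x => A x i j)) ->
  forall i j, Ck k U (fun x => invmx (A x) i j).
Proof.
move=> oU uA CA i j.
apply: (@Ck_ext _ _ k U (fun x => (\det (A x))^-1 * cofactor (A x) j i)) => //.
  by move=> x /uA ux; rewrite /invmx ux !mxE.
apply: Ck_mul => //.
  apply: Ck_inv => //; last exact: Ck_det.
  by move=> x /uA; rewrite unitmxE unitfE.
apply: Ck_mul => //; first exact: Ck_cst.
apply: Ck_det => // a b; rewrite (_ : (fun x => _) = fun x => A x (lift j a) (lift i b))//.
by apply/funext => x; rewrite !mxE.
Qed.

(** In the rest of this section [sigma] is the inverse of the identity plus [w],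
    where [w] has finite rank and is contractive; it is smooth if [w] is. *)
Variables (E : normedModType R) (m : nat) (wc : 'I_m -> E -> R) (e : 'I_m -> E).
Variables (w sigma : E -> E) (O O' : set E).
Hypothesis oO : open O.
Hypothesis oO' : open O'.
Hypothesis wE : forall x, O x -> w x = \sum_j wc j x *: e j.
Hypothesis swc : forall j, smooth_on O (wc j).
Hypothesis dwle : forall x v, O x ->
  `|\sum_j 'D_v (wc j) x *: e j| <= 2^-1 * `|v|.
Hypothesis sigmaO : forall y, O' y -> O (sigma y).
Hypothesis sigmaE : forall y, O' y -> sigma y + w (sigma y) = y.
Hypothesis sigma_lip : forall y y', `|sigma y - sigma y'| <= 2 * `|y - y'|.

(* On the combinations of the e_j, the identity plus the differential of w at x acts
   on the coefficients by the matrix M x. *)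
Let M x : 'M[R]_m := 1%:M + \matrix_(j, k) 'D_(e k) (wc j) x.

Let dwc x j : O x -> differentiable (wc j) x.
Proof. by move=> Ox; exact: smooth_differentiable (swc j) Ox. Qed.

Let D_lin x j (a : 'I_m -> R) : O x ->
  'D_(\sum_k a k *: e k) (wc j) x = \sum_k a k * 'D_(e k) (wc j) x.
Proof.
move=> Ox; rewrite deriveE; last exact: dwc.
rewrite linear_sum; apply: eq_bigr => k _.
by rewrite linearZ -deriveE//; exact: dwc.
Qed.

Let M_unit x : O x -> M x \in unitmx.
Proof.
move=> Ox; rewrite -unitmx_tr -row_free_unit; apply: inj_row_free => u uM.
pose v := \sum_k u 0 k *: e k.
have uE j : 'D_v (wc j) x = - u 0 j.
  apply/eqP; rewrite -addr_eq0 addrC D_lin//.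
  move: uM => /(congr1 (fun A : 'rV_m => A 0 j)); rewrite !mxE => uMj.
  apply/eqP; rewrite -[RHS]uMj.
  rewrite [RHS](eq_bigr (fun k => u 0 k * (k == j)%:R + u 0 k * 'D_(e k) (wc j) x)).
    rewrite big_split/=; congr (_ + _).
    rewrite (bigD1 j)//= eqxx mulr1 big1 ?addr0// => k kj.
    by rewrite (negPf kj) mulr0.
  by move=> k _; rewrite !mxE mulrDr eq_sym.
have v0 : v = 0.
  have := dwle v Ox; under eq_bigr do rewrite uE scaleNr.
  rewrite sumrN normrN -/v => h; apply/eqP; rewrite -normr_le0.
  by have := normr_ge0 v; lra.
apply/rowP => j; rewrite mxE; apply: oppr_inj.
by rewrite -uE v0 derive0 oppr0.
Qed.

(* The coordinates in the span of the e_j of the displacement v - L x v, where L x,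
   defined below, is the inverse of the identity plus the differential of w at x. *)
Let c x v j := \sum_k invmx (M x) j k * 'D_v (wc k) x.

Let cE x v j : O x -> c x v j + \sum_k c x v k * 'D_(e k) (wc j) x = 'D_v (wc j) x.
Proof.
move=> Ox; pose C : 'cV_m := \col_k c x v k; pose b : 'cV_m := \col_k 'D_v (wc k) x.
have CE : C = invmx (M x) *m b.
  by apply/colP => i; rewrite !mxE; apply: eq_bigr => k _; rewrite mxE.
have : M x *m C = b by rewrite CE mulKVmx//; exact: M_unit.
move=> /colP/(_ j); rewrite !mxE => <-.
rewrite [RHS](eq_bigr (fun k => (j == k)%:R * c x v k + c x v k * 'D_(e k) (wc j) x)).
  rewrite big_split/=; congr (_ + _).
  rewrite (bigD1 j)//= eqxx mul1r big1 ?addr0// => k kj.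
  by rewrite eq_sym (negPf kj) mul0r.
by move=> k _; rewrite !mxE mulrDl [in RHS](mulrC (c x v k)).
Qed.

Let L x v := v - \sum_j c x v j *: e j.

Let D_L x v j : O x -> 'D_(L x v) (wc j) x = c x v j.
Proof.
move=> Ox; have := cE v j Ox; rewrite -D_lin// !deriveE; try exact: dwc.
by rewrite /L linearB /= => <-; rewrite addrK.
Qed.

Let L_linear x : O x -> linear (L x).
Proof.
move=> Ox a u v.
have cl j : c x (a *: u + v) j = a * c x u j + c x v j.
  rewrite /c mulr_sumr -big_split/=; apply: eq_bigr => k _.
  by rewrite !deriveE ?linearP; try exact: dwc; rewrite mulrDr mulrCA.
rewrite /L scalerBr addrACA -opprD scaler_sumr -big_split/=; congr (_ - _).
by apply: eq_bigr => j _; rewrite cl scalerDl scalerA.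
Qed.

Let L_continuous x : O x -> continuous (L x).
Proof.
move=> Ox v; apply: cvgB; first exact: cvg_id.
move: v; apply: continuous_big => [|j _ v]; first exact: add_continuous.
apply: cvgZr_tmp; move: v; apply: continuous_big => [|k _ v].
  exact: add_continuous.
apply: cvgM; first exact: cvg_cst.
have cD : continuous (fun u : E => 'D_u (wc k) x).
  rewrite (_ : (fun u : E => _) = 'd (wc k) x).
    exact: (diff_continuous (dwc k Ox)).
  by apply/funext => u; rewrite deriveE//; exact: dwc.
exact: cD.
Qed.

Let sigma_differentiable y : O' y ->
  differentiable sigma y /\ 'd sigma y = L (sigma y) :> (E -> E).
Proof.
move=> Oy; have Ox := sigmaO Oy; set x := sigma y in Ox *.
pose T v := \sum_j 'D_v (wc j) x *: e j.
have TL v : L x v + T (L x v) = v.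
  by rewrite /T; under eq_bigr do rewrite D_L//; rewrite subrK.
have [dw dwE] : differentiable w x /\ 'd w x = T :> (E -> E).
  have [dS dSE] := differentiable_combination e (fun j => dwc j Ox).
  have nE : \near x, \sum_j wc j x *: e j = w x.
    by apply: filterS (open_near oO Ox) => z /wE.
  have dw := near_eq_differentiable nE dS; split=> //.
  by apply/funext => v; rewrite -deriveE// -(near_eq_derive v nE) dSE.
apply: differentiableW; [exact: L_linear|exact: L_continuous|move=> eps eps0].
have eps4 : 0 < eps / 4 by rewrite divr_gt0.
have [r r0 wr] := near_ball (differentiable_littleo dw eps4).
have nr : \forall h \near (0 : E), `|0 - h| < r / 2.
  by apply: (@cvgr_dist_lt _ E _ (nbhs 0) _ id 0); rewrite ?divr_gt0//; exact: cvg_id.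
have nO : \forall h \near (0 : E), O' (h + y).
  by have := open_near oO' Oy; rewrite (near_shift 0) /= subr0.
near=> h.
have hr : `|0 - h| < r / 2 by near: h.
have Oh : O' (h + y) by near: h.
pose k := sigma (h + y) - x.
have kh : `|k| <= 2 * `|h|.
  by have := sigma_lip (h + y) y; rewrite addrK.
have kr : `|0 - k| < r by move: hr; rewrite !sub0r !normrN; lra.
have := wr k kr; rewrite dwE /k subrK.
have hE : k + (w (sigma (h + y)) - w x) = h.
  by rewrite /k addrACA -opprD sigmaE// sigmaE// addrK.
rewrite -/k -/(k - _); set W := w _ - w x in hE * => Wk.
pose r1 := k - L x h.
have Tadd u v : T (u - v) = T u - T v.
  by rewrite -dwE linearB.
have r1E : r1 + T r1 = - (W - T k).
  rewrite opprB /r1 Tadd addrACA -opprD TL -[X in _ - X]hE opprD addrA.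
  by rewrite [k + T k]addrC addrK.
rewrite -/r1.
have Tr1 : `|T r1| <= 2^-1 * `|r1| by exact: dwle.
have : `|r1| <= `|r1 + T r1| + `|T r1|.
  by rewrite -{1}(addrK (T r1) r1) ler_normB.
rewrite r1E normrN; have := normr_ge0 h; nra.
Unshelve. all: by end_near. Qed.

(** The derivatives of the components of the inverse solve a linear system, with
    invertible matrix, whose coefficients are smooth functions composed with the
    inverse; by Cramer's rule, one order of differentiability is gained at each
    step. *)
Lemma smooth_inverse_coeff j : smooth_on O' (fun y => wc j (sigma y)).
Proof.
move=> k; elim: k j => [|k IH] j.
  move=> y Oy; apply: continuous_comp.
    by have [ds _] := sigma_differentiable Oy; exact: differentiable_continuous.
  exact: smooth_continuous (swc j) (sigmaO Oy).
have comp (f : E -> R) : Ck k O f -> Ck k O' (fun y => f (sigma y)).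
  move=> Cf; pose s y := y + \sum_j (- wc j (sigma y)) *: e j.
  have sE y : O' y -> sigma y = s y.
    move=> Oy; rewrite /s; under eq_bigr do rewrite scaleNr.
    rewrite sumrN -wE; last exact: sigmaO.
    by apply/eqP; rewrite eq_sym subr_eq sigmaE.
  apply: (@Ck_ext _ _ k O' (fun y => f (s y))) => //.
    by move=> y /sE ->.
  apply: Ck_comp Cf => //; first by move=> y Oy; rewrite -sE//; exact: sigmaO.
  apply: smap_add; first by apply: smap_lin => // x; exact: cvg_id.
  elim: (index_enum _) => [|i r IHr].
    by under eq_fun do rewrite big_nil; exact: smap_cst.
  under eq_fun do rewrite big_cons; apply: smap_add => //.
  by apply: smap_scale; exact: Ck_opp.
split=> [y Oy|v].
  apply: differentiable_comp; last exact: dwc (sigmaO Oy).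
  by have [] := sigma_differentiable Oy.
apply: (@Ck_ext _ _ k O' (fun y => c (sigma y) v j)) => //.
  move=> y Oy; have [ds dsE] := sigma_differentiable Oy.
  have Ox := sigmaO Oy.
  rewrite (@derive_comp _ _ _ _ (wc j) sigma)//; last exact: dwc.
  by rewrite deriveE// dsE -deriveE ?D_L//; exact: dwc.
apply: Ck_sum => // i _; apply: Ck_mul => //; last first.
  exact: comp (smooth_derive v (swc i) k).
apply: (@Ck_invmx _ k O' m (fun y => M (sigma y))) => // [y /sigmaO/M_unit//|a b].
rewrite (_ : (fun y => _) = fun y => (a == b)%:R + 'D_(e b) (wc a) (sigma y)).
  by apply: Ck_add => //; [exact: Ck_cst|exact: comp (smooth_derive (e b) (swc a) k)].
by apply/funext => y; rewrite !mxE.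
Qed.

End SmoothInverse.

(** * The circle and lifts *)

Lemma continuous_pair_at (T U W : topologicalType) (f : T -> U) (g : T -> W) x :
  {for x, continuous f} -> {for x, continuous g} ->
  {for x, continuous (fun t => (f t, g t))}.
Proof. by move=> cf cg; exact: cvg_pair cf cg. Qed.

Lemma continuous_near (T U : topologicalType) (f : T -> U) x (P : U -> Prop) :
  {for x, continuous f} -> (\forall y \near f x, P y) -> \forall y \near x, P (f y).
Proof. by move=> cf; exact: cf. Qed.

Section Circle.
Variable R : realType.
Local Notation cpi := (@cpi R).

Lemma cpi_eqP (x y : R) : cpi x = cpi y <-> exists k : int, x = y + k%:~R.
Proof.
split=> [/eqmodP/intrP[k xy]|[k ->]].
  by exists k; rewrite -xy addrC subrK.
apply/eqmodP; rewrite /= /int_diff addrAC subrr add0r; exact: intr_int.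
Qed.

Lemma cpi_addz (x : R) (k : int) : cpi (x + k%:~R) = cpi x.
Proof. by apply/cpi_eqP; exists k. Qed.

Lemma cpi_repr (x : circle R) : cpi (repr x) = x.
Proof. exact: reprK. Qed.

Lemma cpi_continuous : continuous cpi.
Proof. exact: pi_continuous. Qed.

Lemma circle_continuousP (T : topologicalType) (f : circle R -> T) :
  continuous f <-> continuous (fun x => f (cpi x)).
Proof. exact: quotient_continuous. Qed.

Lemma near_shift_real (x k : R) (A : set R) :
  nbhs x A -> nbhs (x + k) [set y | A (y - k)].
Proof.
move=> nA; have : {for x + k, continuous (fun y => y - k)}.
  by apply: cvgB; [exact: cvg_id|exact: cvg_cst].
by move/(_ A); apply; rewrite addrK.
Qed.

Lemma cpi_open (x : R) (A : set R) : nbhs x A -> nbhs (cpi x) (cpi @` A).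
Proof.
rewrite nbhsE => -[U [oU Ux] UA]; rewrite nbhsE.
exists (cpi @` U); last exact: image_subset; split; last by exists x.
rewrite /open /= /quotient_open openE => y /= [z Uz zy].
have [k ->] : exists k : int, y = z + k%:~R by apply/cpi_eqP.
have : nbhs z U by apply: open_nbhs_nbhs.
move=> /near_shift_real-/(_ k%:~R); rewrite /interior; apply: filterS => t Ut.
by exists (t - k%:~R) => //; apply/cpi_eqP; exists (- k); rewrite mulrNz.
Qed.

Definition cadd (x : circle R) (r : R) : circle R := cpi (repr x + r).

Lemma cadd_cpi x r : cadd (cpi x) r = cpi (x + r).
Proof.
have [k E] : exists k : int, repr (cpi x) = x + k%:~R.
  by apply/cpi_eqP; rewrite cpi_repr.
by rewrite /cadd E addrAC cpi_addz.
Qed.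

Lemma cadd0 x : cadd x 0 = x.
Proof. by rewrite /cadd addr0 cpi_repr. Qed.

(** The difference of the two lifts is continuous with integer values. *)
Lemma lift_unique (T : topologicalType) (z0 : T) (f g : T -> R) :
  {for z0, continuous f} -> {for z0, continuous g} ->
  (\forall z \near z0, cpi (f z) = cpi (g z)) ->
  exists k : int, \forall z \near z0, f z = g z + k%:~R.
Proof.
move=> cf cg fg; have /cpi_eqP[k fgk] := nbhs_singleton fg.
exists k; have cd : {for z0, continuous (fun z => f z - g z)} by exact: cvgB.
have nd : \forall z \near z0, `|(f z0 - g z0) - (f z - g z)| < 1.
  by move/cvgrPdist_lt : cd; apply.
apply: filterS2 fg nd => z /cpi_eqP[l ->].
rewrite fgk (addrC (g z0)) addrK (addrC (g z)) addrK -intrB => lt1.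
have [->//|/negP ne] := eqVneq l k; first by rewrite addrC.
have := @norm_intr_ge1 R (k - l)%:~R (intr_int _ _).
rewrite intr_eq0 subr_eq0 eq_sym; move: lt1; rewrite ltNge => /negP lt1.
by move=> /(_ (introN idP ne)).
Qed.

Lemma cvelocity_lift (c : R -> circle R) (t0 a : R) (g : R -> R) :
  cvelocity c t0 a -> {for t0, continuous g} ->
  (\forall t \near t0, c t = cpi (g t)) -> is_derive t0 1 g a.
Proof.
move=> [h [ch dh]] cg cgE.
have cth : {for t0, continuous h}.
  by apply: differentiable_continuous; apply/derivable1_diffP; case: dh.
have [|k gh] := lift_unique cg cth; first by apply: filterS2 ch cgE => t -> <-.
have dhk : is_derive t0 1 (fun t => h t + k%:~R) a.
  rewrite -[a]addr0.
  exact: (@is_deriveD _ _ _ h (cst k%:~R) t0 1 a 0 dh (is_derive_cst _ _ _)).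
by apply: near_eq_is_derive dhk; apply: filterS gh => t ->.
Qed.

Lemma cvelocity_unique (c : R -> circle R) (t0 a b : R) :
  cvelocity c t0 a -> cvelocity c t0 b -> a = b.
Proof.
move=> ca [h [ch dh]].
have [_ <-] : is_derive t0 1 h a.
  apply: cvelocity_lift ca _ ch.
  by apply: differentiable_continuous; apply/derivable1_diffP; case: dh.
by have [_ <-] := dh.
Qed.

Lemma glue_continuous (T U : topologicalType) (F : T -> U) (z : T) (A B : set T) :
  (\forall y \near z, A y \/ B y) ->
  (forall N, nbhs (F z) N -> \forall y \near z, A y -> N (F y)) ->
  (forall N, nbhs (F z) N -> \forall y \near z, B y -> N (F y)) ->
  {for z, continuous F}.
Proof.
move=> AB cA cB N nN.
by apply: filterS3 AB (cA N nN) (cB N nN) => y [Ay /(_ Ay)|By _ /(_ By)].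
Qed.

End Circle.

(** * The covering of the base *)

Section Cover.
Variables (R : realType) (n : nat).
Local Notation cpi := (@cpi R).
Local Notation proj := (@Defs.proj R n).
Implicit Types q : 'rV[R]_n.

Lemma projE q i : proj q 0 i = cpi (q 0 i).
Proof. by rewrite mxE. Qed.

Lemma proj_continuous : continuous proj.
Proof.
move=> q N [P nP PN]; exists (fun i j => [set x | P i j (cpi x)]).
  move=> i j; have := nP i j; rewrite !mxE; exact: cpi_continuous.
by move=> q' qP; apply: PN => i j; rewrite mxE; exact: qP.
Qed.

Lemma proj_open q (A : set 'rV[R]_n) : nbhs q A -> nbhs (proj q) (proj @` A).
Proof.
move=> [P nP PA]; exists (fun i j => cpi @` P i j).
  by move=> i j; rewrite mxE; exact: cpi_open.
move=> p pP; have ex j : exists x, P 0 j x /\ cpi x = p 0 j.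
  by have [x Px xp] := pP 0 j; exists x.
have [x xP] := choice ex.
exists (\row_j x j); last by apply/rowP => j; rewrite !mxE (xP j).2.
by apply: PA => i j; rewrite ord1 mxE; exact: (xP j).1.
Qed.

Lemma continuous_nextpt i : continuous (fun q => nextpt q i).
Proof.
have c : continuous (fun q : 'rV[R]_n => q 0 (ordS i) + (i.+1 == n)%:R).
  have c0 : continuous (fun q : 'rV[R]_n => q 0 (ordS i)) by exact: coord_continuous.
  by move=> q; exact: cvgD (c0 q) (cvg_cst _).
exact: c.
Qed.

Lemma Bcover_near q : Bcover q -> \forall q' \near q, Bcover q'.
Proof.
move=> Bq; suff: \forall q' \near q, forall i, (q' : 'rV[R]_n) 0 i < nextpt q' i by [].
suff h i : \forall q' \near q, (q' : 'rV[R]_n) 0 i < nextpt q' i.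
  exact: (@filter_forall _ _ _ (nbhs q) _ h).
have cg : {for q, continuous (fun q => nextpt q i - q 0 i)}.
  have cc : continuous (fun q : 'rV[R]_n => q 0 i) by exact: coord_continuous.
  exact: cvgB (@continuous_nextpt i q) (cc q).
have : \forall q' \near q, 0 < nextpt q' i - q' 0 i.
  by apply: (cvgr_gt _ cg); rewrite subr_gt0.
by apply: filterS => q'; rewrite subr_gt0.
Qed.

Lemma Bcover_open : open (@Bcover R n).
Proof. by rewrite openE => q Bq; exact: Bcover_near. Qed.

Lemma Bset_proj q : Bcover q -> Bset (proj q).
Proof. by exists q. Qed.

Lemma Bset_open : open (@Bset R n).
Proof.
rewrite openE => p [q Bq <-].
have := proj_open (Bcover_near Bq); rewrite /interior; apply: filterS.
by move=> p' [q' Bq' <-]; exists q'.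
Qed.

Lemma nextpt_shift q (c : R) i : nextpt (q + const_mx c) i = nextpt q i + c.
Proof. by rewrite /nextpt !mxE addrAC. Qed.

Lemma Bcover_shift q (c : R) : Bcover (q + const_mx c) <-> Bcover q.
Proof.
have H q' c' : Bcover q' -> Bcover (q' + const_mx c').
  by move=> Bq i; rewrite nextpt_shift !mxE ltrD2r.
split=> [/(H _ (- c))|/H//]; rewrite -addrA -raddfD/= subrr.
by rewrite (_ : const_mx 0 = 0) ?addr0//; apply/rowP => i; rewrite !mxE.
Qed.

Lemma proj_shift q (k : int) : proj (q + const_mx k%:~R) = proj q.
Proof. by apply/rowP => i; rewrite !mxE cpi_addz. Qed.

Lemma nextptS q (i : 'I_n) : (i.+1 < n)%N -> nextpt q i = q 0 (ordS i).
Proof. by move=> lt; rewrite /nextpt (ltn_eqF lt) addr0. Qed.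

Lemma Bcover_mono q (i j : 'I_n) : Bcover q -> (i <= j)%N -> q 0 i <= q 0 j.
Proof.
move=> Bq; case: j => j; elim: j => [|j IH] ltj /=.
  by rewrite leqn0 => /eqP i0; rewrite (_ : i = Ordinal ltj)//; exact: val_inj.
rewrite leq_eqVlt => /orP[/eqP ij|]; first by rewrite (_ : i = Ordinal ltj)//; exact: val_inj.
rewrite ltnS => ij; have ltj' := ltnW ltj.
apply: le_trans (IH ltj' ij) _; apply: ltW.
have := Bq (Ordinal ltj'); rewrite nextptS//.
by congr (_ < q _ _); apply: val_inj; rewrite /= modn_small.
Qed.

Lemma Bcover_lt1 q (i j : 'I_n) : Bcover q -> q 0 j < q 0 i + 1.
Proof.
move=> Bq; have n0 : (0 < n)%N by case: (i) => m; case: n.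
have lt : (n.-1 < n)%N by rewrite prednK.
apply: (@le_lt_trans _ _ (q 0 (Ordinal lt))).
  by apply: Bcover_mono => //=; rewrite -ltnS prednK.
apply: (@lt_le_trans _ _ (q 0 (Ordinal n0) + 1)); last by rewrite lerD2r; apply: Bcover_mono.
have := Bq (Ordinal lt); rewrite /nextpt /= prednK// eqxx.
congr (_ < q _ _ + _); apply: val_inj; rewrite /= prednK// modnn//.
Qed.

(** Two lifts differ by an integer in each coordinate; these integers are all equal
    because the coordinates of each lift lie in an interval of length less than 1. *)
Lemma proj_Bcover_eq q q' : Bcover q -> Bcover q' -> proj q = proj q' ->
  exists k : int, q' = q + const_mx k%:~R.
Proof.
move=> Bq Bq' E; have [n0|n0] := posnP n.
  by exists 0; apply/rowP => i; have := ltn_ord i; rewrite [X in (_ < X)%N]n0.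
pose o := Ordinal n0.
have ex i : exists k : int, q' 0 i = q 0 i + k%:~R.
  by apply/cpi_eqP; move/rowP: E => /(_ i); rewrite !projE.
have [k kE] := choice ex.
exists (k o); apply/rowP => i; rewrite !mxE kE; congr (_ + _%:~R).
have b1 := @Bcover_lt1 q o i Bq; have b2 := @Bcover_mono q o i Bq (leq0n _).
have c1 := @Bcover_lt1 q' o i Bq'; have c2 := @Bcover_mono q' o i Bq' (leq0n _).
rewrite !kE in c1 c2.
have : (k i - k o)%:~R < (1%:~R : R) by rewrite intrB; lra.
have : ((-1)%:~R : R) < (k i - k o)%:~R by rewrite mulrN1z intrB; lra.
by rewrite !ltr_int; lia.
Qed.

(** After a translation by an integer x lies in [q_1, q_1 + 1), and the arc starts
    at the last coordinate that does not exceed x. *)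
Lemma arc_right q (x : R) : (0 < n)%N -> Bcover q ->
  exists (i : 'I_n) (k : int), q 0 i + k%:~R <= x < nextpt q i + k%:~R.
Proof.
move=> n0 Bq; pose o := Ordinal n0.
pose k := Num.floor (x - q 0 o); pose y := x - k%:~R.
have [y0 y1] : q 0 o <= y /\ y < q 0 o + 1.
  have := floor_itv (x - q 0 o); rewrite -/k intrD /y; lra.
have Po : q 0 o <= y by [].
case: (@arg_maxnP _ o (fun i => q 0 i <= y) (fun i => i : nat) Po) => i yi imax.
exists i, k; rewrite -!lerBrDr -/y yi /= -ltrBlDr -/y.
have [lt|] := ltnP i.+1 n; last first.
  move=> ni; have Ei : i.+1 = n by apply/eqP; rewrite eqn_leq ltn_ord.
  rewrite /nextpt Ei eqxx (_ : ordS i = o)//; apply: val_inj => /=.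
  by rewrite Ei modnn.
rewrite nextptS// ltNge; apply/negP => /imax /=.
by rewrite modn_small// ltnn.
Qed.

Lemma nextpt_pred (i : 'I_n) : exists b : int, forall q,
  nextpt q (ord_pred i) = q 0 i + b%:~R.
Proof.
by exists ((ord_pred i).+1 == n)%:Z => q; rewrite /nextpt ord_predK.
Qed.

Lemma interior_or_break q (x : R) : (0 < n)%N -> Bcover q ->
  exists (i : 'I_n) (k : int),
    q 0 i + k%:~R < x < nextpt q i + k%:~R \/ x = q 0 i + k%:~R.
Proof.
move=> n0 Bq; have [i [k /andP[le lt]]] := arc_right x n0 Bq.
exists i, k; move: le; rewrite le_eqVlt => /orP[/eqP->|->]; first by right.
by left.
Qed.

(** The deck transformations of the covering of the circle. *)
Definition shiftx (k : R) (z : R * 'rV[R]_n) : R * 'rV[R]_n := (z.1 - k, z.2).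

Lemma shiftx_continuous k : continuous (shiftx k).
Proof.
move=> z; apply: (@continuous_pair_at _ _ _ (fun y : R * 'rV[R]_n => y.1 - k) snd).
  by apply: cvgB; [exact: cvg_fst|exact: cvg_cst].
exact: cvg_snd.
Qed.

(** One piece suffices in the interior of an arc, and at a break the two pieces are
    those on its two sides. *)
Lemma pieces_near (z : R * 'rV[R]_n) : (0 < n)%N -> Bcover z.2 ->
  exists (i j : 'I_n) (k l : int),
    [/\ piece i (shiftx k%:~R z), piece j (shiftx l%:~R z) &
    \forall y \near z, piece i (shiftx k%:~R y) \/ piece j (shiftx l%:~R y)].
Proof.
move=> n0 Bz; have [i [k H]] := interior_or_break z.1 n0 Bz.
have nB : \forall y \near z, Bcover y.2 by apply: cvg_snd; exact: Bcover_near.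
have cx : {for z, continuous (fun y : R * 'rV[R]_n => y.1 - k%:~R)}.
  by apply: cvgB; [exact: cvg_fst|exact: cvg_cst].
have cq j : {for z, continuous (fun y : R * 'rV[R]_n => y.2 0 j)}.
  apply: (@continuous_comp _ _ _ snd (fun q : 'rV[R]_n => q 0 j)); first exact: cvg_snd.
  exact: coord_continuous.
have cn j : {for z, continuous (fun y : R * 'rV[R]_n => nextpt y.2 j)}.
  apply: (@continuous_comp _ _ _ snd (fun q : 'rV[R]_n => nextpt q j)); first exact: cvg_snd.
  exact: continuous_nextpt.
case: H => [/andP[h1 h2]|zE].
  exists i, i, k, k; have pz : piece i (shiftx k%:~R z).
    by split=> //=; rewrite lerBrDr lerBlDr !ltW.
  split=> //.
  have d1 : \forall y \near z, 0 < y.1 - k%:~R - (y.2 : 'rV[R]_n) 0 i.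
    by apply: (cvgr_gt _ (cvgB cx (cq i))); rewrite subr_gt0 ltrBrDr.
  have d2 : \forall y \near z, 0 < nextpt y.2 i - (y.1 - k%:~R).
    by apply: (cvgr_gt _ (cvgB (cn i) cx)); rewrite subr_gt0 ltrBlDr.
  apply: filterS3 nB d1 d2 => y By; rewrite !subr_gt0 => y1 y2; left.
  by split=> //=; rewrite !ltW.
have [b bE] := nextpt_pred i; pose j := ord_pred i.
exists i, j, k, (k - b); split.
- by split=> //=; rewrite zE addrK lexx ltW.
- split=> //=; have := Bz j; rewrite bE zE intrB => h.
  by apply/andP; split; lra.
have d1 : \forall y \near z, 0 < nextpt y.2 i - (y.1 - k%:~R).
  apply: (cvgr_gt _ (cvgB (cn i) cx)); rewrite subr_gt0 zE addrK; exact: Bz.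
have d2 : \forall y \near z, 0 < y.1 - k%:~R + b%:~R - (y.2 : 'rV[R]_n) 0 j.
  have cb : {for z, continuous (fun y : R * 'rV[R]_n => y.1 - k%:~R + b%:~R)}.
    by apply: cvgD => //; exact: cvg_cst.
  apply: (cvgr_gt _ (cvgB cb (cq j))).
  by rewrite subr_gt0 zE addrK -bE; exact: Bz.
apply: filterS3 nB d1 d2 => y By; rewrite !subr_gt0 => y1 y2.
have [le|/ltW ge] := leP (y.2 0 i) (y.1 - k%:~R); [left|right]; split=> //=.
  by rewrite le ltW.
by rewrite bE intrB opprB addrCA [b%:~R + _]addrC (ltW y2) lerD2r.
Qed.

(** The continuity that is assumed along each piece glues, since two pieces cover a
    neighbourhood of each point up to deck transformations. *)
Lemma pieces_continuous (T : topologicalType) (F : R * 'rV[R]_n -> T) :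
  (0 < n)%N ->
  (forall z (k : int), F (shiftx k%:~R z) = F z) ->
  (forall i z, piece i z -> forall N, nbhs (F z) N ->
     \forall y \near z, piece i y -> N (F y)) ->
  forall z, Bcover z.2 -> {for z, continuous F}.
Proof.
move=> n0 per pc z Bz; have [i [j [k [l [pi pj nij]]]]] := pieces_near n0 Bz.
apply: glue_continuous nij _ _ => N nN.
  have := pc i _ pi N; rewrite per => /(_ nN).
  move=> /(continuous_near (@shiftx_continuous k%:~R z)); apply: filterS => y.
  by rewrite per.
have := pc j _ pj N; rewrite per => /(_ nN).
move=> /(continuous_near (@shiftx_continuous l%:~R z)); apply: filterS => y.
by rewrite per.
Qed.

Lemma arcs_continuous (T : topologicalType) (q : 'rV[R]_n) (F : R -> T) :
  (0 < n)%N -> Bcover q ->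
  (forall x (k : int), F (x - k%:~R) = F x) ->
  (forall i x, q 0 i <= x <= nextpt q i -> forall N, nbhs (F x) N ->
     \forall y \near x, q 0 i <= y <= nextpt q i -> N (F y)) ->
  continuous F.
Proof.
move=> n0 Bq per pc x.
have cp : {for x, continuous (fun y : R => (y, q))}.
  by apply: continuous_pair_at; [exact: cvg_id|exact: cvg_cst].
have [i [j [k [l [[_ pi] [_ pj] nij]]]]] := @pieces_near (x, q) n0 Bq.
have cs (m : int) : {for x, continuous (fun y : R => y - m%:~R)}.
  by apply: cvgB; [exact: cvg_id|exact: cvg_cst].
apply: glue_continuous (continuous_near cp nij) _ _ => N nN.
  have := pc i _ pi N; rewrite per => /(_ nN) /(continuous_near (cs k)).
  by apply: filterS => y; rewrite per => H [_]; exact: H.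
have := pc j _ pj N; rewrite per => /(_ nN) /(continuous_near (cs l)).
by apply: filterS => y; rewrite per => H [_]; exact: H.
Qed.

Definition pproj (z : R * 'rV[R]_n) : circle R * config R n := (cpi z.1, proj z.2).

Lemma pproj_continuous : continuous pproj.
Proof.
move=> z; apply: (@continuous_pair_at _ _ _ (fun y : R * 'rV[R]_n => cpi y.1)
  (fun y : R * 'rV[R]_n => proj y.2)).
  by apply: (@continuous_comp _ _ _ fst cpi); [exact: cvg_fst|exact: cpi_continuous].
by apply: (@continuous_comp _ _ _ snd proj); [exact: cvg_snd|exact: proj_continuous].
Qed.

(** The covering is open, and its image is an open subset of the space of all
    configurations. *)
Lemma within_S1BP (T : topologicalType) (F : circle R * config R n -> T) :
  {within S1B, continuous F} <->
  forall z, Bcover z.2 -> {for z, continuous (fun z => F (pproj z))}.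
Proof.
have oS : open (@S1B R n).
  rewrite openE => -[x p] /= Bp; rewrite /interior.
  have : nbhs (x, p) (snd @^-1` (@Bset R n)).
    by apply: cvg_snd; exact: (open_nbhs_nbhs (conj Bset_open Bp)).
  exact.
split=> [/subspace_continuousP cF z Bz|cF].
  apply: (@continuous_comp _ _ _ pproj F); first exact: pproj_continuous.
  have Sz : S1B (pproj z) by exact: Bset_proj.
  have := cF _ Sz; rewrite within_interior//.
  exact: open_nbhs_nbhs (conj oS Sz).
apply/subspace_continuousP => -[x p] Sz.
rewrite within_interior; last exact: open_nbhs_nbhs (conj oS Sz).
case: Sz => q /= Bq <-; rewrite -(cpi_repr x) => N nN.
have : nbhs (repr x, q) [set z | N (F (pproj z))] by apply: (cF (repr x, q)).
move=> [[A B] [/= nA nB] AB]; exists (cpi @` A, proj @` B).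
  by split; [exact: cpi_open|exact: proj_open].
by move=> [_ _] /= [[a Aa <-] [b Bb <-]]; exact: (AB (a, b)).
Qed.

End Cover.

(** * Arrows of the form x + c u(x) *)

Section CompactBound.
Variable R : realType.

(** A family of conditions that holds for all large constants locally holds for all
    large constants globally. *)
Lemma compact_bound (T : topologicalType) (K : set T) (P : R -> T -> Prop) :
  compact K ->
  (forall z, K z -> exists c0, \forall z' \near z, forall c, c0 <= c -> K z' -> P c z') ->
  exists c1, forall c z, c1 <= c -> K z -> P c z.
Proof.
move=> /compact_near_coveringP/near_covering_withinP cK loc.
have : \forall c \near +oo, K `<=` P c.
  apply: cK => z /loc[c0 nz].
  exists ([set z' | forall c, c0 <= c -> K z' -> P c z'], [set c | c0 <= c]).
    by split=> //=; apply: nbhs_pinfty_ge; exact: num_real.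
  by move=> [z' c] /= [H c0c] Kz'; exact: H.
move=> [M [_ MP]]; exists (M + 1) => c z Mc Kz; apply: MP => //.
by rewrite (lt_le_trans _ Mc)// ltrDl.
Qed.

Lemma lipschitz_continuous (V W : normedModType R) (f : V -> W) (k : R) :
  (forall x y, `|f x - f y| <= k * `|x - y|) -> continuous f.
Proof.
move=> fk x; apply/cvgrPdist_lt => e e0.
have k1 : 0 < `|k| + 1 by rewrite ltr_wpDl.
have nx : \forall y \near x, `|x - y| < e / (`|k| + 1).
  by apply: (@cvgr_dist_lt _ V _ (nbhs x) _ id x) => //; rewrite divr_gt0.
apply: filterS nx => y; rewrite ltr_pdivlMr// => xy.
rewrite (le_lt_trans (fk _ _))// (le_lt_trans _ xy)// mulrC ler_wpM2l//.
by rewrite (le_trans (ler_norm _))// lerDl.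
Qed.

Lemma derive_dir1 (f : R -> R) x v : differentiable f x ->
  'D_v f x = v * 'D_1 f x.
Proof.
by move=> df; rewrite -{1}[v]mulr1 -[v * 1]/(v *: (1 : R)) derive_scale_dir.
Qed.

(** A function that is Lipschitz with constant [L] around each point of the line,
    in the pointwise sense, is Lipschitz: the supremum of the points up to which
    the inequality holds cannot be interior. *)
Lemma pointwise_lipschitz (f : R -> R) (L : R) :
  (forall x, \forall y \near x, `|f y - f x| <= L * `|y - x|) ->
  forall x y, `|f x - f y| <= L * `|x - y|.
Proof.
move=> loc.
suff H x y : x <= y -> `|f y - f x| <= L * (y - x).
  move=> x y; have [xy|/ltW yx] := leP x y.
    by rewrite distrC (distrC x) [`|y - x|]ger0_norm ?subr_ge0// H.
  by rewrite [`|x - y|]ger0_norm ?subr_ge0// H.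
move=> xy; pose A := [set s | x <= s <= y /\ `|f s - f x| <= L * (s - x)].
have Ax : A x by split; rewrite ?lexx// !subrr normr0 mulr0.
have supA : has_sup A by split; [exists x|exists y => s [/andP[_]]].
pose m := sup A.
have xm : x <= m by apply: ub_le_sup => //; case: supA.
have my : m <= y by apply: ge_sup; [exists x|move=> s [/andP[]]].
have [r r0 br] := near_ball (loc m).
have Am : A m.
  have [s As sm] := sup_adherent r0 supA.
  have sm' : s <= m by apply: ub_le_sup => //; case: supA.
  split; first by rewrite xm.
  case: As => /andP[xs sy] As.
  have := br s; rewrite ger0_norm ?subr_ge0// ltrBlDr -ltrBlDl => /(_ sm).
  rewrite distrC (distrC s m) [`|m - s|]ger0_norm ?subr_ge0// => h.
  have := ler_distD (f s) (f m) (f x); nra.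
case: (ltgtP m y) my => // [my _|my _]; last by rewrite -my; case: Am.
pose s := Num.min (m + r / 2) y.
have ms : m < s by rewrite /s lt_min my andbT ltrDl divr_gt0.
have sr : s <= m + r / 2 by rewrite /s ge_min lexx.
have As : A s.
  split; first by rewrite (ltW (le_lt_trans xm ms)) /s ge_min lexx orbT.
  have := br s; rewrite ltr0_norm ?subr_lt0// opprB => /(_ ltac:(lra)).
  rewrite [`|s - m|]gtr0_norm ?subr_gt0// => h; case: Am => _ Am.
  have := ler_distD (f m) (f s) (f x); nra.
have : s <= m by apply: ub_le_sup => //; case: supA.
by rewrite leNgt ms.
Qed.

(** The inverse function theorem in one variable. The perturbation [f] is composed with
    the retraction onto a small interval around [a], which makes it contractive on
    the whole line. *)
Lemma local_inverse (N : set R) (f : R -> R) (a : R) : open N -> N a ->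
  smooth_on N f -> `|'D_1 f a| <= 4^-1 ->
  exists (O O' : set R) (h : R -> R),
    [/\ open O, O a, open O' & smooth_on O' h] /\
    [/\ O `<=` N, O' (a + f a) &
      forall x, O x -> h (x + f x) = x].
Proof.
move=> oN Na sf fa.
have n1 : \forall x \near a, `|'D_1 f x| < 2^-1.
  have cD := smooth_continuous (smooth_derive (1 : R) sf) Na.
  have cn : {for a, continuous (fun x => `|'D_1 f x|)} by exact: cvg_norm.
  by apply: (cvgr_lt _ cn); rewrite (le_lt_trans fa)// ltf_pV2 ?posrE// ltr_nat.
have [r r0 br] := near_ball (filterI (open_near oN Na) n1).
pose rho := r / 2.
have rho0 : 0 < rho by rewrite divr_gt0.
have rhor : rho < r by rewrite /rho; lra.
pose clip (x : R) := Num.max (a - rho) (Num.min (a + rho) x).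
have clip_in x : `|a - clip x| <= rho.
  rewrite /clip ler_distlC; apply/andP; split; first by rewrite le_max lexx.
  by rewrite ge_max ge_min lexx andbT; lra.
have clip_lip x y : `|clip x - clip y| <= `|x - y|.
  suff H s t : s <= t -> 0 <= clip t - clip s <= t - s.
    have [/H/andP[h1 h2]|/ltW yx] := leP x y.
      by rewrite distrC ger0_norm// distrC ger0_norm// (le_trans h1).
    by have /andP[h1 h2] := H _ _ yx; rewrite !ger0_norm// (le_trans h1).
  move=> st; have h0 : a - rho <= a + rho by lra.
  rewrite /clip; case: (leP (a + rho) s) => h1; case: (leP (a + rho) t) => h2;
    rewrite ?(max_r h0); [lra|lra|by case: (leP (a - rho) s) => h3; lra|].
  by case: (leP (a - rho) s) => h3; case: (leP (a - rho) t) => h4; lra.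
have lip_in x y : `|a - x| <= rho -> `|a - y| <= rho -> `|f y - f x| <= 2^-1 * `|y - x|.
  move=> ax ay; have seg s : 0 <= s <= 1 -> `|a - (x + s *: (y - x))| < r.
    move=> /andP[s0 s1]; apply: le_lt_trans rhor.
    rewrite (_ : a - _ = (1 - s) * (a - x) + s * (a - y)); last by rewrite /GRing.scale/=; ring.
    rewrite (le_trans (ler_normD _ _))// !normrM (ger0_norm s0) ger0_norm ?subr_ge0//.
    by nra.
  have [s s01|s s01] := @segment_mvt R R f x (y - x).
    by apply: smooth_differentiable sf _; have [] := br _ (seg s s01).
  rewrite (addrC x) subrK => ->.
  have [Ns Ds] := br _ (seg s s01).
  rewrite derive_dir1.
    by rewrite normrM mulrC ler_wpM2r// ltW.
  exact: smooth_differentiable sf Ns.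
pose w x := f (clip x).
have w_lip x y : `|w x - w y| <= 2^-1 * `|x - y|.
  by rewrite (le_trans (lip_in _ _ _ _))// ler_wpM2l// invr_ge0.
have [sg [sg1 sg2 sg3]] := id_plus_contraction_bijective w_lip.
pose O := [set x | `|a - x| < rho].
have oO : open O.
  rewrite (_ : O = ball a rho); first exact: ball_open.
  by rewrite -ball_normE.
have wO x : O x -> w x = f x.
  move=> /ltW ax; rewrite /w /clip; congr f.
  move: ax; rewrite ler_distlC => /andP[h1 h2].
  by rewrite min_r// max_r.
have ON : O `<=` N by move=> x ax; have [] := br x (lt_trans ax rhor).
have csg : continuous sg by exact: lipschitz_continuous sg3.
pose O' := sg @^-1` O.
have oO' : open O' by apply: open_comp => // x _; exact: csg.
have sw : smooth_on O' (fun y => f (sg y)).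
  apply: (@smooth_inverse_coeff R R 1 (fun=> f) (fun=> 1) w sg O O' oO oO' _ _ _ _ _ _ 0) => //.
  - by move=> x /wO ->; rewrite big_ord1 /GRing.scale/= mulr1.
  - by move=> _; exact: smooth_sub ON sf.
  - move=> x v Ox; rewrite big_ord1 /GRing.scale/= mulr1.
    have [Nx Dx] := br x (lt_trans Ox rhor).
    rewrite derive_dir1.
      by rewrite normrM mulrC ler_wpM2r// ltW.
    exact: smooth_differentiable sf Nx.
exists O, O', (fun y => y + - f (sg y)); split; split=> //.
- by rewrite /O /= subrr normr0.
- apply: smooth_add => //; first by apply: smooth_linear => // x; exact: cvg_id.
  exact: smooth_opp.
- by rewrite /O' /= -wO ?sg2 /O /= subrr normr0.
- by move=> x Ox; rewrite -wO// sg2 wO// addrK.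
Qed.

End CompactBound.

Section Arrows.
Variables (R : realType) (n : nat).
Hypothesis n0 : (0 < n)%N.
Local Notation cpi := (@cpi R).
Local Notation proj := (@Defs.proj R n).

(** A bound on the derivative at [a] that is meaningful at the ends of an arc, where
    [U] itself has no derivative. *)
Definition slope_at (q : 'rV[R]_n) (U : R -> R) (i : 'I_n) (L a : R) : Prop :=
  exists (N : set R) (g : R -> R), [/\ open N, N a, smooth_on N g,
    forall x, q 0 i <= x <= nextpt q i -> N x -> U x = g x & `|'D_1 g a| <= L].

Definition slope_le (q : 'rV[R]_n) (U : R -> R) (L : R) : Prop :=
  forall i a, q 0 i <= a <= nextpt q i -> slope_at q U i L a.

Lemma slope_le_shift q (U : R -> R) L (k : int) :
  (forall x (k : int), U (x + k%:~R) = U x) ->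
  slope_le q U L -> slope_le (q + const_mx k%:~R) U L.
Proof.
move=> per sl i a; rewrite nextpt_shift !mxE => qa.
have [|N [g [oN Na sg Ug ga]]] := sl i (a - k%:~R).
  by rewrite lerBrDr lerBlDr.
have c : continuous (fun x : R => x - k%:~R).
  by move=> x; apply: cvgB; [exact: cvg_id|exact: cvg_cst].
exists [set x | N (x - k%:~R)], (fun x => g (x - k%:~R)); split=> //.
- by apply: open_comp => // x _; exact: c.
- apply: (smooth_comp _ _ _ sg) => //.
    by apply: open_comp => // x _; exact: c.
  apply: smooth_map_add; [exact: smooth_map_id|exact: smooth_map_cst].
- move=> x; rewrite nextpt_shift !mxE => qx Nx.
  by rewrite -Ug//; [rewrite -mulrNz per|rewrite lerBrDr lerBlDr].
- by rewrite derive_translate.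
Qed.

(** The mean value theorem holds on each arc, and every point of the line has a
    neighbourhood covered by translates of two arcs. *)
Lemma slope_le_lipschitz q (U : R -> R) L : Bcover q ->
  (forall x (k : int), U (x + k%:~R) = U x) ->
  continuous U -> slope_le q U L ->
  forall x y, `|U x - U y| <= L * `|x - y|.
Proof.
move=> Bq per cU sl.
have arc i x y : q 0 i <= x -> x <= y -> y <= nextpt q i ->
    `|U y - U x| <= L * (y - x).
  move=> ix; rewrite le_eqVlt => /orP[/eqP<-|xy yi].
    by rewrite !subrr normr0 mulr0.
  have dU s : s \in `]x, y[ -> is_derive s 1 U ('D_1 U s) /\ `|'D_1 U s| <= L.
    rewrite in_itv/= => /andP[xs sy].
    have s_in : q 0 i <= s <= nextpt q i.
      by rewrite (le_trans ix (ltW xs)) (le_trans (ltW sy) yi).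
    have [N [g [oN Ns sg Ug gs]]] := sl i s s_in.
    have n1 : \forall t \near s, x < t < y.
      by apply: near_in_itvoo; rewrite in_itv/= xs.
    have gU : \near s, g s = U s.
      apply: filterS2 (open_near oN Ns) n1 => t Nt /andP[xt ty].
      by rewrite Ug// (le_trans ix (ltW xt)) (le_trans (ltW ty) yi).
    rewrite -(near_eq_derive (1 : R) gU); split=> //; apply: near_eq_is_derive gU _.
    by apply: DeriveDef => //; exact: diff_derivable (smooth_differentiable sg Ns).
  have [||c cxy E] := @MVT R U (fun s => 'D_1 U s) x y xy.
  - by move=> s /dU[].
  - by apply: continuous_subspaceT => s; exact: cU.
  rewrite E normrM (gtr0_norm (_ : 0 < y - x)) ?subr_gt0//.
  by apply: ler_wpM2r; [rewrite subr_ge0 ltW|have [] := dU c cxy].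
have arcn i x y : q 0 i <= x <= nextpt q i -> q 0 i <= y <= nextpt q i ->
    `|U y - U x| <= L * `|y - x|.
  move=> /andP[x1 x2] /andP[y1 y2]; have [xy|/ltW yx] := leP x y.
    by rewrite [`|y - x|]ger0_norm ?subr_ge0//; exact: arc x1 xy y2.
  by rewrite distrC (distrC y) [`|x - y|]ger0_norm ?subr_ge0//; exact: arc y1 yx x2.
have perN x (k : int) : U (x - k%:~R) = U x by rewrite -mulrNz per.
apply: pointwise_lipschitz => x.
have cp : {for x, continuous (fun y : R => (y, q))}.
  by apply: continuous_pair_at; [exact: cvg_id|exact: cvg_cst].
have [i [j [k [l [[_ pi] [_ pj] nij]]]]] := @pieces_near R n (x, q) n0 Bq.
apply: filterS (continuous_near cp nij) => y [[_ py]|[_ py]].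
  by have := arcn i _ _ pi py; rewrite /= !perN opprB addrA subrK.
by have := arcn j _ _ pj py; rewrite /= !perN opprB addrA subrK.
Qed.

(** The lift x + c u(x) is a contractive perturbation of the identity, which gives a
    continuous inverse; on the arcs the inverse is smooth by [local_inverse], applied
    to local extensions of [u] across the ends. *)
Lemma arrow_of_field q (u : circle R -> R) (c L : R) : Bcover q ->
  continuous u -> slope_le q (fun x => u (cpi x)) L -> 0 <= L -> `|c| * L <= 4^-1 ->
  arrow (proj q) (fun x => cadd x (c * u x)).
Proof.
move=> Bq cu sl L0 cL; pose U x := u (cpi x).
have per x (k : int) : U (x + k%:~R) = U x by rewrite /U cpi_addz.
have cU : continuous U by apply/circle_continuousP.
have lU := slope_le_lipschitz Bq per cU sl.
have lw x y : `|c * U x - c * U y| <= 2^-1 * `|x - y|.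
  rewrite -mulrBr normrM (le_trans (ler_wpM2l (normr_ge0 c) (lU x y)))//.
  rewrite mulrA ler_wpM2r// (le_trans cL)// lef_pV2 ?posrE// ler_nat//.
have [sg [sg1 sg2 sg3]] := id_plus_contraction_bijective lw.
pose F x := x + c * U x.
have cF : continuous F.
  by move=> x; apply: cvgD; [exact: cvg_id|apply: cvgM; [exact: cvg_cst|exact: cU]].
have Fper x (k : int) : F (x + k%:~R) = F x + k%:~R by rewrite /F per addrAC.
have sper y (k : int) : sg (y + k%:~R) = sg y + k%:~R.
  have -> : y + k%:~R = F (sg y + k%:~R) by rewrite Fper /F sg1.
  exact: sg2.
have csg : continuous sg by exact: lipschitz_continuous sg3.
have fF x : cadd (cpi x) (c * u (cpi x)) = cpi (F x) by rewrite cadd_cpi.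
pose g (y : circle R) := cpi (sg (repr y)).
have gE y : g (cpi y) = cpi (sg y).
  have [k E] : exists k : int, repr (cpi y) = y + k%:~R.
    by apply/cpi_eqP; rewrite cpi_repr.
  by rewrite /g E sper cpi_addz.
split; first exact: Bset_proj.
  exists g; split.
  - apply/circle_continuousP => x.
    rewrite (_ : (fun x => _) = fun x => cpi (F x)); last exact/funext.
    by apply: (@continuous_comp _ _ _ F cpi); [exact: cF|exact: cpi_continuous].
  - apply/circle_continuousP => x.
    rewrite (_ : (fun x => _) = fun x => cpi (sg x)); last exact/funext.
    by apply: (@continuous_comp _ _ _ sg cpi); [exact: csg|exact: cpi_continuous].
  - by move=> x; rewrite -(cpi_repr x) fF gE sg2.
  - by move=> y; rewrite -(cpi_repr y) gE fF [F _]sg1.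
exists F; split.
  split=> // x y xy; have := lw x y; rewrite ler_norml => /andP[_ +].
  by rewrite ltr0_norm ?subr_lt0// /F; lra.
move=> q' Bq' /esym/proj_Bcover_eq-/(_ Bq Bq')[k q'E] i.
have {}sl : slope_le q' U L by rewrite q'E; exact: slope_le_shift.
split=> [a|].
  rewrite /= in_itv/= => /sl[N [h [oN Na sh Uh _]]].
  exists N, (fun x => x + c * h x); split=> //.
    apply: smooth_add => //; first by apply: smooth_linear => // x; exact: cvg_id.
    by apply: smooth_mul => //; exact: smooth_cst.
  by move=> x; rewrite /= in_itv/= => ax Nx; rewrite /F Uh.
exists sg; split=> [y|x _]; last exact: sg2.
move=> [a /=]; rewrite in_itv/= => a_in <-.
have [N [h [oN Na sh Uh ha]]] := sl i a a_in.
have [|| S [T [v [[oS Sa oT sv] [SN Ta vE]]]]] := @local_inverse R N (fun x => c * h x) a oN Na.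
- by apply: smooth_mul => //; exact: smooth_cst.
- rewrite derive_scale_fun; last exact: smooth_differentiable sh Na.
  by rewrite normrM (le_trans _ cL)// ler_wpM2l.
have FE x : q' 0 i <= x <= nextpt q' i -> S x -> F x = x + c * h x.
  by move=> xi /SN Nx; rewrite /F Uh.
exists (T `&` (sg @^-1` S)), v; split=> //.
- by apply: openI => //; apply: open_comp => // x _; exact: csg.
- by split=> /=; rewrite ?sg2// FE.
- by apply: smooth_sub sv => x [].
- move=> _ [x /= + <-] [_ /=]; rewrite in_itv/= sg2 => xi Sx.
  by rewrite FE// vE.
Qed.

End Arrows.

(** * The tangent spaces to the source fibers *)

Section TangentFiber.
Variables (R : realType) (n : nat).
Hypothesis n0 : (0 < n)%N.
Local Notation cpi := (@cpi R).
Local Notation proj := (@Defs.proj R n).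

Lemma smooth_upto_near (V : normedModType R) (A : set V) (f : V -> R) a
    (N : set R) : smooth_upto A f -> A a -> nbhs (f a) N ->
  \forall y \near a, A y -> N (f y).
Proof.
move=> sf Aa; have [U [g [oU Ua sg fg]]] := sf a Aa.
rewrite fg// => /(continuous_near (smooth_continuous sg Ua)) nN.
by apply: filterS2 (open_near oU Ua) nN => y Uy Ny Ay; rewrite fg.
Qed.

(** The closed arcs are compact. *)
Lemma BVect_slope q (u : circle R -> R) : BVect (proj q) u -> Bcover q ->
  exists2 L, 0 <= L & slope_le q (fun x => u (cpi x)) L.
Proof.
move=> [cu su] Bq; pose U x := u (cpi x).
have ex i : exists c1, forall c a, c1 <= c -> `[q 0 i, nextpt q i]%classic a ->
    slope_at q U i c a.
  apply: compact_bound; first exact: segment_compact.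
  move=> z Kz; have [N [g [oN Nz sg Ug]]] := su q Bq erefl i z Kz.
  exists (`|'D_1 g z| + 1).
  have cD := smooth_continuous (smooth_derive (1 : R) sg) Nz.
  have cn : {for z, continuous (fun x => `|'D_1 g x|)} by exact: cvg_norm.
  have nD : \forall z' \near z, `|'D_1 g z'| < `|'D_1 g z| + 1.
    by apply: (cvgr_lt _ cn); rewrite ltrDl.
  apply: filterS2 (open_near oN Nz) nD => z' Nz' Dz' c cge _.
  exists N, g; split=> //; last by rewrite (le_trans (ltW Dz')).
have [c cP] := choice ex.
exists (\sum_i `|c i|); first exact: sumr_ge0.
move=> i a ai; apply: cP; last by rewrite /= in_itv.
rewrite (le_trans (ler_norm _))// (bigD1 i)//= lerDl; exact: sumr_ge0.
Qed.

(** On a closed arc the curve has local lifts that are smooth in (t, x), and the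
    velocity is their derivative in t. It is continuous since the arcs glue. *)
Lemma tangent_BVect (p : config R n) (u : circle R -> R) : Bset p ->
  tangent_source_fiber p u -> BVect p u.
Proof.
move=> [q0 Bq0 q0p] [f [e e0 [_ f0 sf]] vf].
have su q : Bcover q -> proj q = p -> forall i : 'I_n,
    smooth_upto `[q 0 i, nextpt q i] (fun x => u (cpi x)).
  move=> Bq qp i a; rewrite /= in_itv/= => ai.
  have [|U [g [oU Ua sg fg]]] := sf q Bq qp i (0, a).
    by split=> //=; rewrite normr0.
  pose phi (x : R) : R * R := (0, x); pose v : R * R := (1, 0).
  have sphi S : smooth_map S phi.
    by apply: smooth_map_pair; [exact: smooth_map_cst|exact: smooth_map_id].
  have cphi : continuous phi.
    by move=> x; apply: continuous_pair_at; [exact: cvg_cst|exact: cvg_id].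
  exists (phi @^-1` U), (fun x => 'D_v g (phi x)); split=> //.
  - by apply: open_comp => // x _; exact: cphi.
  - apply: (@smooth_comp R _ _ _ U ('D_v g) phi) => //; last exact: smooth_derive.
    by apply: open_comp => // x _; exact: cphi.
  move=> x; rewrite /= in_itv/= => xi Ux.
  have lineE (t : R) : phi x + t *: v = (t, x).
    by congr pair; rewrite /= /GRing.scale/= ?mulr1 ?mulr0 ?add0r ?addr0.
  have dg : is_derive (0 : R) 1 (fun t : R => g (phi x + t *: v)) ('D_v g (phi x)).
    have := @is_derive_line R _ g (phi x) v 0; rewrite scale0r addr0; apply.
    exact: smooth_differentiable sg Ux.
  have cg : {for (0 : R), continuous (fun t : R => g (phi x + t *: v))}.
    by apply: differentiable_continuous; apply/derivable1_diffP; case: dg.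
  have [_ <-] : is_derive (0 : R) 1 (fun t : R => g (phi x + t *: v)) (u (cpi x)).
    apply: cvelocity_lift (vf (cpi x)) cg _.
    have n1 : \forall t \near (0 : R), `|0 - t| < e.
      by apply: (@cvgr_dist_lt _ R _ (nbhs 0) _ id 0).
    have n2 : \forall t \near (0 : R), U (t, x).
      have ct : {for (0 : R), continuous (fun t : R => (t, x))}.
        by apply: continuous_pair_at; [exact: cvg_id|exact: cvg_cst].
      exact: (continuous_near ct (open_near oU Ux)).
    apply: filterS2 n1 n2 => t; rewrite sub0r normrN => te Ut.
    by rewrite lineE -fg.
  by have [_ ->] := dg.
split=> //; apply/circle_continuousP; apply: (arcs_continuous n0 Bq0).
  by move=> x k; rewrite -mulrNz cpi_addz.
move=> i x xi N nN; have := smooth_upto_near (su q0 Bq0 q0p i) _ nN.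
by rewrite /= in_itv/= => /(_ xi); apply: filterS => y; rewrite /= in_itv.
Qed.

Lemma cvelocity_cadd (x : circle R) (a : R) (h : R -> R) :
  is_derive (0 : R) 1 h a -> cvelocity (fun t => cadd x (h t)) 0 a.
Proof.
move=> dh; exists (fun t : R => repr x + h t); split.
  by apply: (@filterE _ (nbhs (0 : R))) => t.
rewrite -[a]add0r.
exact: (@is_deriveD _ _ _ (cst (repr x)) h (0 : R) 1 0 a (is_derive_cst _ _ _) dh).
Qed.

Lemma is_derive_mull (c : R) : is_derive (0 : R) 1 (fun t => t * c) c.
Proof.
have := @is_deriveM _ _ id (cst c) (0 : R) 1 1 0 (is_derive_id _ _) (is_derive_cst _ _ _).
by rewrite /= scaler0 add0r /GRing.scale/= mulr1.
Qed.

(** The curve is x + t u(x), for |t| less than the inverse of four times a bound on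
    the slopes of u. *)
Lemma BVect_tangent (p : config R n) (u : circle R -> R) : Bset p ->
  BVect p u -> tangent_source_fiber p u.
Proof.
move=> [q0 Bq0 <-] Bu; have [L L0 sl] := BVect_slope Bu Bq0.
have L1 : 0 < 4 * (L + 1) by rewrite mulr_gt0// ltr_wpDl.
exists (fun t x => cadd x (t * u x)).
  exists (4 * (L + 1))^-1; first by rewrite invr_gt0.
  split=> [t te|x|q Bq qq0 i [t x] /= [te xi]].
  - apply: (arrow_of_field n0 Bq0 Bu.1 sl L0).
    have : `|t| * (4 * (L + 1)) <= 1.
      by rewrite -ler_pdivlMr// mul1r ltW.
    have := normr_ge0 t; nra.
  - by rewrite mul0r cadd0.
  have [|N [g [oN Nx sg ug]]] := Bu.2 q Bq qq0 i x; first by rewrite /= in_itv.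
  have oN' : open [set z : R * R | N z.2].
    by apply: open_comp => // z _; exact: cvg_snd.
  have lfst S : smooth_map S (fst : R * R -> R).
    by apply: smooth_map_fst; exact: smooth_map_id.
  have lsnd S : smooth_map S (snd : R * R -> R).
    by apply: smooth_map_snd; exact: smooth_map_id.
  exists [set z | N z.2], (fun z => z.2 + z.1 * g z.2); split=> //.
    apply: smooth_add => //.
      by apply: smooth_linear; [exact: linear_snd|exact: continuous_snd].
    apply: smooth_mul => //.
      by apply: smooth_linear; [exact: linear_fst|exact: continuous_fst].
    exact: (smooth_comp oN' _ (lsnd _) sg).
  move=> [s y] /= [_ yi] Ny; rewrite cadd_cpi; congr (cpi (_ + _ * _)).
  by apply: ug => //=; rewrite in_itv.
move=> x; apply: cvelocity_cadd; exact: is_derive_mull.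
Qed.

Lemma tangent_source_fiberE (p : config R n) : Bset p ->
  tangent_source_fiber p = [set u | BVect p u].
Proof.
by move=> Bp; apply/seteqP; split=> u; [exact: tangent_BVect|exact: BVect_tangent].
Qed.

Lemma dtrg_anchor (p : config R n) (u : circle R -> R) : dtrg p u (anchor p u).
Proof. by move=> f _ vf i; rewrite /trg /anchor !mxE; under eq_fun do rewrite mxE. Qed.

End TangentFiber.

(** * Solving for a curve near the identity *)

Section Coordinates.
Variable R : realType.

(** Both sides are the same limit of difference quotients, whether or not it exists. *)
Lemma derive_line0 (V W : normedModType R) (f : V -> W) (a v : V) :
  'D_v f a = 'D_1 (fun s : R => f (a + s *: v)) 0.
Proof.
have E : (fun h : R => h^-1 *: ((f \o shift a) (h *: v) - f a)) =
    (fun h : R => h^-1 *: (((fun s : R => f (a + s *: v)) \o shift 0) (h *: 1) -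
      f (a + 0 *: v))).
  apply/funext => h; rewrite /= scale0r addr0 addr0 (addrC a).
  by rewrite [h *: (1 : R)]mulr1.
exact: (congr1 (fun g : R -> W => lim (g @ 0^')) E).
Qed.

Lemma derive_slice (V W X : normedModType R) (f : V * W -> X) (a : V) (b w : W) :
  'D_w (fun y => f (a, y)) b = 'D_(0, w) f (a, b).
Proof.
apply: etrans (derive_line0 _ _ _) (etrans _ (esym (derive_line0 _ _ _))).
have -> // : (fun s : R => f (a, b + s *: w)) = (fun s : R => f ((a, b) + s *: (0, w))).
by apply/funext => s; congr (f (_, _)); rewrite /= scaler0 addr0.
Qed.

Lemma derive_slice1 (V W X : normedModType R) (f : V * W -> X) (a v : V) (b : W) :
  'D_v (fun y => f (y, b)) a = 'D_(v, 0) f (a, b).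
Proof.
apply: etrans (derive_line0 _ _ _) (etrans _ (esym (derive_line0 _ _ _))).
have -> // : (fun s : R => f (a + s *: v, b)) = (fun s : R => f ((a, b) + s *: (v, 0))).
by apply/funext => s; congr (f (_, _)); rewrite /= scaler0 addr0.
Qed.

Lemma continuous_slice (T U : topologicalType) (a : T) (z0 : U) :
  {for z0, continuous (fun z => (a, z))}.
Proof. exact: cvg_pair (cvg_cst _) cvg_id. Qed.

Variable m : nat.
Implicit Types v z : 'rV[R]_m.
Local Notation e := (delta_mx 0 : 'I_m -> 'rV[R]_m).

Lemma row_norm_ge v j : `|v 0 j| <= `|v|.
Proof. by rewrite [leRHS]mx_normrE (le_bigmax _ (fun ij : 'I_1 * 'I_m => `|v ij.1 ij.2|) (0, j)). Qed.

Lemma row_norm_le v (d : R) : 0 <= d -> (forall j, `|v 0 j| <= d) -> `|v| <= d.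
Proof.
move=> d0 vd; rewrite [leLHS]mx_normrE; apply: bigmax_le => // -[i j] _.
by rewrite ord1.
Qed.

Lemma derive_coord (X : normedModType R) (f : 'rV[R]_m -> X) z v :
  differentiable f z -> 'D_v f z = \sum_j v 0 j *: 'D_(e j) f z.
Proof.
move=> df; rewrite deriveE// {1}(row_sum_delta v) linear_sum.
by apply: eq_bigr => j _; rewrite linearZ -deriveE.
Qed.

Lemma derive_coord_le (f : 'rV[R]_m -> R) z v (d : R) : differentiable f z ->
  (forall j, `|'D_(e j) f z| <= d) -> `|'D_v f z| <= m%:R * d * `|v|.
Proof.
move=> df dle; rewrite derive_coord// (le_trans (ler_norm_sum _ _ _))//.
rewrite -mulrA mulr_natl.
have -> : d * `|v| *+ m = \sum_(j < m) d * `|v| by rewrite sumr_const card_ord.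
by apply: ler_sum => j _; rewrite normrM mulrC ler_pM// row_norm_ge.
Qed.

Lemma lipschitz_of_partials (f : 'rV[R]_m -> R) z z' (d : R) :
  (forall s : R, 0 <= s <= 1 -> differentiable f (z + s *: (z' - z)) /\
     forall j, `|'D_(e j) f (z + s *: (z' - z))| <= d) ->
  `|f z' - f z| <= m%:R * d * `|z' - z|.
Proof.
move=> H; have [s s01|s s01] := @segment_mvt R _ f z (z' - z).
  by have [] := H s s01.
rewrite (addrC z) subrK => ->; have [df dle] := H s s01.
exact: derive_coord_le.
Qed.

End Coordinates.

Section SolveCurve.
Variables (R : realType) (m : nat).
Local Notation E := 'rV[R]_m.
Local Notation e := (delta_mx 0 : 'I_m -> E).
Variables (W : set (R * E)) (F : 'I_m -> R * E -> R) (z0 : E).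
Hypothesis oW : open W.
Hypothesis Wz0 : W (0, z0).
Hypothesis sF : forall j, smooth_on W (F j).
Hypothesis F0 : forall j z, W (0, z) -> F j (0, z) = z 0 j.

Let G j (tz : R * E) := F j tz - tz.2 0 j.

Let sG j : smooth_on W (G j).
Proof.
apply: smooth_add => //; apply: smooth_opp => //; apply: smooth_linear.
  by move=> a x y; rewrite /= !mxE.
have cc : continuous (fun q : E => q 0 j) by exact: coord_continuous.
by move=> x; apply: (@continuous_comp _ _ _ snd (fun q : E => q 0 j)); [exact: cvg_snd|exact: cc].
Qed.

Let near_slice (P : R * E -> Prop) : (\forall tz \near ((0, z0) : R * E), P tz) ->
  \forall z \near z0, P (0, z).
Proof.
exact: (continuous_near (@continuous_slice R E 0 z0)).
Qed.

Let DG0 j k : 'D_(0, k) (G j) (0, z0) = 0.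
Proof.
rewrite -derive_slice (near_eq_derive (g := cst 0)) ?derive_cst//.
apply: filterS (near_slice (open_near oW Wz0)) => z Wz.
by rewrite /G F0 /= ?subrr.
Qed.

Let DF0 j k : 'D_(0, k) (F j) (0, z0) = k 0 j.
Proof.
rewrite -derive_slice (near_eq_derive (g := fun z : E => z 0 j)).
  apply: derive_linear_fun; first by move=> a x y; rewrite !mxE.
  exact: coord_continuous.
by apply: filterS (near_slice (open_near oW Wz0)) => z Wz; rewrite F0.
Qed.

(** The map (t, z) |-> F(t, z) is the identity at t = 0, so that F(t, .) is a
    contractive perturbation of the identity near z0 for small t, and the preimage
    of z0 is unique near z0. At time 0 it moves with the opposite of the velocity of
    F: it is at distance O(t) from z0, and so the first order expansion of F at
    (0, z0) gives its first order expansion. *)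
Lemma solve_curve : exists zt : R -> E,
  [/\ zt 0 = z0,
      \forall t \near (0 : R), W (t, zt t) /\ forall j, F j (t, zt t) = z0 0 j,
      differentiable zt 0 &
      'D_1 zt 0 = - \row_j 'D_(1, 0) (F j) (0, z0)].
Proof.
pose N : R := m%:R; have N0 : 0 <= N by rewrite /N.
pose d := (2 * (N + 1))^-1.
have NN : 0 < 2 * (N + 1) by rewrite mulr_gt0// ltr_wpDl.
have d0 : 0 < d by rewrite invr_gt0.
have dN : N * d <= 2^-1 by rewrite /d ler_pdivrMr//; lra.
have nD : \forall tz \near ((0, z0) : R * E), forall jk : 'I_m * 'I_m,
    `|'D_(0, e jk.2) (G jk.1) tz| <= d.
  suff h jk : \forall tz \near ((0, z0) : R * E), `|'D_(0, e jk.2) (G jk.1) tz| <= d.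
    exact: (@filter_forall _ _ _ (nbhs ((0, z0) : R * E)) _ h).
  have cD := smooth_continuous (smooth_derive (0, e jk.2) (@sG jk.1)) Wz0.
  have cn : {for (0, z0), continuous (fun tz => `|'D_(0, e jk.2) (G jk.1) tz|)}.
    exact: cvg_norm.
  have : \forall tz \near ((0, z0) : R * E), `|'D_(0, e jk.2) (G jk.1) tz| < d.
    by apply: (cvgr_lt _ cn); rewrite DG0 normr0.
  by apply: filterS => tz /ltW.
have [r r0 br] := near_ball (filterI (open_near oW Wz0) nD).
have inr (t : R) (z : E) : `|t| < r -> `|z - z0| < r -> `|(0, z0) - (t, z)| < r.
  by move=> tr zr; rewrite prod_normE /= gt_max sub0r normrN tr distrC.
pose w (t : R) (z : E) : E := \row_j G j (t, z).
have wE (t : R) (z : E) j : (z + w t z) 0 j = F j (t, z).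
  by rewrite !mxE /G addrC subrK.
pose rho := r / 2.
have rhor : rho < r by rewrite /rho; lra.
have rho0 : 0 < rho by rewrite divr_gt0.
have lw (t : R) : `|t| < r -> forall z z' : E, `|z - z0| <= rho -> `|z' - z0| <= rho ->
    `|w t z - w t z'| <= 2^-1 * `|z - z'|.
  move=> tr z z' zr zr'; apply: row_norm_le; first by rewrite mulr_ge0// invr_ge0.
  move=> j; rewrite !mxE.
  rewrite (le_trans (@lipschitz_of_partials _ _ (fun z => G j (t, z)) _ _ d _))//.
    move=> s /andP[s0 s1].
    have sr : `|(0, z0) - (t, z' + s *: (z - z'))| < r.
      apply: inr => //; apply: le_lt_trans rhor.
      rewrite (_ : _ - z0 = (1 - s) *: (z' - z0) + s *: (z - z0)); last first.
        by apply/rowP => i; rewrite !mxE; ring.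
      rewrite (le_trans (ler_normD _ _))// !normrZ (ger0_norm s0) ger0_norm ?subr_ge0//.
      nra.
    have [Ws Ds] := br _ sr; split=> [|k]; last first.
      by rewrite derive_slice; exact: (Ds (j, k)).
    apply: (@differentiable_comp _ _ _ _ (fun z : E => (t, z)) (G j)).
      by apply: differentiable_pair; [exact: differentiable_cst|exact: ex_diff].
    exact: smooth_differentiable (@sG j) Ws.
  by rewrite ler_wpM2r.
have dF j : differentiable (F j) (0, z0) by exact: smooth_differentiable (@sF j) Wz0.
have dFE j (t : R) (k : E) : 'd (F j) (0, z0) (t, k) = t * 'D_(1, 0) (F j) (0, z0) + k 0 j.
  have -> : (t, k) = t *: ((1, 0) : R * E) + (0, k).
    by congr pair; rewrite /= ?scaler0 ?add0r// addr0 [t *: _]mulr1.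
  by rewrite linearD linearZ -!deriveE// DF0.
pose D := \sum_j `|'D_(1, 0) (F j) (0, z0)|.
have D0 : 0 <= D by exact: sumr_ge0.
have Dj j : `|'D_(1, 0) (F j) (0, z0)| <= D.
  by rewrite /D (bigD1 j)//= lerDl sumr_ge0.
have lo (c : R) : 0 < c -> exists2 s, 0 < s & forall j (t : R) (k : E), `|(t, k)| < s ->
    `|F j (t, k + z0) - z0 0 j - (t * 'D_(1, 0) (F j) (0, z0) + k 0 j)| <= c * `|(t, k)|.
  move=> c0; have h j := differentiable_littleo (dF j) c0.
  have [s s0 sP] := near_ball (@filter_forall _ _ _ (nbhs (0 : R * E)) _ h).
  exists s => // j t k tk; have := sP (t, k); rewrite sub0r normrN => /(_ tk j).
  rewrite dFE (F0 _ Wz0) (_ : (t, k) + (0, z0) = (t, k + z0))//.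
  by congr pair; rewrite /= addr0.
have [r1 r10] := lo 1 ltr01 => br1.
have FE j : F j (0, z0) = z0 0 j by rewrite F0.
pose K := D + 1.
have wz0 (t : R) : `|t| < r1 -> `|w t z0| <= K * `|t|.
  move=> tr1; apply: row_norm_le; first by rewrite mulr_ge0// addr_ge0.
  move=> j; rewrite mxE /G /=.
  have t0 : `|(t, 0 : E)| = `|t| by rewrite prod_normE /= normr0 max_l.
  have := br1 j t 0; rewrite t0 add0r mxE addr0 mul1r => /(_ tr1) h.
  rewrite -(subrK (t * 'D_(1, 0) (F j) (0, z0)) (_ - _)).
  rewrite (le_trans (ler_normD _ _))// /K mulrDl mul1r addrC lerD//.
  by rewrite normrM mulrC ler_wpM2r.
pose Good (t : R) := `|t| < r /\ 2 * `|w t z0| <= rho.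
have ex (t : R) : exists z : E, Good t ->
    [/\ `|z - z0| <= rho, z + w t z = z0 & `|z - z0| <= 2 * `|w t z0|].
  have [[tr wr]|ng] := pselect (Good t); last by exists z0 => /ng.
  have [|z [z1 z2 z3]] := @local_solve R E (w t) z0 z0 rho rho0 (lw t tr).
    by rewrite addrAC subrr add0r normrN; lra.
  by exists z => _; split=> //; move: z3; rewrite addrAC subrr add0r normrN.
have [zt ztP] := choice ex.
have w0 : w 0 z0 = 0 by apply/rowP => j; rewrite !mxE /G FE subrr.
have zt0 : zt 0 = z0.
  have [|_ _] := ztP 0; first by split; rewrite ?w0 normr0 ?mulr0// ltW.
  by rewrite w0 normr0 mulr0 normr_le0 subr_eq0 => /eqP.
have K0 : 0 < K by rewrite ltr_wpDl.
pose r2 := Num.min (Num.min r r1) (rho / (2 * K)).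
have r20 : 0 < r2.
  by rewrite /r2 !lt_min r0 r10 divr_gt0// mulr_gt0.
have r2P (t : R) : `|t| < r2 -> [/\ `|t| < r, `|t| < r1 & Good t].
  rewrite /r2 !lt_min => /andP[/andP[tr tr1] tK]; split=> //; split=> //.
  have := wz0 t tr1; move: tK; rewrite ltr_pdivlMr ?mulr_gt0//; lra.
have ztK (t : R) : `|t| < r2 -> `|zt t - z0| <= 2 * K * `|t|.
  move=> /r2P[_ tr1 /ztP[_ _]]; have := wz0 t tr1; lra.
have Fzt (t : R) : `|t| < r2 -> W (t, zt t) /\ forall j, F j (t, zt t) = z0 0 j.
  move=> /r2P[tr _ /ztP[z1 z2 _]]; split=> [|j]; last by rewrite -wE z2.
  by have [] := br _ (inr _ _ tr (le_lt_trans z1 rhor)).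
have nr2 (s : R) : 0 < s -> \forall t \near (0 : R), `|t| < s.
  move=> s0; have : \forall t \near (0 : R), `|0 - t| < s.
    by apply: (@cvgr_dist_lt _ R _ (nbhs 0) _ id 0).
  by apply: filterS => t; rewrite sub0r normrN.
pose A : E := - \row_j 'D_(1, 0) (F j) (0, z0).
have [dz dzE] : differentiable zt 0 /\ 'd zt 0 = (fun t : R => t *: A) :> (R -> E).
  apply: differentiableW.
  - by move=> a x y; rewrite scalerDl scalerA.
  - exact: scalel_continuous.
  move=> eps eps0.
  pose eps1 := eps / (2 * K + 1).
  have K1 : 0 < 2 * K + 1 by rewrite ltr_wpDl// mulr_ge0// ltW.
  have eps10 : 0 < eps1 by rewrite divr_gt0.
  have [r3 r30] := lo _ eps10 => br3.
  have r3K : 0 < r3 / (2 * K + 1) by rewrite divr_gt0.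
  apply: filterS2 (nr2 _ r20) (nr2 _ r3K) => t tr2 tr3.
  have := ztK t tr2; set k := zt t - z0 => kt.
  have tk : `|(t, k)| <= (2 * K + 1) * `|t|.
    rewrite prod_normE /= ge_max; have := normr_ge0 t; nra.
  rewrite addr0 zt0; apply: row_norm_le; first by rewrite mulr_ge0// ltW.
  move=> j; have [_ Fz] := Fzt t tr2.
  have := br3 j t k; rewrite /k subrK Fz subrr sub0r normrN -/k.
  rewrite ltr_pdivlMr// mulrC in tr3.
  move=> /(_ (le_lt_trans tk tr3)) h.
  have -> : (k - t *: A) 0 j = t * 'D_(1, 0) (F j) (0, z0) + k 0 j.
    by rewrite !mxE mulrN opprK addrC.
  rewrite (le_trans h)// (le_trans (ler_wpM2l (ltW eps10) tk))//.
  by rewrite mulrA /eps1 divfK// gt_eqF.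
exists zt; split=> //.
- by apply: filterS (nr2 _ r20) => t /Fzt.
- by rewrite deriveE// dzE scale1r.
Qed.

End SolveCurve.

(** * The bracket of the bisection group *)

Section SolvePair.
Variables (R : realType) (n : nat).
Local Notation E := (R * 'rV[R]_n)%type.
Implicit Types z : E.

Let enc z : 'rV[R]_(1 + n) := row_mx z.1%:M z.2.
Let dec (v : 'rV[R]_(1 + n)) : E := (lsubmx v 0 0, rsubmx v).

Let encK : cancel enc dec.
Proof. by move=> [x q]; rewrite /dec /enc row_mxKl row_mxKr mxE eqxx mulr1n. Qed.

Let smooth_dec S : smooth_map S dec.
Proof.
apply: smooth_map_pair.
  apply: smooth_map_real; rewrite (_ : (fun x => _) = fun v : 'rV[R]_(1 + n) => v 0 (lshift n 0)).
    exact: smooth_coord.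
  by apply/funext => v; rewrite mxE.
apply: smooth_map_row => j; rewrite (_ : (fun x => _) = fun v : 'rV[R]_(1 + n) => v 0 (rshift 1 j)).
  exact: smooth_coord.
by apply/funext => v; rewrite mxE.
Qed.

Let dec_linear : linear dec.
Proof. by move=> a x y; congr pair; rewrite ?linearP//= !mxE. Qed.

Let continuous_dec : continuous dec.
Proof. by move=> x; exact: (smap_continuous (@smooth_dec setT 0%N)). Qed.

Variables (W : set (R * E)) (F : R * E -> R) (G : 'I_n -> R * E -> R) (z0 : E).

(** This is [solve_curve] in the coordinates of R * 'rV_n. *)
Lemma solve_pair : open W -> W (0, z0) -> smooth_on W F ->
  (forall j, smooth_on W (G j)) ->
  (forall z, W (0, z) -> F (0, z) = z.1) ->
  (forall j z, W (0, z) -> G j (0, z) = z.2 0 j) ->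
  exists zt : R -> E,
  [/\ zt 0 = z0,
      \forall t \near (0 : R), [/\ W (t, zt t), F (t, zt t) = z0.1 &
        forall j, G j (t, zt t) = z0.2 0 j],
      differentiable zt 0 &
      'D_1 zt 0 = - ('D_(1, 0) F (0, z0), \row_j 'D_(1, 0) (G j) (0, z0))].
Proof.
move=> oW Wz0 sF sG F0 G0.
pose P (tv : R * 'rV[R]_(1 + n)) : R * E := (tv.1, dec tv.2).
have sP S : smooth_map S P.
  apply: smooth_map_pair; first by apply: smooth_map_fst; exact: smooth_map_id.
  move=> k; apply: smap_post_linear => //; apply: smooth_map_snd; exact: smooth_map_id.
have cP : continuous P.
  by move=> x; exact: (smap_continuous (@sP setT 0%N)).
pose W' := P @^-1` W.
have oW' : open W' by apply: open_comp => // x _; exact: cP.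
pose H (i : 'I_(1 + n)) (tv : R * 'rV[R]_(1 + n)) : R :=
  match fintype.split i with inl _ => F (P tv) | inr j => G j (P tv) end.
have sH i : smooth_on W' (H i).
  rewrite /H; case: (fintype.split i) => j.
    exact: (@smooth_comp R _ _ W' W F P oW' _ (sP _) sF).
  exact: (@smooth_comp R _ _ W' W (G j) P oW' _ (sP _) (sG j)).
have H0 i v : W' (0, v) -> H i (0, v) = v 0 i.
  move=> Wv; rewrite /H; case: fintype.splitP => [j ij|j ij].
    by rewrite F0//= mxE; congr (v _ _); apply: val_inj; rewrite /= ij (ord1 j).
  by rewrite G0//= mxE; congr (v _ _); apply: val_inj; rewrite /= ij.
have Wz0' : W' (0, enc z0) by rewrite /W' /P /= encK.
have [vt [vt0 vtP dvt Dvt]] := solve_curve oW' Wz0' sH H0.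
exists (fun t => dec (vt t)); split.
- by rewrite vt0 encK.
- apply: filterS vtP => t [Wt Ht]; split=> // [|j].
    have := Ht (lshift n 0); rewrite /H; case: fintype.splitP => [? _|j /=]; last by [].
    by rewrite /enc row_mxEl mxE eqxx mulr1n.
  have := Ht (rshift 1 j); rewrite /H; case: fintype.splitP => [i|k /= /addnI/val_inj <-].
    by move=> /= Ei; have := ltn_ord i; rewrite -Ei.
  by rewrite /enc row_mxEr.
- apply: differentiable_comp => //; exact: linear_fun_differentiable.
have ldec : 'd dec (vt 0) = dec :> (_ -> _).
  by apply/funext => v; rewrite -deriveE ?derive_linear_fun//; exact: linear_fun_differentiable.
rewrite (@derive_comp _ _ _ _ dec vt)//; last exact: linear_fun_differentiable.
rewrite ldec Dvt.
have P1 : 'D_(1, 0) F (0, z0) = 'D_(1, 0) (fun tv => F (P tv)) (0, enc z0).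
  by rewrite -!derive_slice1 /P /= encK.
have P2 j : 'D_(1, 0) (G j) (0, z0) = 'D_(1, 0) (fun tv => G j (P tv)) (0, enc z0).
  by rewrite -!derive_slice1 /P /= encK.
congr pair; first by rewrite /dec /= !mxE P1 /H; case: fintype.splitP => [//|j /=].
apply/rowP => j; rewrite /dec /= !mxE P2 /H; congr (- _).
case: fintype.splitP => [i|k /= /addnI/val_inj <-//].
by move=> /= Ei; have := ltn_ord i; rewrite -Ei.
Qed.

End SolvePair.

Section Sections.
Variables (R : realType) (n : nat).
Hypothesis n0 : (0 < n)%N.
Local Notation cpi := (@cpi R).
Local Notation proj := (@Defs.proj R n).
Local Notation E := (R * 'rV[R]_n)%type.
Implicit Types (u v : circle R -> config R n -> R) (z : E) (q : 'rV[R]_n).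

Definition lift_section u z : R := u (cpi z.1) (proj z.2).

Definition arc_interior (i : 'I_n) : set E :=
  [set z | Bcover z.2 /\ z.2 0 i < z.1 < nextpt z.2 i].

Lemma arc_interior_piece i z : arc_interior i z -> piece i z.
Proof. by move=> [Bz /andP[h1 h2]]; split=> //; rewrite !ltW. Qed.

Lemma arc_interior_open i : open (arc_interior i).
Proof.
rewrite openE => z [Bz /andP[h1 h2]].
have nB : \forall y \near z, Bcover y.2 by apply: cvg_snd; exact: Bcover_near.
have cx : {for z, continuous (fun y : E => y.1)} by exact: cvg_fst.
have cc : continuous (fun q => q 0 i) by exact: coord_continuous.
have cq : {for z, continuous (fun y : E => y.2 0 i)}.
  by apply: (@continuous_comp _ _ _ snd (fun q => q 0 i)); [exact: cvg_snd|exact: cc].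
have cn : {for z, continuous (fun y : E => nextpt y.2 i)}.
  apply: (@continuous_comp _ _ _ snd (fun q : 'rV[R]_n => nextpt q i)); first exact: cvg_snd.
  exact: continuous_nextpt.
have d1 : \forall y \near z, 0 < y.1 - (y.2 : 'rV[R]_n) 0 i.
  by apply: (cvgr_gt _ (cvgB cx cq)); rewrite subr_gt0.
have d2 : \forall y \near z, 0 < nextpt y.2 i - y.1.
  by apply: (cvgr_gt _ (cvgB cn cx)); rewrite subr_gt0.
apply: filterS3 nB d1 d2 => y By; rewrite !subr_gt0 => y1 y2.
by split=> //=; rewrite y1.
Qed.

Lemma section_smooth_interior u i : smooth_section u ->
  smooth_on (arc_interior i) (lift_section u).
Proof.
move=> [_ su]; apply: smooth_local => z zi.
have [N [g [oN Nz sg ug]]] := su i z (arc_interior_piece zi).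
have oI := @arc_interior_open i.
exists (N `&` arc_interior i); split=> //; first exact: openI.
apply: (@smooth_ext _ _ _ g); [exact: openI| |by apply: smooth_sub sg => y []].
by move=> y [Ny /arc_interior_piece yi]; rewrite -ug.
Qed.

Definition break (j : 'I_n) q : E := (q 0 j, q).

Lemma break_piece j q : Bcover q -> piece j (break j q).
Proof. by move=> Bq; split=> //=; rewrite lexx ltW. Qed.

Lemma smooth_break j (S : set 'rV[R]_n) : smooth_map S (break j).
Proof.
apply: smooth_map_pair; last exact: smooth_map_id.
by apply: smooth_map_real; exact: smooth_coord.
Qed.

Lemma continuous_break j : continuous (break j).
Proof. by move=> q; exact: (smap_continuous (@smooth_break j setT 0%N)). Qed.

Lemma section_smooth_break u j : smooth_section u ->
  smooth_on (@Bcover R n) (fun q => lift_section u (break j q)).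
Proof.
move=> [_ su]; apply: smooth_local => q Bq.
have [N [g [oN Nz sg ug]]] := su j _ (break_piece j Bq).
pose M := (break j) @^-1` N `&` @Bcover R n.
have oM : open M.
  apply: openI; last exact: Bcover_open.
  by apply: open_comp => // x _; exact: continuous_break.
exists M; split=> //.
apply: (@smooth_ext _ _ _ (fun q => g (break j q))) => //.
  by move=> y [Ny By]; rewrite -ug//; exact: break_piece.
apply: (@smooth_comp R _ _ M N g (break j) oM _ (@smooth_break j _) sg).
by move=> y [].
Qed.

(** A bisection moves x and the breaks at the same time; this is the velocity of the
    point (x, p_1, ..., p_n) in an infinitesimal motion. *)
Definition vel u z : E := (lift_section u z, \row_j lift_section u (break j z.2)).

Lemma derive_pair_dir (f : E -> R) z (a : R) (b : 'rV[R]_n) : differentiable f z ->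
  'D_(a, b) f z = a * 'D_(1, 0) f z + \sum_j b 0 j * 'D_(0, delta_mx 0 j) f z.
Proof.
move=> df.
have E1 : (a, b) = a *: ((1, 0) : E) + \sum_j b 0 j *: ((0, delta_mx 0 j) : E).
  have -> : \sum_j b 0 j *: ((0, delta_mx 0 j) : E) = (0, b).
    rewrite [in RHS](row_sum_delta b); elim/big_ind2 : _ => //.
      by move=> x1 x2 y1 y2 -> ->; congr pair; rewrite /= addr0.
    by move=> j _; congr pair; rewrite /= scaler0.
  by congr pair; rewrite /= ?scaler0 ?add0r// addr0 [a *: _]mulr1.
rewrite {1}E1 deriveE// linearD linearZ linear_sum -deriveE//; congr (_ + _).
by apply: eq_bigr => j _; rewrite linearZ -deriveE.
Qed.

Lemma d_xE u z : d_x u (cpi z.1) (proj z.2) = 'D_(1, 0) (lift_section u) z.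
Proof.
have [k kE] : exists k : int, repr (cpi z.1) = z.1 + k%:~R.
  by apply/cpi_eqP; rewrite cpi_repr.
rewrite /d_x derive1E kE -derive_translate.
case: z {kE} => x q /=.
apply: etrans _ (derive_slice1 (lift_section u) x 1 q).
have -> // : (fun y : R => u (cpi (y + k%:~R)) (proj q)) =
  (fun y : R => lift_section u (y, q)).
by apply/funext => y; rewrite /lift_section /= cpi_addz.
Qed.

Lemma d_pE u z j : d_p j u (cpi z.1) (proj z.2) =
  'D_(0, delta_mx 0 j) (lift_section u) z.
Proof.
have ex i : exists k : int, repr (cpi (z.2 0 i)) = z.2 0 i + k%:~R.
  by apply/cpi_eqP; rewrite cpi_repr.
have [k kE] := choice ex.
pose c : 'rV[R]_n := \row_i (k i)%:~R.
have rE : map_mx repr (proj z.2) = z.2 + c.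
  by apply/rowP => i; rewrite !mxE kE.
rewrite /d_p rE -derive_translate.
case: z {ex kE rE} => x q /=.
apply: etrans _ (derive_slice (lift_section u) x q (delta_mx 0 j)).
have -> // : (fun y => u (cpi x) (proj (y + c))) = (fun y => lift_section u (x, y)).
apply/funext => y; rewrite /lift_section /=; congr (u _ _).
by apply/rowP => i; rewrite !mxE cpi_addz.
Qed.

(** The bracket formula is the first component of the commutator of the vector fields
    [vel u] and [vel v]. *)
Lemma bracket_formulaE u v i z : smooth_section u -> smooth_section v ->
  arc_interior i z -> bracket_formula u v (cpi z.1) (proj z.2) =
    'D_(vel u z) (lift_section v) z - 'D_(vel v z) (lift_section u) z.
Proof.
move=> su sv zi.
have du := smooth_differentiable (section_smooth_interior i su) zi.
have dv := smooth_differentiable (section_smooth_interior i sv) zi.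
rewrite /vel (derive_pair_dir _ _ du) (derive_pair_dir _ _ dv) opprD addrACA.
rewrite /bracket_formula !d_xE -sumrB; congr (_ + _).
apply: eq_bigr => j _; rewrite !mxE !d_pE.
by rewrite /lift_section /break /=.
Qed.

Lemma off_breaks_interior q (x : R) : Bcover q -> off_breaks (cpi x) (proj q) ->
  exists i (k : int), arc_interior i (x - k%:~R, q).
Proof.
move=> Bq ob; have [i [k [/andP[h1 h2]|xE]]] := interior_or_break x n0 Bq.
  by exists i, k; split=> //=; rewrite ltrBrDr h1 ltrBlDr.
by case: (ob i); rewrite xE cpi_addz projE.
Qed.

End Sections.

(** * The mixed derivative of a conjugation *)

Section CurveLifts.
Variables (R : realType) (n : nat).
Local Notation cpi := (@cpi R).
Local Notation proj := (@Defs.proj R n).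
Local Notation E := (R * 'rV[R]_n)%type.

Lemma derive_pairE (U V W : normedModType R) (h : U -> V) (k : U -> W) x v :
  differentiable h x -> differentiable k x ->
  'D_v (fun y => (h y, k y)) x = ('D_v h x, 'D_v k x).
Proof.
move=> dh dk; rewrite deriveE; last exact: differentiable_pair.
by rewrite diff_pair// !deriveE.
Qed.

(** A smooth lift of a curve of maps into the circle can be normalized at time 0
    by an integer, and then its initial velocity is that of the curve. *)
Lemma flow_lift (V : normedModType R) (c : R -> V -> circle R) (b a : V -> R) (z0 : V)
    (W0 : set (R * V)) (F0 : R * V -> R) :
  open W0 -> W0 (0, z0) -> smooth_on W0 F0 ->
  (forall t z, W0 (t, z) -> c t z = cpi (F0 (t, z))) ->
  {for z0, continuous b} ->
  (forall z, W0 (0, z) -> c 0 z = cpi (b z)) ->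
  (forall z, W0 (0, z) -> cvelocity (fun t => c t z) 0 (a z)) ->
  exists (W : set (R * V)) (F : R * V -> R),
    [/\ open W, W (0, z0), W `<=` W0 & smooth_on W F] /\
    [/\ forall t z, W (t, z) -> c t z = cpi (F (t, z)),
        forall z, W (0, z) -> F (0, z) = b z &
        forall z, W (0, z) -> 'D_(1, 0) F (0, z) = a z].
Proof.
move=> oW0 Wz0 sF cF cb cb0 cva.
have nW : \forall z \near z0, W0 (0, z).
  exact: (continuous_near (@continuous_slice _ _ (0 : R) z0) (open_near oW0 Wz0)).
have cF0 : {for z0, continuous (fun z => F0 (0, z))}.
  apply: (@continuous_comp _ _ _ (fun z => (0 : R, z)) F0); first exact: continuous_slice.
  exact: smooth_continuous sF Wz0.
have [|k nk] := lift_unique cF0 cb.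
  by apply: filterS nW => z Wz; rewrite -cF// cb0.
have [N [oN Nz0] Nk] : exists2 N : set V, open_nbhs z0 N &
    N `<=` (fun z => F0 (0, z) = b z + k%:~R).
  have : nbhs z0 (fun z => F0 (0, z) = b z + k%:~R) by exact: nk.
  by rewrite nbhsE.
have oN' : open [set tz : R * V | N tz.2].
  by apply: open_comp => // x _; exact: cvg_snd.
pose W := W0 `&` [set tz : R * V | N tz.2].
have oW : open W by exact: openI.
pose F tz := F0 tz + (- k%:~R).
have sW : smooth_on W F.
  apply: smooth_add => //; last exact: smooth_cst.
  by apply: smooth_sub sF => z [].
have WF t z : W (t, z) -> c t z = cpi (F (t, z)).
  by move=> [Wz _]; rewrite cF// /F -mulrNz cpi_addz.
exists W, F; split; split=> //; first by move=> z [].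
  by move=> z [_ /Nk]; rewrite /F => ->; rewrite addrK.
move=> z Wz; have [W0z _] := Wz.
have lineE (t : R) : (0, z) + t *: ((1, 0) : R * V) = (t, z).
  by congr pair; rewrite /= ?scaler0 ?addr0// add0r [t *: _]mulr1.
have dF : is_derive (0 : R) 1 (fun t : R => F ((0, z) + t *: (1, 0))) ('D_(1, 0) F (0, z)).
  have := @is_derive_line R _ F (0, z) (1, 0) 0; rewrite scale0r addr0; apply.
  exact: smooth_differentiable sW Wz.
have [_ <-] := dF; symmetry.
have [_ <-//] : is_derive (0 : R) 1 (fun t : R => F ((0, z) + t *: (1, 0))) (a z).
apply: cvelocity_lift (cva z W0z) _ _.
  by apply: differentiable_continuous; apply/derivable1_diffP; case: dF.
have n1 : \forall t \near (0 : R), W (t, z).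
  have ct : {for (0 : R), continuous (fun t : R => (t, z))}.
    by exact: cvg_pair cvg_id (cvg_cst _).
  exact: (continuous_near ct (open_near oW Wz)).
by apply: filterS n1 => t Wt; rewrite lineE WF.
Qed.

Lemma velocity_lift (c : R -> circle R) (a y : R) : cvelocity c 0 a -> c 0 = cpi y ->
  exists g : R -> R, [/\ g 0 = y, \forall t \near (0 : R), c t = cpi (g t) &
    is_derive (0 : R) 1 g a].
Proof.
move=> [h [ch dh]] c0; have : cpi (h 0) = cpi y by rewrite -c0 -(nbhs_singleton ch).
move=> /cpi_eqP[k hk]; exists (fun t => h t - k%:~R); split.
- by rewrite hk addrK.
- by apply: filterS ch => t ->; rewrite -mulrNz cpi_addz.
- rewrite -[a]subr0.
  exact: (@is_deriveB _ _ _ h (cst k%:~R) (0 : R) 1 a 0 dh (is_derive_cst _ _ _)).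
Qed.

Variables (u : circle R -> config R n -> R) (f : R -> circle R -> config R n -> circle R).
Hypothesis fu : bisection_curve u f.

Lemma curve_lift_interior i (z0 : E) : arc_interior i z0 ->
  exists (W : set (R * E)) (F : R * E -> R),
    [/\ open W, W (0, z0), smooth_on W F & forall t z, W (t, z) -> arc_interior i z] /\
    [/\ forall t z, W (t, z) -> f t (cpi z.1) (proj z.2) = cpi (F (t, z)),
        forall z, W (0, z) -> F (0, z) = z.1 &
        forall z, W (0, z) -> 'D_(1, 0) F (0, z) = lift_section u z].
Proof.
move=> z0i; have [[e e0 [_ sf]] f0 fv] := fu.
have pz0 : [set z : R * E | `|z.1| < e /\ piece i z.2] (0, z0).
  by split; [rewrite /= normr0|exact: arc_interior_piece].
have [U [g [oU Uz0 sg fg]]] := sf i (0, z0) pz0.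
have oT : open [set tz : R * E | `|tz.1| < e].
  have -> : [set tz : R * E | `|tz.1| < e] = fst @^-1` (ball (0 : R) e).
    by apply/seteqP; split=> tz /=; rewrite -ball_normE /ball_ /= sub0r normrN.
  by apply: open_comp; [move=> x _; exact: cvg_fst|exact: ball_open].
have oI : open [set tz : R * E | arc_interior i tz.2].
  by apply: open_comp; [move=> x _; exact: cvg_snd|exact: arc_interior_open].
pose W0 := U `&` ([set tz : R * E | `|tz.1| < e] `&` [set tz : R * E | arc_interior i tz.2]).
have [|||||||W [F [[oW Wz0 WW0 sF] [F1 F2 F3]]]] := @flow_lift _
  (fun t (z : E) => f t (cpi z.1) (proj z.2)) (fun z => z.1) (lift_section u) z0 W0 g.
- by apply: openI => //; exact: openI.
- by split=> //; split=> //=; rewrite normr0.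
- by apply: smooth_sub sg => z [].
- by move=> t z [Uz [te /arc_interior_piece zi]]; exact: (fg (t, z)).
- exact: cvg_fst.
- by move=> z [_ [_ [/= Bz _]]]; rewrite f0//; exact: Bset_proj.
- by move=> z [_ [_ [/= Bz _]]]; apply: fv; exact: Bset_proj.
by exists W, F; split=> //; split=> // t z /WW0[_ []].
Qed.

(** The motion of the breaks is a function on the base alone, which is why the pieces
    on one side of the break suffice. *)
Lemma curve_lift_break j (q0 : 'rV[R]_n) : Bcover q0 ->
  exists (W : set (R * 'rV[R]_n)) (F : R * 'rV[R]_n -> R),
    [/\ open W, W (0, q0), smooth_on W F & forall t q, W (t, q) -> Bcover q] /\
    [/\ forall t q, W (t, q) -> f t (cpi (q 0 j)) (proj q) = cpi (F (t, q)),
        forall q, W (0, q) -> F (0, q) = q 0 j &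
        forall q, W (0, q) -> 'D_(1, 0) F (0, q) = lift_section u (break j q)].
Proof.
move=> Bq0; have [[e e0 [_ sf]] f0 fv] := fu.
have pz0 : [set z : R * E | `|z.1| < e /\ piece j z.2] (0, break j q0).
  by split; [rewrite /= normr0|exact: break_piece].
have [U [g [oU Uz0 sg fg]]] := sf j _ pz0.
pose B (tq : R * 'rV[R]_n) : R * E := (tq.1, break j tq.2).
have sB S : smooth_map S B.
  apply: smooth_map_pair; first by apply: smooth_map_fst; exact: smooth_map_id.
  apply: smooth_map_pair; last by apply: smooth_map_snd; exact: smooth_map_id.
  apply: smooth_map_real; apply: smooth_linear; first by move=> a x y; rewrite /= !mxE.
  have cc : continuous (fun q : 'rV[R]_n => q 0 j) by exact: coord_continuous.
  by move=> x; apply: (@continuous_comp _ _ _ snd (fun q : 'rV[R]_n => q 0 j)); [exact: cvg_snd|exact: cc].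
have cB : continuous B by move=> x; exact: (smap_continuous (@sB setT 0%N)).
have oU' : open (B @^-1` U) by apply: open_comp => // x _; exact: cB.
have oT : open [set tz : R * 'rV[R]_n | `|tz.1| < e].
  have -> : [set tz : R * 'rV[R]_n | `|tz.1| < e] = fst @^-1` (ball (0 : R) e).
    by apply/seteqP; split=> tz /=; rewrite -ball_normE /ball_ /= sub0r normrN.
  by apply: open_comp; [move=> x _; exact: cvg_fst|exact: ball_open].
have oI : open [set tz : R * 'rV[R]_n | Bcover tz.2].
  by apply: open_comp; [move=> x _; exact: cvg_snd|exact: Bcover_open].
pose W0 := (B @^-1` U) `&` ([set tz : R * 'rV[R]_n | `|tz.1| < e] `&`
  [set tz : R * 'rV[R]_n | Bcover tz.2]).
have oW0 : open W0 by apply: openI => //; exact: openI.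
have [||||||W [F [[oW Wz0 WW0 sF] [F1 F2 F3]]]] := @flow_lift _
  (fun t (q : 'rV[R]_n) => f t (cpi (q 0 j)) (proj q)) (fun q => q 0 j)
  (fun q => lift_section u (break j q)) q0 W0 (fun tq => g (B tq)) oW0.
- by split=> //; split=> //=; rewrite normr0.
- apply: (@smooth_comp R _ _ W0 U g B oW0 _ (@sB _) sg).
  by move=> x [].
- by move=> t q [Uz [te Bq]]; apply: (fg (B (t, q))) => //; split=> //; exact: break_piece.
- exact: coord_continuous.
- by move=> q [_ [_ /= Bq]]; rewrite f0//; exact: Bset_proj.
- by move=> q [_ [_ /= Bq]]; apply: fv; exact: Bset_proj.
by exists W, F; split=> //; split=> // t z /WW0[_ []].
Qed.

End CurveLifts.

Section MixedDerivative.
Variables (R : realType) (n : nat).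
Hypothesis n0 : (0 < n)%N.
Local Notation cpi := (@cpi R).
Local Notation proj := (@Defs.proj R n).
Local Notation E := (R * 'rV[R]_n)%type.
Variables (u v : circle R -> config R n -> R).
Variables (f g : R -> circle R -> config R n -> circle R).
Hypothesis su : smooth_section u.
Hypothesis sv : smooth_section v.
Hypothesis fu : bisection_curve u f.
Hypothesis gv : bisection_curve v g.

Lemma is_diff_slice (f0 : R * E -> R) (tz : R * E) (w : E) :
  'D_w (fun y => f0 (tz.1, y)) tz.2 = 'D_(0, w) f0 tz.
Proof. by rewrite derive_slice; case: tz. Qed.

(** The preimage of (x, p) under (x, p) |-> (f^t(x, p), f^t(p, p)) solves an equation
    for lifts that are smooth in t and z, to which [solve_pair] applies. *)
Lemma binv_curve i (z0 : E) : arc_interior i z0 ->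
  exists (W : set (R * E)) (F : R * E -> R) (zt : R -> E),
    [/\ open W, W (0, z0), smooth_on W F & forall t z, W (t, z) -> arc_interior i z] /\
    [/\ forall t z, W (t, z) -> f t (cpi z.1) (proj z.2) = cpi (F (t, z)),
        forall z, W (0, z) -> F (0, z) = z.1 &
        forall z, W (0, z) -> 'D_(1, 0) F (0, z) = lift_section u z] /\
    [/\ zt 0 = z0, differentiable zt 0, 'D_1 zt 0 = - vel u z0 &
      \forall t \near (0 : R), [/\ W (t, zt t),
        binv (f t) (cpi z0.1) (proj z0.2) = cpi (zt t).1 &
        btrg (binv (f t)) (proj z0.2) = proj (zt t).2]].
Proof.
move=> z0i; have [Bz0 _] := z0i.
have [W [F [[oW Wz0 sF Wi] [F1 F2 F3]]]] := curve_lift_interior fu z0i.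
have ex j : exists WG : set (R * 'rV[R]_n) * (R * 'rV[R]_n -> R),
    [/\ open WG.1, WG.1 (0, z0.2), smooth_on WG.1 WG.2 & forall t q, WG.1 (t, q) -> Bcover q] /\
    [/\ forall t q, WG.1 (t, q) -> f t (cpi (q 0 j)) (proj q) = cpi (WG.2 (t, q)),
        forall q, WG.1 (0, q) -> WG.2 (0, q) = q 0 j &
        forall q, WG.1 (0, q) -> 'D_(1, 0) WG.2 (0, q) = lift_section u (break j q)].
  by have [W' [F' H]] := curve_lift_break fu j Bz0; exists (W', F').
have [WG WGP] := choice ex.
pose P (tz : R * E) : R * 'rV[R]_n := (tz.1, tz.2.2).
have sP S : smooth_map S P.
  apply: smooth_map_pair; first by apply: smooth_map_fst; exact: smooth_map_id.
  by apply: smooth_map_snd; apply: smooth_map_snd; exact: smooth_map_id.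
have cP : continuous P by move=> x; exact: (smap_continuous (@sP setT 0%N)).
pose W1 : set (R * E) := [set tz | W tz /\ forall j, (WG j).1 (P tz)].
have oW1 : open W1.
  rewrite openE => tz [Wtz Gtz]; apply: filterI; first exact: (open_near oW Wtz).
  suff h j : \forall x \near tz, (WG j).1 (P x).
    exact: (@filter_forall _ _ _ (nbhs tz) _ h).
  have [[oj _ _ _] _] := WGP j.
  exact: (continuous_near (cP tz) (open_near oj (Gtz j))).
have W1z0 : W1 (0, z0) by split=> // j; have [[]] := WGP j.
have sF1 : smooth_on W1 F by apply: smooth_sub sF => z [].
have sG j : smooth_on W1 (fun tz => (WG j).2 (P tz)).
  have [[_ _ sj _] _] := WGP j.
  apply: (@smooth_comp R _ _ W1 (WG j).1 (WG j).2 P oW1 _ (sP _) sj).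
  by move=> x [_]; exact.
have [z [Wz _]|j z [_ Gz]|zt [zt0 ztP dzt Dzt]] := @solve_pair R n W1 F
    (fun j tz => (WG j).2 (P tz)) z0 oW1 W1z0 sF1 sG.
- exact: F2.
- have [_ [_ h _]] := WGP j; exact: (h _ (Gz j)).
exists W1, F, zt; split; [|split].
- by split=> // t z [Wz _]; exact: Wi Wz.
- by split=> [t z [Wz _]|z [Wz _]|z [Wz _]]; [exact: F1|exact: F2|exact: F3].
split=> //.
  rewrite Dzt /vel F3//; congr (- (_, _)); apply/rowP => j; rewrite !mxE.
  have [[_ Gz0 sj _] [_ _ h]] := WGP j; rewrite -(h _ Gz0).
  by rewrite -!derive_slice1.
have [[e e0 [bf _]] _ _] := fu.
have ne : \forall t \near (0 : R), `|t| < e.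
  have : \forall t \near (0 : R), `|0 - t| < e.
    by apply: (@cvgr_dist_lt _ R _ (nbhs 0) _ id 0).
  by apply: filterS => t; rewrite sub0r normrN.
apply: filterS2 ne ztP => t te [W1t Ft Gt].
have [Wt Gt1] := W1t.
have [Bt _] := Wi _ _ Wt.
have tE : btrg (f t) (proj (zt t).2) = proj z0.2.
  apply/rowP => j; rewrite /btrg /trg !mxE -(Gt j).
  by have [_ [h _ _]] := WGP j; exact: (h _ _ (Gt1 j)).
have Bp := Bset_proj Bt.
split=> //.
  have := binvP (cpi (zt t).1) (bf t te) Bp; rewrite tE => <-.
  by rewrite F1// Ft.
apply/rowP => j; rewrite /btrg /trg !mxE.
have := binvP (cpi ((zt t).2 0 j)) (bf t te) Bp; rewrite tE => <-.
congr (binv _ _ _); have [_ [h _ _]] := WGP j.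
by rewrite (h _ _ (Gt1 j)) Gt.
Qed.

(** The conjugate of g^s by f^t sends (x, p) to f^t(g^s(z(t))), where z(t) is the
    preimage of (x, p) under f^t. Its velocity at s = 0 is A(t, z(t)), with A the
    derivative of the lift of f^t along [vel v], and the derivative of this at t = 0
    splits into the contributions of the two arguments of A. *)
Lemma conj_mixed i (z0 : E) : arc_interior i z0 ->
  conj_mixed_derivative f g (cpi z0.1) (proj z0.2)
    (- bracket_formula u v (cpi z0.1) (proj z0.2)).
Proof.
move=> z0i; have [W [F [zt [[oW Wz0 sF Wi] [[F1 F2 F3] [zt0 dzt Dzt ztP]]]]]] := binv_curve z0i.
have sV := section_smooth_interior i sv.
pose A (tz : R * E) : R := 'D_(0, vel v tz.2) F tz.
have sA : smooth_on W A.
  have sa : smooth_on W (fun tz : R * E => lift_section v tz.2).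
    apply: (@smooth_comp R _ _ W (arc_interior i) (lift_section v) snd oW _ _ sV).
      by move=> [t z] /Wi.
    by apply: smooth_map_snd; exact: smooth_map_id.
  have sb j : smooth_on W (fun tz : R * E => lift_section v (break j tz.2.2)).
    apply: (@smooth_comp R _ _ W (@Bcover R n) (fun q => lift_section v (break j q))
      (fun tz : R * E => tz.2.2) oW _ _ (section_smooth_break j sv)).
      by move=> [t z] /Wi[].
    by apply: smooth_map_snd; apply: smooth_map_snd; exact: smooth_map_id.
  apply: (@smooth_ext _ _ _ (fun tz : R * E => lift_section v tz.2 * 'D_(0, (1, 0)) F tz +
      \sum_j lift_section v (break j tz.2.2) * 'D_(0, (0, delta_mx 0 j)) F tz)) => //.
    move=> tz Wtz; rewrite /A -is_diff_slice /vel derive_pair_dir.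
      rewrite is_diff_slice; congr (_ + _); apply: eq_bigr => j _.
      by rewrite mxE is_diff_slice.
    apply: (@differentiable_comp _ _ _ _ (fun z : E => (tz.1, z)) F).
      by apply: differentiable_pair; [exact: differentiable_cst|exact: ex_diff].
    by apply: smooth_differentiable sF _; case: tz Wtz.
  apply: smooth_add => //.
    by apply: smooth_mul => //; exact: smooth_derive.
  by apply: smooth_sum => // j _; apply: smooth_mul => //; exact: smooth_derive.
exists (fun t => A (t, zt t)); split.
  (* Only a lift of the curve s |-> g^s at the points of z(t) is needed here. *)
  apply: filterS ztP => t [Wt bx bp].
  have [Bt _] := Wi _ _ Wt.
  have [_ g0 vg] := gv; have Bp := Bset_proj Bt.
  have [g1 [g10 g1E dg1]] := velocity_lift (vg (cpi (zt t).1) _ Bp) (g0 (cpi (zt t).1) _ Bp).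
  have ex j := velocity_lift (vg (proj (zt t).2 0 j) _ Bp)
    (etrans (g0 (proj (zt t).2 0 j) _ Bp) (projE (zt t).2 j)).
  have [gj gjP] := choice ex.
  pose G (s : R) : E := (g1 s, \row_j gj j s).
  have G0 : G 0 = zt t.
    rewrite /G g10 [RHS]surjective_pairing; congr pair.
    by apply/rowP => j; rewrite mxE; have [] := gjP j.
  have dG1 : differentiable g1 0 by apply/derivable1_diffP; case: dg1.
  have dGj j : differentiable (gj j) 0 by apply/derivable1_diffP; have [_ _ []] := gjP j.
  have GE : G = fun s => (g1 s, \sum_j gj j s *: (delta_mx 0 j : 'rV[R]_n)).
    apply/funext => s; congr pair; rewrite [LHS]row_sum_delta.
    by apply: eq_bigr => j _; rewrite mxE.
  have [dsum Dsum] := differentiable_combination (delta_mx 0 : 'I_n -> 'rV[R]_n) dGj.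
  have dG : differentiable G 0 by rewrite GE; exact: differentiable_pair.
  have DG : 'D_1 G 0 = vel v (zt t).
    rewrite GE derive_pairE// Dsum /vel; congr pair.
      by have [_ ->] := dg1.
    rewrite [RHS]row_sum_delta; apply: eq_bigr => j _; rewrite mxE; congr (_ *: _).
    have [_ _ [_ ->]] := gjP j.
    by rewrite /lift_section /break /= projE.
  exists (fun s => F (t, G s)); split.
    have nW : \forall s \near (0 : R), W (t, G s).
      have cG : {for (0 : R), continuous (fun s => (t, G s))}.
        apply: (@continuous_comp _ _ _ G (fun z : E => (t, z))).
          exact: differentiable_continuous.
        exact: continuous_slice.
      by apply: (continuous_near cG); rewrite G0; exact: open_near.
    have nj : \forall s \near (0 : R), forall j,
        g s (proj (zt t).2 0 j) (proj (zt t).2) = cpi (gj j s).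
      suff h j : \forall s \near (0 : R), g s (proj (zt t).2 0 j) (proj (zt t).2) = cpi (gj j s).
        exact: (@filter_forall _ _ _ (nbhs (0 : R)) _ h).
      by have [] := gjP j.
    apply: filterS3 nW g1E nj => s Ws g1s gjs.
    rewrite -F1//= /bmul bx bp g1s; congr (f t _ _).
    by apply/rowP => j; rewrite /btrg /trg !mxE -gjs projE.
  have dF : differentiable F (t, G 0).
    by rewrite G0; exact: smooth_differentiable sF Wt.
  have dtG : differentiable (fun s : R => (t, G s)) 0.
    by apply: differentiable_pair => //; exact: differentiable_cst.
  apply: DeriveDef.
    by apply: diff_derivable; apply: (@differentiable_comp _ _ _ _ (fun s : R => (t, G s)) F).
  rewrite (@derive_comp _ _ _ _ F (fun s : R => (t, G s)))//.
  rewrite (@derive_pairE _ _ _ _ (cst t) G)//.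
  by rewrite derive_cst DG -deriveE// G0.
have dA : differentiable A (0, zt 0) by rewrite zt0; exact: smooth_differentiable sA Wz0.
have dtz : differentiable (fun t : R => (t, zt t)) 0.
  by apply: differentiable_pair => //; exact: ex_diff.
apply: DeriveDef.
  by apply: diff_derivable; apply: (@differentiable_comp _ _ _ _ (fun t : R => (t, zt t)) A).
rewrite (@derive_comp _ _ _ _ A (fun t : R => (t, zt t)))//.
rewrite (@derive_pairE _ _ _ _ id zt)//.
rewrite derive_id Dzt.
have -> : (1, - vel u z0) = ((1, 0) : R * E) - (0, vel u z0).
  by congr pair; rewrite /= ?subr0 ?sub0r.
rewrite linearB -!deriveE// zt0.
(* F(0, .) is the first coordinate, so that A(0, .) is the section v. *)
have -> : 'D_(0, vel u z0) A (0, z0) = 'D_(vel u z0) (lift_section v) z0.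
  rewrite -derive_slice; apply: near_eq_derive.
  have nW : \forall z \near z0, W (0, z).
    exact: (continuous_near (@continuous_slice _ _ (0 : R) z0) (open_near oW Wz0)).
  apply: filterS nW => z Wz.
  have nWz : \forall z' \near z, W (0, z').
    exact: (continuous_near (@continuous_slice _ _ (0 : R) z) (open_near oW Wz)).
  rewrite /A /= -derive_slice.
  rewrite (near_eq_derive (g := fst)); last by apply: filterS nWz => z' /F2.
  by rewrite derive_linear_fun//; exact: continuous_fst.
(* The derivatives in t and along vel v commute, and dF/dt at t = 0 is the section u. *)
have -> : 'D_(1, 0) A (0, z0) = 'D_(vel v z0) (lift_section u) z0.
  rewrite -derive_slice1.
  have -> : (fun t => A (t, z0)) = (fun t => 'D_(0, vel v z0) F (t, z0)) by [].
  apply: etrans (derive_slice1 ('D_(0, vel v z0) F) (0 : R) 1 z0) _.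
  rewrite (derive_symmetric _ _ oW sF Wz0) -derive_slice.
  apply: near_eq_derive.
  have nW : \forall z \near z0, W (0, z).
    exact: (continuous_near (@continuous_slice _ _ (0 : R) z0) (open_near oW Wz0)).
  by apply: filterS nW => z /F3.
by rewrite (bracket_formulaE su sv z0i) opprB.
Qed.

Lemma conj_mixed_bracket (x : circle R) (p : config R n) : Bset p -> off_breaks x p ->
  conj_mixed_derivative f g x p (- bracket_formula u v x p).
Proof.
move=> [q Bq <-]; rewrite -(cpi_repr x) => /(off_breaks_interior n0 Bq)[i [k zi]].
by have := conj_mixed zi; rewrite /= -mulrNz cpi_addz.
Qed.

End MixedDerivative.

(** * A smooth function that decreases as fast as prescribed *)

Section SmallFunction.
Variable R : realType.

(** The functions that occur in the derivatives of exp(-1/x), extended by 0. *)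
Definition flat (j : nat) (x : R) : R :=
  if 0 < x then x^-1 ^+ j * expR (- x^-1) else 0.

Lemma pow_expRN (n : nat) (y : R) : 0 <= y -> y ^+ n * expR (- y) <= n`!%:R.
Proof.
move=> y0; rewrite expRN ler_pdivrMr ?expR_gt0//.
have f0 : 0 < n`!%:R :> R by rewrite ltr0n fact_gt0.
rewrite mulrC -ler_pdivrMr//.
case: n f0 => [|n] f0; first by rewrite fact0 divr1 expr0 -expR0 ler_expR.
by rewrite (le_trans _ (expR_ge1Dxn n y0))// lerDr.
Qed.

Lemma flat_ge0 j x : 0 <= flat j x.
Proof.
rewrite /flat; case: ifPn => // x0.
by rewrite mulr_ge0 ?expR_ge0// exprn_ge0// invr_ge0 ltW.
Qed.

Lemma flat_gt0 x : 0 < x -> 0 < flat 0 x.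
Proof. by move=> x0; rewrite /flat x0 mul1r expR_gt0. Qed.

Lemma flat_eq0 j x : x <= 0 -> flat j x = 0.
Proof. by rewrite /flat leNgt => /negbTE ->. Qed.

Lemma flat_le j x : flat j x <= j`!%:R.
Proof.
rewrite /flat; case: ifPn => // x0; first by apply: pow_expRN; rewrite invr_ge0 ltW.
Qed.

Lemma flat_le_sqr j x : flat j x <= j.+2`!%:R * x ^+ 2.
Proof.
rewrite /flat; case: ifPn => x0; last by rewrite mulr_ge0// sqr_ge0.
have := @pow_expRN j.+2 x^-1; rewrite invr_ge0 (ltW x0) => /(_ isT).
have xn : x != 0 by rewrite gt_eqF.
move=> h; have := ler_wpM2r (sqr_ge0 x) h; congr (_ <= _).
by rewrite -addn2 exprD mulrAC; congr (_ * _); rewrite -mulrA -exprMn mulVf// expr1n mulr1.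
Qed.

(** At 0 the derivative vanishes because of [flat_le_sqr]. *)
Lemma flat_derive j (x : R) :
  is_derive x 1 (flat j) (flat j.+2 x - j%:R * flat j.+1 x).
Proof.
have [x0|x0|->] := ltgtP x 0.
- rewrite !flat_eq0 ?ltW// mulr0 subrr.
  have n0 : \near x, (cst 0 : R -> R) x = flat j x.
    have : \forall y \near x, y < 0 by exact: lt_nbhsl.
    by apply: filterS => y /ltW y0; rewrite flat_eq0.
  exact: near_eq_is_derive n0 (is_derive_cst _ _ _).
- have n0 : \near x, (fun y : R => y^-1 ^+ j * expR (- y^-1)) x = flat j x.
    have : \forall y \near x, 0 < y by exact: lt_nbhsr.
    by apply: filterS => y y0; rewrite /flat y0.
  apply: near_eq_is_derive n0 _; rewrite /flat x0.
  have xn : x != 0 by rewrite gt_eqF.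
  have d1 : is_derive x 1 (fun y : R => y^-1) (- x ^- 2).
    by have := @is_deriveV R id x 1 1 xn (is_derive_id _ _); rewrite /GRing.scale/= mulr1.
  have d2 : is_derive x 1 (fun y : R => y^-1 ^+ j) (j%:R * x^-1 ^+ j.-1 * - x ^- 2).
    have := @is_deriveX R R (fun y : R => y^-1) j x 1 _ d1.
    by rewrite (_ : (_ ^+ j : R -> R) = fun y : R => y^-1 ^+ j)//; apply/funext => y; rewrite exprfctE.
  have d3 : is_derive x 1 (fun y : R => expR (- y^-1)) (x ^- 2 * expR (- x^-1)).
    have dN : is_derive x 1 (fun y : R => - y^-1) (x ^- 2).
      by rewrite -[x ^- 2]opprK; exact: is_deriveN.
    rewrite [x ^- 2 * _]mulrC.
    exact: (@is_derive1_comp R expR (fun y : R => - y^-1) x _ _ (is_derive_expR _) dN).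
  have := @is_deriveM R R (fun y : R => y^-1 ^+ j) (fun y : R => expR (- y^-1)) x 1 _ _ d2 d3.
  move=> h; apply: is_derive_eq h _; rewrite /GRing.scale/=.
  rewrite -exprVn; case: (j) => [|i] /=; first by rewrite !expr0 expr2; ring.
  by rewrite !exprS; ring.
- rewrite !flat_eq0// mulr0 subrr.
  have [df dE] : differentiable (flat j) (0 : R) /\ 'd (flat j) 0 = cst 0 :> (R -> R).
    apply: differentiableW; [by move=> a y z; rewrite /= scaler0 addr0|exact: cst_continuous|].
    move=> e e0; pose C : R := j.+2`!%:R.
    have C0 : 0 < C by rewrite ltr0n fact_gt0.
    have n1 : \forall h \near (0 : R), `|0 - h| < e / C.
      by apply: (@cvgr_dist_lt _ R _ (nbhs 0) _ id 0) => //; rewrite divr_gt0.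
    apply: filterS n1 => h; rewrite sub0r normrN ltr_pdivlMr// => he.
    rewrite addr0 (flat_eq0 _ (lexx 0)) !subr0 ger0_norm ?flat_ge0//.
    rewrite (le_trans (flat_le_sqr j h))// -/C -real_normK ?num_real// expr2 mulrA.
    by rewrite ler_wpM2r// mulrC ltW.
  apply: DeriveDef; first exact: diff_derivable.
  by rewrite deriveE// dE.
Qed.

Lemma smooth_flat j (U : set R) : smooth_on U (flat j).
Proof.
move=> k; apply: Ck_sub (@subsetT _ U) _; elim: k j => [|k IH] j.
  by move=> x _; apply: differentiable_continuous; apply/derivable1_diffP; case: (flat_derive j x).
have df (x : R) : differentiable (flat j) x by apply/derivable1_diffP; case: (flat_derive j x).
split=> [x _|v]; first exact: df.
rewrite (_ : (fun x => _) = fun x => v * (flat j.+2 x + (- j%:R) * flat j.+1 x)).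
  apply: Ck_mul openT (Ck_cst _ _ _) _; apply: Ck_add openT _ _ => //.
  exact: Ck_mul openT (Ck_cst _ _ _) _.
apply/funext => x; rewrite derive_dir1//; congr (_ * _).
by have [_ ->] := flat_derive j x; rewrite mulNr.
Qed.

Definition bump (x : R) : R := flat 0 (1 + x) * flat 0 (1 - x).

Definition dbump (x : R) : R :=
  flat 2 (1 + x) * flat 0 (1 - x) - flat 0 (1 + x) * flat 2 (1 - x).

Lemma bump_derive (x : R) : is_derive x 1 bump (dbump x).
Proof.
have d1 : is_derive x 1 (fun y : R => 1 + y) 1.
  by rewrite -[X in is_derive _ _ _ X]add0r; apply: is_deriveD; exact: is_derive_id.
have d2 : is_derive x 1 (fun y : R => 1 - y) (- 1).
  by rewrite -[X in is_derive _ _ _ X]add0r; apply: is_deriveD; apply: is_deriveN; exact: is_derive_id.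
have f (y : R) : is_derive y 1 (flat 0) (flat 2 y).
  by have := flat_derive 0 y; rewrite mul0r subr0.
have e1 := @is_derive1_comp R (flat 0) _ x _ _ (f (1 + x)) d1.
have e2 := @is_derive1_comp R (flat 0) _ x _ _ (f (1 - x)) d2.
have := @is_deriveM R R _ _ x 1 _ _ e1 e2 => h.
by apply: is_derive_eq h _; rewrite /GRing.scale/= /dbump; ring.
Qed.

Lemma smooth_bump (U : set R) : smooth_on U bump.
Proof.
apply: smooth_sub (@subsetT _ U) _.
apply: smooth_mul openT _ _.
  apply: (smooth_comp openT _ _ (@smooth_flat 0 setT)) => //.
  apply: smooth_map_add; [exact: smooth_map_cst|exact: smooth_map_id].
apply: (smooth_comp openT _ _ (@smooth_flat 0 setT)) => //.
apply: smooth_map_add; first exact: smooth_map_cst.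
apply: smooth_map_linear => [a x y|x]; first by rewrite opprD scalerN.
exact: opp_continuous.
Qed.

Lemma bump_gt0 x : -1 < x < 1 -> 0 < bump x.
Proof. by move=> /andP[h1 h2]; rewrite mulr_gt0// flat_gt0//; lra. Qed.

Lemma bump_out x : (x <= -1) || (1 <= x) -> bump x = 0 /\ dbump x = 0.
Proof.
move=> /orP[h|h]; rewrite /bump /dbump.
  by rewrite !(@flat_eq0 _ (1 + x)) ?mul0r ?subr0//; lra.
by rewrite !(@flat_eq0 _ (1 - x)) ?mulr0 ?subr0//; lra.
Qed.

Lemma bump_le x : `|bump x| <= 4 /\ `|dbump x| <= 4.
Proof.
have h j y : 0 <= flat j y <= j`!%:R by rewrite flat_ge0 flat_le.
have := h 0%N (1 + x); have := h 0%N (1 - x); have := h 2%N (1 + x); have := h 2%N (1 - x).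
rewrite /bump /dbump fact0 (_ : 2`! = 2)//.
set a := flat 0 _; set b := flat 0 _; set c := flat 2 _; set d := flat 2 _.
by move=> /andP[d0 d1] /andP[c0 c1] /andP[b0 b1] /andP[a0 a1]; split; rewrite ler_norml; nra.
Qed.

(** The series of all [c i * bump (r - i)]: the bump centred at i vanishes at r as soon
    as r + 1 <= i. *)
Definition bump_sum (c : nat -> R) (r : R) : R :=
  \sum_(i < (Num.truncn r).+2) c i * bump (r - i%:R).

Lemma bump_sumE (c : nat -> R) (r : R) (N : nat) : r + 1 <= N%:R ->
  bump_sum c r = \sum_(i < N) c i * bump (r - i%:R).
Proof.
have H (M M' : nat) : (M <= M')%N -> r + 1 <= M%:R ->
    \sum_(i < M) c i * bump (r - i%:R) = \sum_(i < M') c i * bump (r - i%:R).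
  move=> MM' rM.
  rewrite -(big_mkord xpredT (fun i => c i * bump (r - i%:R))).
  rewrite -(big_mkord xpredT (fun i => c i * bump (r - i%:R))).
  rewrite [RHS](big_cat_nat (leq0n M) MM')//= [X in _ = _ + X](_ : _ = 0) ?addr0//.
  rewrite big_nat_cond; apply: big1 => i /andP[/andP[Mi _] _].
  have h : M%:R <= i%:R :> R by rewrite ler_nat.
  have [|-> _] := @bump_out (r - i%:R); last by rewrite mulr0.
  by apply/orP; left; lra.
move=> rN; have rT : r + 1 <= (Num.truncn r).+2%:R.
  by rewrite -natr1 lerD2r ltW// truncnS_gt.
rewrite /bump_sum; have [le|/ltnW le] := leqP N (Num.truncn r).+2; first exact: esym (H _ _ le rN).
exact: H.
Qed.

Lemma bump_sum_near (c : nat -> R) (r0 : R) (N : nat) : r0 + 1 < N%:R ->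
  \forall r \near r0, \sum_(i < N) c i * bump (r - i%:R) = bump_sum c r.
Proof.
move=> rN; have : \forall r \near r0, r < N%:R - 1 by apply: lt_nbhsl; lra.
by apply: filterS => r rN'; rewrite (@bump_sumE _ _ N)//; lra.
Qed.

Lemma smooth_bump_sum c (U : set R) : smooth_on U (bump_sum c).
Proof.
apply: smooth_local => a _; pose N := (Num.truncn a).+2.
exists [set r | r < N%:R - 1]; split.
- exact: open_lt.
- rewrite /= ltrBrDr /N -natr1 ltrD2r; exact: truncnS_gt.
apply: (@smooth_ext _ _ _ (fun r : R => \sum_(i < N) c i * bump (r - i%:R))).
- exact: open_lt.
- by move=> r /= rN; rewrite (@bump_sumE _ _ N)//; lra.
have oN : open [set r : R | r < N%:R - 1] by exact: open_lt.
apply: smooth_sum => // i _; apply: smooth_mul => //; first exact: smooth_cst.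
apply: (smooth_comp oN _ _ (@smooth_bump setT)) => //.
apply: smooth_map_add; [exact: smooth_map_id|exact: smooth_map_cst].
Qed.

Lemma sum_two (c : nat -> R) (f : R -> R) (m : nat) (r : R) :
  (forall x, (x <= -1) || (1 <= x) -> f x = 0) -> m%:R <= r <= m.+1%:R ->
  \sum_(i < m.+3) c i * f (r - i%:R) = c m * f (r - m%:R) + c m.+1 * f (r - m.+1%:R).
Proof.
move=> f0 /andP[mr rm]; rewrite !big_ord_recr/= big1 => [|i _].
  rewrite add0r [f (r - m.+2%:R)]f0 ?mulr0 ?addr0//.
  by move: rm; rewrite -!natr1 => rm; apply/orP; left; lra.
rewrite f0 ?mulr0//; apply/orP; right.
have : i.+1%:R <= m%:R :> R by rewrite ler_nat.
by rewrite -natr1; lra.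
Qed.

(** On [m, m + 1] only the bumps centred at m and m + 1 contribute, and they and
    their derivatives are at most 4: the coefficients are chosen below 1 / (8 C_m). *)
Lemma smooth_small_function (C : nat -> R) : (forall m, 0 < C m) ->
  exists G : R -> R, smooth_on setT G /\ forall (m : nat) r, m%:R <= r < m.+1%:R ->
    [/\ 0 < G r, G r <= (C m)^-1 & `|'D_1 G r| <= (C m)^-1].
Proof.
(* The sum makes both c m and c m.+1 at most 1 / (8 C_m). *)
move=> C0; pose c (m : nat) := (8 * \sum_(i < m.+1) C i)^-1.
have S0 m : 0 < \sum_(i < m.+1) C i.
  by rewrite big_ord_recr/= ltr_wpDl// sumr_ge0// => i _; exact: ltW.
have c0 m : 0 < c m by rewrite invr_gt0 mulr_gt0.
have c1 m : c m <= (8 * C m)^-1.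
  rewrite lef_pV2 ?posrE ?mulr_gt0// ler_wpM2l// big_ord_recr/= lerDr.
  by rewrite sumr_ge0// => i _; exact: ltW.
have c2 m : c m.+1 <= (8 * C m)^-1.
  rewrite (le_trans _ (c1 m))// lef_pV2 ?posrE ?mulr_gt0// ler_wpM2l//.
  by rewrite [leRHS]big_ord_recr/= lerDl ltW.
exists (bump_sum c); split=> [|m r mr]; first exact: smooth_bump_sum.
have mr' : m%:R <= r <= m.+1%:R by case/andP: mr => -> /ltW.
have rN : r + 1 < m.+3%:R by case/andP: mr => _; rewrite -!natr1; lra.
have bd (f : R -> R) : (forall x, `|f x| <= 4) ->
    `|c m * f (r - m%:R) + c m.+1 * f (r - m.+1%:R)| <= (C m)^-1.
  move=> f4; have h1 := f4 (r - m%:R); have h2 := f4 (r - m.+1%:R).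
  rewrite (le_trans (ler_normD _ _))// !normrM !(gtr0_norm (c0 _)).
  have -> : (C m)^-1 = (8 * C m)^-1 * 4 + (8 * C m)^-1 * 4.
    by field; rewrite gt_eqF.
  by rewrite lerD// ler_pM// ltW.
have E := sum_two c (fun x h => (@bump_out x h).1) mr'.
split.
- rewrite (@bump_sumE _ _ m.+3) ?ltW// E ltr_wpDr//.
    by apply: mulr_ge0; [exact: ltW|apply: mulr_ge0; exact: flat_ge0].
  rewrite mulr_gt0// bump_gt0//; move: mr; rewrite -natr1; lra.
- rewrite (etrans (bump_sumE c (ltW rN)) E); apply: le_trans (ler_norm _) _.
  by apply: bd => x; case: (bump_le x).
have d : is_derive r 1 (bump_sum c) (\sum_(i < m.+3) c i * dbump (r - i%:R)).
  apply: near_eq_is_derive (bump_sum_near c rN) _.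
  have := @is_derive_sum R R R m.+3 (fun i x => c i * bump (x - i%:R)) r 1
    (fun i : 'I_m.+3 => c i * dbump (r - i%:R)).
  have -> : \sum_(i < m.+3) (fun x => c i * bump (x - i%:R)) =
    (fun x => \sum_(i < m.+3) c i * bump (x - i%:R)).
    by apply/funext => x; rewrite fct_sumE.
  apply=> i.
  have d1 : is_derive r 1 (fun y : R => y - i%:R) 1.
    by rewrite -[X in is_derive _ _ _ X]addr0; apply: is_deriveD; exact: is_derive_id.
  have h := @is_derive1_comp R bump _ r _ _ (bump_derive (r - i%:R)) d1.
  have h' := @is_deriveM R R (cst (c i)) _ r 1 _ _ (is_derive_cst _ _ _) h.
  by apply: is_derive_eq h' _; rewrite /GRing.scale/=; ring.
have [_ ->] := d; rewrite (sum_two c (fun x h => (@bump_out x h).2) mr').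
by apply: bd => x; case: (bump_le x).
Qed.

End SmallFunction.

(** * Bounds on a section that are uniform up to a function of the base *)

Lemma closed_le_fun (R : realType) (T : topologicalType) (f g : T -> R) :
  continuous f -> continuous g -> closed [set x | f x <= g x].
Proof.
move=> cf cg; rewrite (_ : [set x | _] = (fun x => g x - f x) @^-1` [set y | 0 <= y]).
  apply: preimage_closed; last exact: closed_ge.
  by move=> x _; exact: cvgB (cg x) (cf x).
by apply/seteqP; split=> x /=; rewrite subr_ge0.
Qed.

Lemma compact_norm_bound (R : realType) (T : topologicalType) (I : finType)
    (K : set T) (f : I -> T -> R) :
  compact K -> (forall i z, K z -> {for z, continuous (f i)}) ->
  exists2 c, 0 <= c & forall i z, K z -> `|f i z| <= c.
Proof.
move=> cK cf; have ex i : exists c1, forall c z, c1 <= c -> K z -> `|f i z| <= c.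
  apply: compact_bound => // z Kz; exists (`|f i z| + 1).
  have cn : {for z, continuous (fun x => `|f i x|)} by exact: cvg_norm (cf i z Kz).
  have nD : \forall z' \near z, `|f i z'| < `|f i z| + 1.
    by apply: (cvgr_lt _ cn); rewrite ltrDl.
  by apply: filterS nD => z' Dz' c cge _; rewrite (le_trans (ltW Dz')).
have [c cP] := choice ex.
exists (\sum_i `|c i|); first exact: sumr_ge0.
move=> i z Kz; apply: cP => //.
rewrite (le_trans (ler_norm _))// (bigD1 i)//= lerDl; exact: sumr_ge0.
Qed.

Section FieldBound.
Variables (R : realType) (n : nat).
Hypothesis n0 : (0 < n)%N.
Local Notation cpi := (@cpi R).
Local Notation proj := (@Defs.proj R n).
Local Notation E := (R * 'rV[R]_n)%type.
Local Notation e := (delta_mx 0 : 'I_n -> 'rV[R]_n).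
Implicit Types (u : circle R -> config R n -> R) (z : E) (q : 'rV[R]_n).

Definition arc_length (i : 'I_n) q : R := nextpt q i - q 0 i.

(** A smooth function on the base that tends to infinity when two breaks collide. *)
Definition crowding q : R := \sum_i (arc_length i q)^-1.

Definition break_value u (j : 'I_n) q : R := lift_section u (break j q).

Lemma arc_length_gt0 i q : Bcover q -> 0 < arc_length i q.
Proof. by move=> /(_ i); rewrite subr_gt0. Qed.

Lemma arc_length_shift i q c : arc_length i (q + const_mx c) = arc_length i q.
Proof. by rewrite /arc_length nextpt_shift !mxE; ring. Qed.

Lemma crowding_shift q c : crowding (q + const_mx c) = crowding q.
Proof. by apply: eq_bigr => i _; rewrite arc_length_shift. Qed.

Lemma crowding_ge i q : Bcover q -> (arc_length i q)^-1 <= crowding q.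
Proof.
move=> Bq; rewrite /crowding (bigD1 i)//= lerDl sumr_ge0// => j _.
by rewrite invr_ge0 ltW// arc_length_gt0.
Qed.

Lemma break_value_shift u j q (k : int) :
  break_value u j (q + const_mx k%:~R) = break_value u j q.
Proof. by rewrite /break_value /lift_section /= proj_shift !mxE cpi_addz. Qed.

Lemma smooth_arc_length i (U : set 'rV[R]_n) : smooth_on U (arc_length i).
Proof.
apply: smooth_sub (@subsetT _ U) _.
apply: smooth_add openT _ _; last exact: smooth_opp openT (@smooth_coord _ _ _ _).
by apply: smooth_add openT _ _; [exact: smooth_coord|exact: smooth_cst].
Qed.

Lemma smooth_crowding : smooth_on Bcover crowding.
Proof.
apply: smooth_sum => [|i _]; first exact: Bcover_open.
apply: smooth_inv => [|q Bq|]; [exact: Bcover_open| |exact: smooth_arc_length].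
by rewrite gt_eqF// arc_length_gt0.
Qed.

(** The quantities that have to be compensated by a small factor for the breaks and
    the points of each arc to move by contractive perturbations of the identity. *)
Definition field_bound u (C : R) q : Prop :=
  slope_le q (fun x => u (cpi x) (proj q)) C /\
  forall i j, [/\ `|break_value u j q| <= C, `|'D_(e i) (break_value u j) q| <= C &
    `|'D_(e i) crowding q| <= C].

Lemma slope_le_mono q (f : R -> R) (L L' : R) : L <= L' ->
  slope_le q f L -> slope_le q f L'.
Proof.
move=> LL' sl i a /sl[N [g [h1 h2 h3 h4 h5]]]; exists N, g; split=> //.
exact: le_trans LL'.
Qed.

Lemma field_bound_shift u C q (k : int) :
  field_bound u C q -> field_bound u C (q + const_mx k%:~R).
Proof.
move=> [sl H]; split.
  rewrite proj_shift; apply: slope_le_shift => // x l; by rewrite cpi_addz.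
move=> i j; have [h1 h2 h3] := H i j; rewrite break_value_shift -!derive_translate.
have -> : (fun q => break_value u j (q + const_mx k%:~R)) = break_value u j.
  by apply/funext => q'; rewrite break_value_shift.
have -> // : (fun q => crowding (q + const_mx k%:~R)) = crowding.
by apply/funext => q'; rewrite crowding_shift.
Qed.

Let o := Ordinal n0.

(** A compact set of lifts, which meets the fibre of each p whose arcs have length at
    least 1 / (m + 1). *)
Definition wide (m : nat) : set 'rV[R]_n :=
  [set q : 'rV[R]_n | 0 <= q 0 o <= 1 /\ forall i, m.+1%:R^-1 <= arc_length i q].

Lemma wide_Bcover m q : wide m q -> Bcover q.
Proof.
move=> [_ H] i; rewrite -subr_gt0; apply: lt_le_trans (H i).
by rewrite invr_gt0 ltr0n.
Qed.

Lemma wide_range m q i : wide m q -> 0 <= q 0 i <= 2 /\ nextpt q i <= 3.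
Proof.
move=> wq; have Bq := wide_Bcover wq; have [/andP[q0 q1] _] := wq.
have H j : 0 <= q 0 j <= 2.
  have h1 := @Bcover_mono R n q o j Bq (leq0n _).
  by have h2 := @Bcover_lt1 R n q o j Bq; apply/andP; split; lra.
split=> //; rewrite /nextpt; have /andP[_ h] := H (ordS i).
by case: (_ == n) => /=; lra.
Qed.

Lemma coord_cont i : continuous (fun q : 'rV[R]_n => q 0 i).
Proof. exact: coord_continuous. Qed.

Lemma wide_compact m : compact (wide m).
Proof.
apply: (@subclosed_compact _ _ [set v : 'rV[R]_n | forall i, `[0, 2]%classic (v ord0 i)]).
- rewrite (_ : wide m = [set q : 'rV[R]_n | 0 <= q 0 o] `&` [set q : 'rV[R]_n | q 0 o <= 1] `&`
      \bigcap_i [set q : 'rV[R]_n | m.+1%:R^-1 <= arc_length i q]); last first.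
    apply/seteqP; split=> q.
      by move=> [/andP[h1 h2] h3]; split=> // i _; exact: h3.
    by move=> [[/= h1 h2] h3]; split=> [|i]; [rewrite h1|exact: h3].
  apply: closedI.
    have cc (a : R) : continuous (fun _ : 'rV[R]_n => a) by exact: cst_continuous.
    by apply: closedI; apply: closed_le_fun => //; exact: coord_cont.
  apply: closed_bigI => i _; apply: closed_le_fun; first exact: cst_continuous.
  by move=> q; exact: (smooth_continuous (@smooth_arc_length i setT)).
- exact: (@rV_compact R n (fun=> `[(0:R), 2]%classic) (fun=> @segment_compact R 0 2)).
- by move=> q wq i /=; rewrite in_itv/=; have [] := wide_range i wq.
Qed.

Lemma wide_translate m q : Bcover q -> crowding q <= m.+1%:R ->
  exists k : int, wide m (q + const_mx k%:~R).
Proof.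
move=> Bq qm; exists (- Num.floor (q 0 o)); split.
  have /andP[] := floor_itv (q 0 o).
  rewrite intrD !mxE mulrNz => h1 h2; apply/andP; split; lra.
move=> i; rewrite arc_length_shift -[leRHS]invrK lef_pV2 ?posrE ?ltr0n//.
  exact: le_trans (crowding_ge i Bq) qm.
by rewrite invr_gt0 arc_length_gt0.
Qed.

(** The points (x, q) of a closed piece with [q] in [wide m] form a compact set, and
    near each of them a local extension of the section has a bounded x-derivative. *)
Lemma wide_slope u m : smooth_section u ->
  exists2 C, 0 <= C & forall q, wide m q -> slope_le q (fun x => u (cpi x) (proj q)) C.
Proof.
move=> su; pose K i : set E := [set z | wide m z.2 /\ z.2 0 i <= z.1 <= nextpt z.2 i].
have cK i : compact (K i).
  apply: (@subclosed_compact _ _ ((`[(0 : R), 3]%classic : set R) `*` wide m)).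
  - rewrite (_ : K i = [set z : E | z.2 0 i <= z.1] `&` [set z : E | z.1 <= nextpt z.2 i]
       `&` (snd @^-1` wide m)); last first.
      apply/seteqP; split=> z; first by move=> [h /andP[h1 h2]].
      by move=> [[/= h1 h2] h3]; split=> //; rewrite h1.
    have c1 : continuous (fun z : E => z.1) by move=> z; exact: cvg_fst.
    have c2 : continuous (fun z : E => z.2) by move=> z; exact: cvg_snd.
    have cc : continuous (fun z : E => z.2 0 i).
      by move=> z; apply: (@continuous_comp _ _ _ snd (fun q => q 0 i)); [exact: c2|exact: coord_cont].
    have cn : continuous (fun z : E => nextpt z.2 i).
      by move=> z; apply: (@continuous_comp _ _ _ snd (fun q => nextpt q i)); [exact: c2|exact: continuous_nextpt].
    apply: closedI; first by apply: closedI; exact: closed_le_fun.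
    apply: preimage_closed; first by move=> z _; exact: c2.
    by apply: compact_closed; [exact: norm_hausdorff|exact: wide_compact].
  - by apply: compact_setX; [exact: segment_compact|exact: wide_compact].
  - move=> z [wz /andP[h1 h2]]; split=> //=; rewrite in_itv/=.
    have [/andP[h3 h4] h5] := wide_range i wz.
    by rewrite (le_trans h3 h1) (le_trans h2 h5).
have ex i : exists c1, forall c z, c1 <= c -> K i z ->
    slope_at z.2 (fun x => u (cpi x) (proj z.2)) i c z.1.
  apply: compact_bound => // z [wz zi]; have [_ /(_ i z)] := su.
  move=> /(_ (conj (wide_Bcover wz) zi))[N [g [oN Nz sg ug]]].
  exists (`|'D_(1, 0) g z| + 1).
  have cD := smooth_continuous (smooth_derive ((1, 0) : E) sg) Nz.
  have cn : {for z, continuous (fun y => `|'D_(1, 0) g y|)} by exact: cvg_norm.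
  have nD : \forall z' \near z, `|'D_(1, 0) g z'| < `|'D_(1, 0) g z| + 1.
    by apply: (cvgr_lt _ cn); rewrite ltrDl.
  apply: filterS2 (open_near oN Nz) nD => -[x q] Nxq Dxq c cge [wq xi].
  have cp : continuous (fun x : R => (x, q)).
    by move=> y; apply: continuous_pair_at; [exact: cvg_id|exact: cvg_cst].
  exists [set x | N (x, q)], (fun x => g (x, q)); split=> //=.
  - by apply: open_comp => // y _; exact: cp.
  - apply: (smooth_comp _ _ _ sg) => //.
      by apply: open_comp => // y _; exact: cp.
    by apply: smooth_map_pair; [exact: smooth_map_id|exact: smooth_map_cst].
  - move=> y yi Ny; apply: (ug (y, q)) => //.
    by split=> //; exact: wide_Bcover wq.
  - by rewrite derive_slice1 (le_trans (ltW Dxq)).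
have [c cP] := choice ex.
exists (\sum_i `|c i|); first exact: sumr_ge0.
move=> q wq i a ai; apply: (cP i _ (a, q)) => //.
rewrite (le_trans (ler_norm _))// (bigD1 i)//= lerDl; exact: sumr_ge0.
Qed.

Lemma smooth_break_value u j : smooth_section u -> smooth_on Bcover (break_value u j).
Proof. exact: section_smooth_break. Qed.

Lemma wide_bound u m : smooth_section u ->
  exists2 C, 1 <= C & forall q, wide m q -> field_bound u C q.
Proof.
move=> su; have [C1 C10 C1P] := wide_slope m su.
have cB (f : 'rV[R]_n -> R) q : smooth_on Bcover f -> wide m q -> {for q, continuous f}.
  by move=> sf /wide_Bcover; exact: smooth_continuous sf.
have [C2 C20 C2P] := @compact_norm_bound R _ 'I_n _ (break_value u) (@wide_compact m)
  (fun j q wq => cB _ q (smooth_break_value j su) wq).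
have [C3 C30 C3P] := @compact_norm_bound R _ ('I_n * 'I_n)%type _
  (fun ij => 'D_(e ij.1) (break_value u ij.2)) (@wide_compact m)
  (fun ij q wq => cB _ q (smooth_derive (e ij.1) (smooth_break_value ij.2 su)) wq).
have [C4 C40 C4P] := @compact_norm_bound R _ 'I_n _ (fun i => 'D_(e i) crowding) (@wide_compact m)
  (fun i q wq => cB _ q (smooth_derive (e i) smooth_crowding) wq).
exists (1 + C1 + C2 + C3 + C4); first lra.
move=> q wq; split; first by apply: slope_le_mono (C1P q wq); lra.
move=> i j; have h2 := C2P j q wq; have h3 := C3P (i, j) q wq; have h4 := C4P i q wq.
by split; [apply: le_trans h2 _|apply: le_trans h3 _|apply: le_trans h4 _]; lra.
Qed.

(** The bounds hold on each compact set [wide m] with a constant C_m, and [eps] is a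
    function of [crowding] that is small compared with C_m where [crowding] is between
    m and m + 1. Its gradient has a bound with one more factor C, the bound on the
    gradient of [crowding]. *)
Lemma section_bound u : smooth_section u ->
  exists eps : 'rV[R]_n -> R,
  [/\ smooth_on Bcover eps, forall q c, eps (q + const_mx c) = eps q &
  forall q, Bcover q -> exists C, [/\ 1 <= C, field_bound u C q,
    forall i, (arc_length i q)^-1 <= C, 0 < eps q &
    eps q <= (4 * n%:R * C ^+ 2)^-1 /\
    forall i, `|'D_(e i) eps q| <= (4 * n%:R * C ^+ 2)^-1 * C]].
Proof.
move=> su.
have ex m : exists C, 1 <= C /\ forall q, wide m q -> field_bound u C q.
  by have [C C1 CP] := wide_bound m su; exists C.
have [C CP] := choice ex.
have nR : 0 < n%:R :> R by rewrite ltr0n.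
pose C' m := C m + m.+1%:R.
have C'1 m : 1 <= C' m by have [h _] := CP m; rewrite /C' (le_trans h)// lerDl.
have C''0 m : 0 < 4 * n%:R * C' m ^+ 2.
  by apply: mulr_gt0; [exact: mulr_gt0|rewrite exprn_gt0// (lt_le_trans ltr01)].
have [G [sG GP]] := smooth_small_function C''0.
exists (fun q => G (crowding q)); split.
- apply: (@smooth_comp R _ _ _ setT G crowding) => //; first exact: Bcover_open.
  by apply: smooth_map_real; exact: smooth_crowding.
- by move=> q c; rewrite crowding_shift.
move=> q Bq; have c0 : 0 <= crowding q.
  by rewrite sumr_ge0// => i _; rewrite invr_ge0 ltW// arc_length_gt0.
pose m := Num.truncn (crowding q).
have /andP[m1 m2] := truncn_itv c0; rewrite -/m in m1 m2.
have [g1 g2 g3] := GP m (crowding q) (introT andP (conj m1 m2)).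
have fb : field_bound u (C' m) q.
  have [k wq] := wide_translate Bq (ltW m2).
  have [sl H] : field_bound u (C m) q.
    have := @field_bound_shift u (C m) _ (- k) ((CP m).2 _ wq).
    rewrite -addrA (_ : const_mx _ + const_mx _ = 0) ?addr0//.
    by apply/rowP => i; rewrite !mxE mulrNz subrr.
  have le : C m <= C' m by rewrite lerDl.
  split; first exact: slope_le_mono sl.
  by move=> i j; have [h1 h2 h3] := H i j; split; apply: le_trans le.
exists (C' m); split=> //.
  move=> i; apply: (le_trans (crowding_ge i Bq)); apply: (le_trans (ltW m2)).
  by rewrite lerDr (le_trans ler01)//; case: (CP m).
split=> // i.
have dc := smooth_differentiable smooth_crowding Bq.
have dG : differentiable G (crowding q) by exact: smooth_differentiable sG _.
rewrite (@derive_comp _ _ _ _ G crowding)// -deriveE// derive_dir1// normrM mulrC.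
have [_ _ h] := fb.2 i i.
by rewrite ler_pM.
Qed.

End FieldBound.

(** * Every section is the velocity of a curve of bisections *)

Section Damp.
Variable R : realType.

(** Equal to t to first order at t = 0, but bounded by e / 2, and with a derivative
    in e that is at most 1, for all times t. *)
Definition damp (t e : R) : R := t * e ^+ 2 / (e ^+ 2 + t ^+ 2).

Lemma damp_den_gt0 (t e : R) : 0 < e -> 0 < e ^+ 2 + t ^+ 2.
Proof. by move=> e0; rewrite ltr_wpDr ?sqr_ge0// exprn_gt0. Qed.

Lemma damp_le t e : 0 < e -> `|damp t e| <= e / 2.
Proof.
move=> e0; have d0 := damp_den_gt0 t e0.
rewrite /damp normrM normfV (gtr0_norm d0) ler_pdivrMr// normrM (ger0_norm (sqr_ge0 e)).
have : 0 <= (e - `|t|) ^+ 2 by exact: sqr_ge0.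
rewrite sqrrB -normrX (ger0_norm (sqr_ge0 t)) => h.
have := normr_ge0 t; nra.
Qed.

Lemma damp_derive_e (t : R) (e : R) : 0 < e ->
  is_derive e 1 (damp t) (2 * t ^+ 3 * e / (e ^+ 2 + t ^+ 2) ^+ 2).
Proof.
move=> e0; have d0 := damp_den_gt0 t e0.
have d1 : is_derive e 1 (fun y : R => y ^+ 2) (2 * e).
  have := @is_deriveX R R id 2 e 1 1 (is_derive_id _ _).
  rewrite (_ : (_ ^+ _ : R -> R) = fun y : R => y ^+ 2); last by apply/funext => y; rewrite exprfctE.
  by rewrite /GRing.scale/= mulr1 expr1.
have d2 : is_derive e 1 (fun y : R => y ^+ 2 + t ^+ 2) (2 * e).
  by rewrite -[2 * e]addr0; apply: is_deriveD.
have dn : e ^+ 2 + t ^+ 2 != 0 by rewrite gt_eqF.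
have d3 := @is_deriveV R _ e _ 1 dn d2.
have d4 := @is_deriveM R R (cst t) _ e 1 _ _ (is_derive_cst _ _ _) d1.
have d5 := @is_deriveM R R _ _ e 1 _ _ d4 d3.
apply: is_derive_eq d5 _.
change (t * e ^+ 2 * (- (e ^+ 2 + t ^+ 2) ^- 2 * (2 * e)) +
  (e ^+ 2 + t ^+ 2)^-1 * (t * (2 * e) + e ^+ 2 * 0) =
  2 * t ^+ 3 * e / (e ^+ 2 + t ^+ 2) ^+ 2).
by field.
Qed.

Lemma damp_derive_e_le (t e : R) : 0 < e ->
  `|2 * t ^+ 3 * e / (e ^+ 2 + t ^+ 2) ^+ 2| <= 1.
Proof.
move=> e0; have d0 := damp_den_gt0 t e0.
rewrite normrM normfV (gtr0_norm (exprn_gt0 2 d0)) ler_pdivrMr ?exprn_gt0// mul1r.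
have -> : 2 * t ^+ 3 * e = (2 * t * e) * t ^+ 2 by ring.
rewrite normrM (ger0_norm (sqr_ge0 t)) expr2 ler_pM ?sqr_ge0//; last first.
  by rewrite lerDr sqr_ge0.
rewrite ler_norml; apply/andP; split.
  by have := sqr_ge0 (e + t); rewrite sqrrD; lra.
by have := sqr_ge0 (e - t); rewrite sqrrB; lra.
Qed.

Lemma damp0 e : damp 0 e = 0.
Proof. by rewrite /damp !mul0r. Qed.

Lemma damp_derive_t (e : R) : 0 < e -> is_derive (0 : R) 1 (damp^~ e) 1.
Proof.
move=> e0; have en : e != 0 by rewrite gt_eqF.
have d1 : is_derive (0 : R) 1 (fun y : R => y ^+ 2) 0.
  have := @is_deriveX R R id 2 0 1 1 (is_derive_id _ _).
  rewrite (_ : (_ ^+ _ : R -> R) = fun y : R => y ^+ 2); last by apply/funext => y; rewrite exprfctE.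
  by rewrite /GRing.scale/= mulr1 expr1 mulr0.
have d2 : is_derive (0 : R) 1 (fun y : R => e ^+ 2 + y ^+ 2) 0.
  by rewrite -[X in is_derive _ _ _ X]addr0; apply: is_deriveD.
have dn : e ^+ 2 + 0 ^+ 2 != 0 by rewrite gt_eqF// damp_den_gt0.
have d3 := @is_deriveV R _ (0 : R) _ 1 dn d2.
have d4 := @is_deriveM R R id (cst (e ^+ 2)) (0 : R) 1 _ _ (is_derive_id _ _) (is_derive_cst _ _ _).
have d5 := @is_deriveM R R _ _ (0 : R) 1 _ _ d4 d3.
by apply: is_derive_eq d5 _; rewrite /GRing.scale/=; field.
Qed.

Lemma smooth_damp : smooth_on [set z : R * R | 0 < z.2] (fun z => damp z.1 z.2).
Proof.
have oP : open [set z : R * R | 0 < z.2].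
  by apply: (@open_comp _ _ snd [set y : R | 0 < y]); [move=> z _; exact: cvg_snd|exact: open_gt].
have s1 : smooth_on [set z : R * R | 0 < z.2] fst.
  by apply: smooth_linear; [exact: linear_fst|exact: continuous_fst].
have s2 : smooth_on [set z : R * R | 0 < z.2] snd.
  by apply: smooth_linear; [exact: linear_snd|exact: continuous_snd].
have s3 : smooth_on [set z : R * R | 0 < z.2] (fun z => z.2 ^+ 2).
  exact: (smooth_mul oP s2 s2).
have s4 : smooth_on [set z : R * R | 0 < z.2] (fun z => z.1 ^+ 2).
  exact: (smooth_mul oP s1 s1).
apply: smooth_mul (oP) _ _; first exact: (smooth_mul oP s1 s3).
apply: smooth_inv (oP) _ _; last exact: (smooth_add oP s3 s4).
by move=> z /= z0; rewrite gt_eqF// damp_den_gt0.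
Qed.

End Damp.

Section ExistsCurve.
Variables (R : realType) (n : nat).
Hypothesis n0 : (0 < n)%N.
Local Notation cpi := (@cpi R).
Local Notation proj := (@Defs.proj R n).
Local Notation E := (R * 'rV[R]_n)%type.
Local Notation e := (delta_mx 0 : 'I_n -> 'rV[R]_n).
Implicit Types (z : E) (q : 'rV[R]_n) (p : config R n).

Variables (u : circle R -> config R n -> R) (eps : 'rV[R]_n -> R).
Hypothesis su : smooth_section u.
Hypothesis seps : smooth_on Bcover eps.
Hypothesis eps_shift : forall q c, eps (q + const_mx c) = eps q.
Hypothesis epsP : forall q, Bcover q -> exists C, [/\ 1 <= C, field_bound u C q,
    forall i, (arc_length i q)^-1 <= C, 0 < eps q &
    eps q <= (4 * n%:R * C ^+ 2)^-1 /\
    forall i, `|'D_(e i) eps q| <= (4 * n%:R * C ^+ 2)^-1 * C].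

Let N : R := n%:R.
Let N1 : 1 <= N. Proof. by rewrite /N ler1n. Qed.

Let Nn : N != 0. Proof. by rewrite gt_eqF// (lt_le_trans ltr01). Qed.

Lemma eps_gt0 q : Bcover q -> 0 < eps q.
Proof. by case/epsP => C []. Qed.

Definition displacement_coeff t (j : 'I_n) q : R := damp t (eps q) * break_value u j q.

Let wc := displacement_coeff.

Lemma smooth_damp_eps t : smooth_on Bcover (fun q => damp t (eps q)).
Proof.
apply: (@smooth_comp R _ _ _ _ (fun z : R * R => damp z.1 z.2) (fun q => (t, eps q))) (@smooth_damp R).
- exact: Bcover_open.
- by move=> q /eps_gt0.
- by apply: smooth_map_pair; [exact: smooth_map_cst|apply: smooth_map_real].
Qed.

Lemma smooth_displacement t j : smooth_on Bcover (wc t j).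
Proof.
apply: smooth_mul; [exact: Bcover_open|exact: smooth_damp_eps|exact: smooth_break_value].
Qed.

(** The breaks move by at most a quarter of the length of each arc, so that they keep
    their order, and the displacement tends to 0 at the boundary of the covering. *)
Lemma displacement_le t j q i : Bcover q -> `|wc t j q| <= arc_length i q / 4.
Proof.
move=> Bq; have [C [C1 [_ H] /(_ i) aC e0 [eC _]]] := epsP Bq.
have [h1 _ _] := H j j; rewrite /wc /displacement_coeff normrM.
have C0 : 0 < C by lra.
have Cn : C != 0 by rewrite gt_eqF.
have a0 := arc_length_gt0 i Bq.
have aC' : 1 <= C * arc_length i q by rewrite -ler_pdivrMr// mul1r.
apply: (@le_trans _ _ ((4 * N * C ^+ 2)^-1 / 2 * C)).
  rewrite ler_pM//; apply: (le_trans (damp_le t e0)).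
  by rewrite ler_wpM2r// invr_ge0.
have -> : (4 * N * C ^+ 2)^-1 / 2 * C = (8 * N * C)^-1 by field; rewrite Nn Cn.
have NC : 0 < 8 * N * C by rewrite mulr_gt0// mulr_gt0// (lt_le_trans ltr01).
rewrite -[leLHS]mul1r ler_pdivrMr//.
have : 1 <= N * (C * arc_length i q) by rewrite -[leLHS]mulr1 ler_pM.
by move: (N) => M; lra.
Qed.

Lemma displacement_derive_le t j i q : Bcover q ->
  `|'D_(e i) (wc t j) q| <= (2 * N)^-1.
Proof.
move=> Bq; have [C [C1 [_ H] _ e0 [eC eD]]] := epsP Bq.
have [h1 h2 _] := H i j; have {}eD := eD i.
have C0 : 0 < C by lra.
have de := smooth_differentiable seps Bq.
have dU := smooth_differentiable (smooth_break_value j su) Bq.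
have dX := smooth_differentiable (smooth_damp_eps t) Bq.
have dd : differentiable (damp t) (eps q).
  by apply/derivable1_diffP; case: (damp_derive_e t e0).
have DX : `|'D_(e i) (fun q => damp t (eps q)) q| <= (4 * N * C ^+ 2)^-1 * C.
  rewrite (@derive_comp _ _ _ _ (damp t) eps)// -deriveE// derive_dir1// normrM.
  have [_ ->] := damp_derive_e t e0; rewrite -[leRHS]mulr1.
  by rewrite ler_pM// damp_derive_e_le.
rewrite /wc /displacement_coeff.
rewrite (@deriveM _ _ (fun q => damp t (eps q)) (break_value u j)); try exact: diff_derivable.
rewrite (le_trans (ler_normD _ _))// /GRing.scale/=.
have hX : `|damp t (eps q)| <= (4 * N * C ^+ 2)^-1 / 2.
  by apply: (le_trans (damp_le t e0)); rewrite ler_wpM2r// invr_ge0.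
move: hX; set X := damp t (eps q); clearbody X => hX; rewrite !normrM.
apply: (@le_trans _ _ ((4 * N * C ^+ 2)^-1 / 2 * C + C * ((4 * N * C ^+ 2)^-1 * C))).
  by apply: lerD; rewrite ler_pM.
have Cn : C != 0 by rewrite gt_eqF.
have -> : (4 * N * C ^+ 2)^-1 / 2 * C + C * ((4 * N * C ^+ 2)^-1 * C) =
    (8 * N)^-1 * C^-1 + (4 * N)^-1 by field; rewrite Nn Cn.
have -> : (2 * N)^-1 = (4 * N)^-1 + (4 * N)^-1 by field.
rewrite lerD2r -[leRHS]mulr1 ler_pM ?invr_ge0 ?invf_le1 ?(ltW C0)//.
  by move: (N) N1 => M M1; lra.
by rewrite lef_pV2 ?posrE; move: (N) N1 => M M1; lra.
Qed.

(** The extension by 0 makes the displacement a contraction of a complete space, to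
    which the fixed point theorem applies. *)
Definition displacement t q : 'rV[R]_n :=
  if `[< Bcover q >] then \row_j wc t j q else 0.

Lemma displacementE t q : Bcover q -> displacement t q = \row_j wc t j q.
Proof. by move=> Bq; rewrite /displacement; case: asboolP. Qed.

Lemma displacement_out t q : ~ Bcover q -> displacement t q = 0.
Proof. by move=> Bq; rewrite /displacement; case: asboolP. Qed.

Lemma displacement_norm_le t q i : Bcover q ->
  `|displacement t q| <= arc_length i q / 4.
Proof.
move=> Bq; rewrite displacementE//; apply: row_norm_le => [|j].
  by rewrite divr_ge0// ltW// arc_length_gt0.
by rewrite mxE; exact: displacement_le.
Qed.

Lemma arc_length_lip i q q' : `|arc_length i q - arc_length i q'| <= 2 * `|q - q'|.
Proof.
have -> : arc_length i q - arc_length i q' = (q - q') 0 (ordS i) - (q - q') 0 i.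
  by rewrite /arc_length /nextpt !mxE; ring.
by rewrite (le_trans (ler_normB _ _))// mulrDl mul1r lerD// row_norm_ge.
Qed.

Lemma Bcover_segment q q' (s : R) : Bcover q -> Bcover q' -> 0 <= s <= 1 ->
  Bcover (q + s *: (q' - q)).
Proof.
move=> Bq Bq' /andP[s0 s1] i; rewrite -subr_gt0.
have := arc_length_gt0 i Bq; have := arc_length_gt0 i Bq'.
rewrite /arc_length /nextpt !mxE.
set a := q' 0 (ordS i); set b := q' 0 i; set c := q 0 (ordS i); set d := q 0 i.
set k := (_ == n)%:R => h1 h2.
have -> : c + s * (a - c) + k - (d + s * (b - d)) =
  (1 - s) * (c + k - d) + s * (a + k - b) by ring.
have [->|s0'] := eqVneq s 0; first by rewrite mul0r addr0 subr0 mul1r.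
by rewrite ltr_wpDl//; [apply: mulr_ge0; [lra|exact: ltW]|rewrite mulr_gt0// lt0r s0'].
Qed.

(** Inside the covering, which is convex, this is the bound on the gradient. If q is
    inside and q' is not, then an arc with respect to q' has length at most 0, so that
    the length of this arc at q is at most 2 |q - q'|, and the displacement at q is at
    most a quarter of it. *)
Lemma displacement_half t q q' :
  `|displacement t q - displacement t q'| <= 2^-1 * `|q - q'|.
Proof.
have out q1 q2 : Bcover q1 -> ~ Bcover q2 -> `|displacement t q1| <= 2^-1 * `|q1 - q2|.
  move=> B1 /existsNP[i]; move/negP; rewrite -leNgt -subr_le0 => a2.
  rewrite (le_trans (displacement_norm_le t i B1))//.
  have := ler_norm (arc_length i q1 - arc_length i q2).
  have := arc_length_lip i q1 q2; rewrite -/(arc_length i q2) in a2.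
  lra.
have [Bq|nBq] := pselect (Bcover q); have [Bq'|nBq'] := pselect (Bcover q').
- rewrite !displacementE//; apply: row_norm_le => [|j]; first by rewrite mulr_ge0// invr_ge0.
  rewrite !mxE; have := @lipschitz_of_partials R n (wc t j) q' q (2 * N)^-1.
  have -> : n%:R * (2 * N)^-1 = 2^-1 :> R by rewrite -/N; field.
  apply=> s s01; have B := Bcover_segment Bq' Bq s01.
  split; first exact: smooth_differentiable (smooth_displacement t j) B.
  by move=> i; exact: displacement_derive_le.
- by rewrite (displacement_out t nBq') subr0 out.
- by rewrite (displacement_out t nBq) sub0r normrN distrC out.
- by rewrite !displacement_out// subr0 normr0 mulr_ge0// invr_ge0.
Qed.

Lemma displacement_shift t q (k : int) :
  displacement t (q + const_mx k%:~R) = displacement t q.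
Proof.
have [Bq|nBq] := pselect (Bcover q).
  rewrite !displacementE//; last by apply/Bcover_shift.
  by apply/rowP => j; rewrite !mxE /wc /displacement_coeff eps_shift break_value_shift.
by rewrite !displacement_out// => /Bcover_shift.
Qed.

Lemma displacement_cover t q : Bcover q -> Bcover (q + displacement t q).
Proof.
move=> Bq i; rewrite -subr_gt0 -/(arc_length i _).
have := arc_length_lip i q (q + displacement t q).
rewrite (_ : q - (q + _) = - displacement t q) ?normrN; last by rewrite opprD addNKr.
have := displacement_norm_le t i Bq; have := arc_length_gt0 i Bq.
have := ler_norm (arc_length i q - arc_length i (q + displacement t q)).
lra.
Qed.

(** The identity plus the displacement is a bijection of the whole space. It is the
    identity outside the covering, hence maps the covering onto itself, and there its
    inverse is smooth by [smooth_inverse_coeff]. *)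
Lemma displacement_inverse t : exists sigma : 'rV[R]_n -> 'rV[R]_n,
  [/\ forall q, Bcover q -> Bcover (sigma q),
      forall q, sigma q + displacement t (sigma q) = q,
      forall q, sigma (q + displacement t q) = q,
      forall q (k : int), sigma (q + const_mx k%:~R) = sigma q + const_mx k%:~R &
      forall j, smooth_on Bcover (fun q => sigma q 0 j)].
Proof.
have [sg [sg1 sg2 sg3]] := id_plus_contraction_bijective (displacement_half t).
have sgB q : Bcover q -> Bcover (sg q).
  move=> Bq; apply: contrapT => nB; apply: (nB).
  by have := sg1 q; rewrite (displacement_out t nB) addr0 => ->.
exists sg; split=> // [q k|j].
  have -> : q + const_mx k%:~R = sg q + const_mx k%:~R + displacement t (sg q + const_mx k%:~R).
    by rewrite displacement_shift addrAC sg1.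
  exact: sg2.
have sw : smooth_on Bcover (fun q => wc t j (sg q)).
  apply: (@smooth_inverse_coeff R _ n (wc t) e (displacement t) sg Bcover Bcover) => //.
  - exact: Bcover_open.
  - exact: Bcover_open.
  - move=> q Bq; rewrite displacementE// [LHS]row_sum_delta.
    by apply: eq_bigr => i _; rewrite mxE.
  - exact: smooth_displacement.
  - move=> q v Bq; apply: row_norm_le => [|i]; first by rewrite mulr_ge0// invr_ge0.
    rewrite summxE (bigD1 i)//= !mxE !eqxx mulr1 big1 ?addr0 => [|k ki]; last first.
      by rewrite !mxE eqxx/= eq_sym (negbTE ki) mulr0.
    have := @derive_coord_le R n (wc t i) q v (2 * N)^-1.
    have -> : n%:R * (2 * N)^-1 = 2^-1 :> R by rewrite -/N; field.
    apply; first exact: smooth_differentiable (smooth_displacement t i) Bq.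
    by move=> k; exact: displacement_derive_le.
apply: (@smooth_ext _ _ _ (fun q => q 0 j + - wc t j (sg q))); first exact: Bcover_open.
  move=> q Bq; have := sg1 q; rewrite displacementE; last exact: sgB.
  by move/rowP => /(_ j); rewrite !mxE => {1}<-; rewrite addrK.
apply: smooth_add; [exact: Bcover_open|exact: smooth_coord|].
by apply: smooth_opp; first exact: Bcover_open.
Qed.

Definition some_lift p : 'rV[R]_n := xget 0 [set q | Bcover q /\ proj q = p].

Definition flow t : circle R -> config R n -> circle R :=
  fun x p => cadd x (damp t (eps (some_lift p)) * u x p).

Lemma some_liftE q : Bcover q -> exists k : int, some_lift (proj q) = q + const_mx k%:~R.
Proof.
move=> Bq; rewrite /some_lift; case: xgetP => [q' _ [Bq' q'q]|/(_ q)].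
  exact: proj_Bcover_eq.
by case.
Qed.

Lemma flow_cpi t x q : Bcover q ->
  flow t (cpi x) (proj q) = cpi (x + damp t (eps q) * u (cpi x) (proj q)).
Proof.
by move=> Bq; rewrite /flow; have [k ->] := some_liftE Bq; rewrite eps_shift cadd_cpi.
Qed.

Lemma flow_btrg t q : Bcover q -> btrg (flow t) (proj q) = proj (q + displacement t q).
Proof.
move=> Bq; apply/rowP => j; rewrite /btrg /trg !mxE flow_cpi// displacementE//.
by rewrite mxE.
Qed.

Lemma flow_diffeo t : diffeo_of_B (btrg (flow t)).
Proof.
have [sg [sgB sg1 sg2 sgS sgs]] := displacement_inverse t.
have sE q : Bcover q -> proj (sg (some_lift (proj q))) = proj (sg q).
  by move=> Bq; have [k ->] := some_liftE Bq; rewrite sgS proj_shift.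
exists (fun p => proj (sg (some_lift p))); split.
- move=> _ [q Bq <-]; have Bd := displacement_cover t Bq.
  by rewrite flow_btrg// sE// sg2; split=> //; exact: Bset_proj.
- move=> _ [q Bq <-]; rewrite sE//; have Bs := sgB _ Bq.
  by rewrite flow_btrg// sg1; split=> //; exact: Bset_proj.
- move=> i q Bq; exists Bcover, (fun q => q 0 i + wc t i q).
  split=> //; first exact: Bcover_open.
    by apply: smooth_add; [exact: Bcover_open|exact: smooth_coord|exact: smooth_displacement].
  by move=> q' Bq' _; rewrite flow_btrg// projE displacementE// !mxE.
- move=> i q Bq; exists Bcover, (fun q => sg q 0 i).
  split=> //; first exact: Bcover_open.
  by move=> q' Bq' _; rewrite sE// projE.
Qed.

Lemma flow_smooth i : csmooth_upto [set z : R * E | piece i z.2]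
  (fun z : R * E => flow z.1 (cpi z.2.1) (proj z.2.2)).
Proof.
move=> z pz; have [M [g [oM Mz sg ug]]] := su.2 i z.2 pz.
pose U := [set z : R * E | M z.2 /\ Bcover z.2.2].
have oU : open U.
  apply: openI; first by apply: open_comp => // y _; exact: cvg_snd.
  apply: (@open_comp _ _ (fun z : R * E => z.2.2)); last exact: Bcover_open.
  move=> y _; apply: (@continuous_comp _ _ _ snd snd); exact: cvg_snd.
have m2 : smooth_map U (fun z : R * E => z.2).
  by apply: smooth_map_snd; exact: smooth_map_id.
have m22 : smooth_map U (fun z : R * E => z.2.2) by exact: smooth_map_snd.
exists U, (fun z : R * E => z.2.1 + damp z.1 (eps z.2.2) * g z.2); split=> //.
- by split=> //; case: pz.
- apply: smooth_add => //.
    apply: smooth_linear => // y.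
    by apply: (@continuous_comp _ _ _ snd fst); [exact: cvg_snd|exact: cvg_fst].
  apply: smooth_mul => //; last by apply: (smooth_comp oU _ m2 sg) => y [].
  apply: (smooth_comp oU _ _ (@smooth_damp R) (phi := fun z : R * E => (z.1, eps z.2.2))).
    by move=> y [_ By]; exact: eps_gt0.
  apply: smooth_map_pair; first by apply: smooth_map_fst; exact: smooth_map_id.
  by apply: smooth_map_real; apply: (smooth_comp oU _ m22 seps) => y [].
- move=> y py [My By]; rewrite flow_cpi//; congr (cpi (_ + _ * _)).
  exact: ug.
Qed.

Lemma section_continuous z : Bcover z.2 -> {for z, continuous (lift_section u)}.
Proof. by move=> Bz; exact: ((within_S1BP _).1 su.1). Qed.

Lemma flow_bisection t : bisection (flow t).
Proof.
split; last exact: flow_diffeo.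
- apply/within_S1BP => z Bz.
  pose F z : R := z.1 + damp t (eps z.2) * lift_section u z.
  have cF : {for z, continuous (cpi \o F)}.
    apply: continuous_comp; last exact: cpi_continuous.
    apply: cvgD; first exact: cvg_fst.
    apply: cvgM; last exact: section_continuous.
    apply: (@continuous_comp _ _ _ snd (fun q => damp t (eps q))); first exact: cvg_snd.
    exact: smooth_continuous (smooth_damp_eps t) Bz.
  have nB : \forall y \near z, Bcover y.2 by apply: cvg_snd; exact: Bcover_near.
  have E : flow t (pproj z).1 (pproj z).2 = (cpi \o F) z by rewrite /= flow_cpi.
  move=> A; rewrite [nbhs _ _]/(nbhs (flow t (pproj z).1 (pproj z).2) A) E => /cF.
  by apply: filterS2 nB => y By; rewrite /= flow_cpi.
- move=> i z pz; have [U [g [oU Uz sg fg]]] := flow_smooth (i := i) (a := (t, z)) pz.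
  have cs : continuous (fun z : E => (t, z)) by move=> y; exact: continuous_slice.
  exists [set z | U (t, z)], (fun z => g (t, z)); split=> //.
  + by apply: open_comp => // y _; exact: cs.
  + apply: (smooth_comp _ _ _ sg) => //; first by apply: open_comp => // y _; exact: cs.
    by apply: smooth_map_pair; [exact: smooth_map_cst|exact: smooth_map_id].
  + by move=> y py Uy; exact: (fg (t, y)).
move=> _ [q Bq <-]; have [C [C1 [sl _] _ e0 [eC _]]] := epsP Bq.
rewrite (_ : (fun x => _) = fun x => cadd x (damp t (eps q) * u x (proj q))); last first.
  by apply/funext => x; rewrite /flow; have [k ->] := some_liftE Bq; rewrite eps_shift.
apply: (@arrow_of_field R n n0 q (fun x => u x (proj q)) _ C Bq) => //; last 2 first.
- by lra.
- have C0 : 0 < C by lra.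
  apply: (@le_trans _ _ ((4 * N * C ^+ 2)^-1 / 2 * C)).
    rewrite ler_wpM2r; [by []|lra|apply: (le_trans (damp_le t e0))].
    by rewrite ler_wpM2r// invr_ge0.
  have Cn : C != 0 by rewrite gt_eqF.
  have -> : (4 * N * C ^+ 2)^-1 / 2 * C = (8 * N * C)^-1 by field; rewrite Nn Cn.
  have NC1 : 1 <= N * C by rewrite -[leLHS]mulr1 ler_pM.
  by rewrite lef_pV2 ?posrE//; move: (N) NC1 => M; lra.
apply/circle_continuousP => x.
apply: (@continuous_comp _ _ _ (fun x : R => (x, q)) (lift_section u)).
  by apply: continuous_pair_at; [exact: cvg_id|exact: cvg_cst].
exact: section_continuous.
Qed.

Lemma flow_curve : bisection_curve u flow.
Proof.
split.
- exists 1 => //; split=> [t _|i]; first exact: flow_bisection.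
  move=> z [_ pz]; have [U [g [oU Uz sg fg]]] := flow_smooth pz.
  by exists U, g; split=> // y [_ py]; exact: fg.
- by move=> x p _; rewrite /flow damp0 mul0r cadd0.
move=> x p [q Bq <-]; have [k kE] := some_liftE Bq.
rewrite /flow kE eps_shift; apply: cvelocity_cadd.
have := @is_deriveM R R _ (cst (u x (proj q))) (0 : R) 1 _ _ (damp_derive_t (eps_gt0 Bq)) (is_derive_cst _ _ _).
by move=> h; apply: is_derive_eq h _; rewrite /GRing.scale/= mulr0 add0r mulr1.
Qed.

End ExistsCurve.

Lemma bisection_curve_exists (R : realType) (n : nat) (u : circle R -> config R n -> R) :
  (0 < n)%N -> smooth_section u -> exists f, bisection_curve u f.
Proof.
move=> n0 su; have [eps [seps shift epsP]] := section_bound n0 su.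
exists (flow u eps); exact: flow_curve.
Qed.

(** * The bracket is a smooth section *)

Section BracketSection.
Variables (R : realType) (n : nat).
Hypothesis n0 : (0 < n)%N.
Local Notation cpi := (@cpi R).
Local Notation proj := (@Defs.proj R n).
Local Notation E := (R * 'rV[R]_n)%type.
Implicit Types (z : E) (q : 'rV[R]_n).
Variables (u v : circle R -> config R n -> R).
Hypotheses (su : smooth_section u) (sv : smooth_section v).

(** The derivative along (a, b), in a form that is smooth in (a, b) as well. *)
Definition dir_derive (a : R) (b : 'rV[R]_n) (f : E -> R) z : R :=
  a * 'D_(1, 0) f z + \sum_j b 0 j * 'D_(0, delta_mx 0 j) f z.

Lemma dir_deriveE a b f z : differentiable f z -> dir_derive a b f z = 'D_(a, b) f z.
Proof. by move=> df; rewrite derive_pair_dir. Qed.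

Lemma smooth_dir_derive (M : set E) (a : E -> R) (b : E -> 'rV[R]_n) (f : E -> R) :
  open M -> smooth_on M a -> (forall j, smooth_on M (fun z => b z 0 j)) ->
  smooth_on M f -> smooth_on M (fun z => dir_derive (a z) (b z) f z).
Proof.
move=> oM sa sb sf; apply: smooth_add (oM) _ _.
  by apply: smooth_mul (oM) _ _ => //; exact: smooth_derive.
by apply: smooth_sum (oM) _ => j _; apply: smooth_mul (oM) _ _ => //; exact: smooth_derive.
Qed.

Definition break_vel (s : circle R -> config R n -> R) q : 'rV[R]_n :=
  \row_j lift_section s (break j q).

(** The common value of the bracket at the break p_j from both sides. It is the
    bracket of the motions that u and v induce on the base, in the coordinate p_j. *)
Definition break_bracket (j : 'I_n) q : R :=
  'D_(break_vel u q) (fun q => lift_section v (break j q)) q -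
  'D_(break_vel v q) (fun q => lift_section u (break j q)) q.

(** The vector (b_j, b) is tangent to the hypersurface x = p_j + c, where the section
    is a function on the base. *)
Lemma derive_along_break (s : circle R -> config R n -> R) (g : E -> R) (M : set E)
    (j : 'I_n) (c : R) q b :
  open M -> smooth_on M g -> M (q 0 j + c, q) ->
  (\forall q' \near q, M ((q' : 'rV[R]_n) 0 j + c, q') ->
     lift_section s (break j q') = g (q' 0 j + c, q')) ->
  'D_b (fun q => lift_section s (break j q)) q = 'D_(b 0 j, b) g (q 0 j + c, q).
Proof.
move=> oM sg Mq E1; pose r q : E := (q 0 j + c, q).
have sr S : smooth_map S r.
  apply: smooth_map_pair; last exact: smooth_map_id.
  apply: smooth_map_real; apply: smooth_sub (@subsetT _ S) _.
  by apply: smooth_add openT _ _; [exact: smooth_coord|exact: smooth_cst].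
have cr : {for q, continuous r} by exact: (smap_continuous (@sr setT 0%N)).
have dr : differentiable r q by exact: (smap_differentiable (@sr setT 1%N)).
have E2 : \forall q' \near q, lift_section s (break j q') = (g \o r) q'.
  by apply: filterS2 E1 (continuous_near cr (open_near oM Mq)) => q' E1' /E1'.
rewrite (near_eq_derive _ E2) (@derive_comp _ _ _ _ g r)//; last first.
  exact: smooth_differentiable sg Mq.
rewrite -deriveE; last exact: smooth_differentiable sg Mq.
congr ('D__ g _); rewrite derive_line0.
have -> : (fun h : R => r (q + h *: b)) = fun h : R => r q + h *: ((b 0 j, b) : E).
  by apply/funext => h; congr pair; rewrite /= !mxE addrAC.
exact: derive_affine.
Qed.

(** With local smooth extensions gu and gv of the sections across the boundary of the
    piece, h is the bracket formula in which u and v at x are replaced by gu and gv.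
    On the boundary the direction of differentiation is tangent to it, so that the
    values of h do not depend on the extensions, nor on the side. *)
Lemma local_bracket i z : piece i z -> exists (M : set E) (h : E -> R),
  [/\ open M, M z & smooth_on M h] /\
  [/\ forall y, arc_interior i y -> M y ->
        bracket_formula u v (cpi y.1) (proj y.2) = h y,
      forall q, Bcover q -> M (break i q) -> h (break i q) = break_bracket i q &
      forall q, Bcover q -> M (nextpt q i, q) ->
        h (nextpt q i, q) = break_bracket (ordS i) q].
Proof.
move=> pz; have [Mu [gu [oMu Muz sgu ugu]]] := su.2 i z pz.
have [Mv [gv [oMv Mvz sgv vgv]]] := sv.2 i z pz.
pose M := [set y : E | [/\ Mu y, Mv y & Bcover y.2]].
have oM : open M.
  have -> : M = Mu `&` Mv `&` [set y : E | Bcover y.2].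
    by apply/seteqP; split=> y; [case|case=> -[]].
  apply: openI; first exact: openI.
  by apply: (@open_comp _ _ snd); [move=> y _; exact: cvg_snd|exact: Bcover_open].
have sMu : smooth_on M gu by apply: smooth_sub sgu => y [].
have sMv : smooth_on M gv by apply: smooth_sub sgv => y [].
have sb s j : smooth_section s -> smooth_on M (fun y => break_vel s y.2 0 j).
  move=> ss; apply: (@smooth_ext _ _ _ (fun y : E => lift_section s (break j y.2))) => //.
    by move=> y _; rewrite mxE.
  apply: (@smooth_comp R _ _ M Bcover (fun q => lift_section s (break j q)) snd) => //.
  - by move=> y [].
  - by apply: smooth_map_snd; exact: smooth_map_id.
  - exact: section_smooth_break.
pose h y := dir_derive (gu y) (break_vel u y.2) gv y + - dir_derive (gv y) (break_vel v y.2) gu y.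
have along s (g : E -> R) (j : 'I_n) (c : R) q b : smooth_on M g -> Bcover q ->
    (forall y, piece i y -> M y -> lift_section s y = g y) ->
    (forall q', Bcover q' -> piece i (q' 0 j + c, q')) ->
    (forall q', lift_section s (q' 0 j + c, q') = lift_section s (break j q')) ->
    M (q 0 j + c, q) ->
    'D_b (fun q => lift_section s (break j q)) q = 'D_(b 0 j, b) g (q 0 j + c, q).
  move=> sg Bq sE pj sj Mq; apply: derive_along_break (oM) _ Mq _ => //.
  apply: filterS (Bcover_near Bq) => q' Bq' Mq'.
  by rewrite -sj sE//; exact: pj.
have break_h (j : 'I_n) (c : R) q : Bcover q ->
    (forall q', Bcover q' -> piece i (q' 0 j + c, q')) ->
    (forall s q', lift_section s (q' 0 j + c, q') = lift_section s (break j q')) ->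
    M (q 0 j + c, q) -> h (q 0 j + c, q) = break_bracket j q.
  move=> Bq pj sj Mq; have pq := pj q Bq.
  have duq := smooth_differentiable sMu Mq; have dvq := smooth_differentiable sMv Mq.
  have Eu y : piece i y -> M y -> lift_section u y = gu y by move=> py [My _ _]; exact: ugu.
  have Ev y : piece i y -> M y -> lift_section v y = gv y by move=> py [_ My _]; exact: vgv.
  rewrite /h /break_bracket !dir_deriveE// -Eu// -Ev//.
  rewrite (along v gv j c q (break_vel u q) sMv Bq Ev pj (sj v) Mq).
  rewrite (along u gu j c q (break_vel v q) sMu Bq Eu pj (sj u) Mq).
  by rewrite !sj !mxE.
exists M, h; split; first split=> //.
- by split=> //; case: pz.
- apply: smooth_add => //; first by apply: smooth_dir_derive => // j; exact: sb.
  by apply: smooth_opp => //; apply: smooth_dir_derive => // j; exact: sb.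
split.
- move=> y iy My; rewrite (bracket_formulaE su sv iy) /h.
  have nI : \forall y' \near y, M y' /\ arc_interior i y'.
    by apply: filterI; [exact: (open_near oM My)|exact: (open_near (@arc_interior_open _ _ i) iy)].
  have Eu : \forall y' \near y, lift_section u y' = gu y'.
    by apply: filterS nI => y' [[My' _ _] /arc_interior_piece py]; exact: (ugu y' py My').
  have Ev : \forall y' \near y, lift_section v y' = gv y'.
    by apply: filterS nI => y' [[_ My' _] /arc_interior_piece py]; exact: (vgv y' py My').
  rewrite !dir_deriveE; [|exact: smooth_differentiable sMu My|exact: smooth_differentiable sMv My].
  rewrite (near_eq_derive _ Eu) (near_eq_derive _ Ev).
  by rewrite /vel (nbhs_singleton Eu) (nbhs_singleton Ev).
- move=> q Bq; rewrite /break -{1 2}[q 0 i]addr0; apply: break_h => //.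
    by move=> q' Bq'; rewrite addr0; exact: break_piece.
  by move=> s q'; rewrite addr0.
- move=> q Bq; apply: break_h => //.
    by move=> q' Bq'; split=> //=; rewrite -/(nextpt q' i) lexx ltW.
  move=> s q'; rewrite /lift_section /break /=; congr (s _ _).
  by apply/cpi_eqP; exists (i.+1 == n)%:Z.
Qed.

(** The bracket, extended to the breaks by the limits from the right. *)
Definition bracket_section (x : circle R) (p : config R n) : R :=
  lim (bracket_formula u v (cpi (repr x + y)) p @[y --> (0 : R)^'+]).

Lemma bracket_section_cpi (x : R) (p : config R n) : bracket_section (cpi x) p =
  lim (bracket_formula u v (cpi (x + y)) p @[y --> (0 : R)^'+]).
Proof.
have [k kE] : exists k : int, repr (cpi x) = x + k%:~R.
  by apply/cpi_eqP; rewrite cpi_repr.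
rewrite /bracket_section kE.
have -> // : (fun y => bracket_formula u v (cpi (x + k%:~R + y)) p) =
  fun y => bracket_formula u v (cpi (x + y)) p.
by apply/funext => y; rewrite addrAC cpi_addz.
Qed.

Lemma bracket_section_left i (M : set E) (h : E -> R) z : open M -> smooth_on M h ->
  (forall y, arc_interior i y -> M y ->
     bracket_formula u v (cpi y.1) (proj y.2) = h y) ->
  M z -> piece i z -> z.1 < nextpt z.2 i -> lift_section bracket_section z = h z.
Proof.
case: z => x q oM sh bh Mz [/= Bq /andP[ix _]] xi.
rewrite /lift_section /= bracket_section_cpi.
have cs : {for (0 : R), continuous (fun y : R => (x + y, q))}.
  apply: continuous_pair_at; last exact: cvg_cst.
  by apply: cvgD; [exact: cvg_cst|exact: cvg_id].
have M0 : M (x + 0, q) by rewrite addr0.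
have nM : \forall y \near (0 : R), M (x + y, q).
  exact: (continuous_near cs (open_near oM M0)).
apply: cvg_lim => //.
have ch : (h (x + y, q)) @[y --> (0 : R)^'+] --> h (x, q).
  apply: cvg_at_right_filter.
  have c0 : (h (x + y, q)) @[y --> (0 : R)] --> h (x + 0, q).
    exact: (@continuous_comp _ _ _ _ h (0 : R) cs (smooth_continuous sh M0)).
  by move: c0; rewrite addr0.
apply: cvg_trans ch; apply: near_eq_cvg.
have r0 : 0 < nextpt q i - x by rewrite subr_gt0.
near=> y; rewrite /= -(bh (x + y, q))//.
  split=> //=; have y0 : 0 < y by near: y; exact: nbhs_right_gt.
  have y1 : y < nextpt q i - x by near: y; exact: nbhs_right_lt.
  by apply/andP; split; lra.
near: y; exact: cvg_within nM.
Unshelve. all: by end_near.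
Qed.

(** At the right end of an arc the limit from the right is computed in the next
    piece; the two local extensions have the same value there. *)
Lemma bracket_section_smooth_upto i : smooth_upto (piece i)
  (fun z => bracket_section (cpi z.1) (proj z.2)).
Proof.
move=> z pz; have [M [h [[oM Mz sh] [h1 _ h3]]]] := local_bracket pz.
exists M, h; split=> // -[x q] pxq Mxq.
have [Bq /andP[/= ix]] := pxq; rewrite le_eqVlt => /orP[/eqP xE|xi]; last first.
  exact: (bracket_section_left oM sh h1 Mxq pxq xi).
pose j := ordS i.
have [M' [h' [[oM' Mj sh'] [h1' h2' _]]]] := local_bracket (break_piece j Bq).
move: Mxq; rewrite xE => Mxq; rewrite h3// -h2'//.
rewrite -(bracket_section_left oM' sh' h1' Mj (break_piece j Bq) (Bq j)).
rewrite /lift_section /=; congr bracket_section.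
by apply/cpi_eqP; exists (i.+1 == n)%:Z.
Qed.

Lemma bracket_section_smooth : smooth_section bracket_section.
Proof.
split; last exact: bracket_section_smooth_upto.
apply/within_S1BP => z; apply: (pieces_continuous n0) => [y k|i y py N nN].
  by rewrite /pproj /= -mulrNz cpi_addz.
have H := smooth_upto_near (@bracket_section_smooth_upto i) py.
exact: (H N nN).
Qed.

Lemma bracket_sectionE x p : Bset p -> off_breaks x p ->
  bracket_section x p = bracket_formula u v x p.
Proof.
move=> [q Bq <-]; rewrite -(cpi_repr x) => /(off_breaks_interior n0 Bq)[i [k zi]].
have pz := arc_interior_piece zi; have [M [h [[oM Mz sh] [h1 _ _]]]] := local_bracket pz.
have := bracket_section_left oM sh h1 Mz pz; rewrite -(h1 _ zi Mz).
rewrite /lift_section /= -mulrNz cpi_addz; apply.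
by case: zi => _ /andP[_]; rewrite /= mulrNz.
Qed.

End BracketSection.

(** * The Lie algebroid *)

Lemma conj_mixed_derivative_unique (R : realType) (n : nat)
    (f g : R -> circle R -> config R n -> circle R) x p a b :
  conj_mixed_derivative f g x p a -> conj_mixed_derivative f g x p b -> a = b.
Proof.
move=> [w1 [n1 d1]] [w2 [n2 d2]].
have E : \forall t \near (0 : R), w1 t = w2 t.
  by apply: filterS2 n1 n2 => t; exact: cvelocity_unique.
have [_ <-] := near_eq_is_derive E d1.
by case: d2.
Qed.

Theorem mainTheorem7 (R : realType) (n : nat) (hn : (1 <= n)%N) :
  (forall p : config R n, Bset p -> tangent_source_fiber p = [set u | BVect p u]) /\
  (forall (p : config R n) (u : circle R -> R), Bset p -> BVect p u ->
     dtrg p u (anchor p u)) /\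
  (forall u v : circle R -> config R n -> R,
     smooth_section u -> smooth_section v ->
     (exists w, bisection_bracket u v w) /\
     (forall w, bisection_bracket u v w ->
        forall x p, Bset p -> off_breaks x p ->
          w x p = bracket_formula u v x p)).
Proof.
split; first exact: tangent_source_fiberE.
split=> [p u _ _|u v su sv]; first exact: dtrg_anchor.
split.
  exists (bracket_section u v); split.
  - exact: bracket_section_smooth.
  - exact: bisection_curve_exists.
  - exact: bisection_curve_exists.
  - move=> f g fu gv x p Bp xp; rewrite bracket_sectionE//.
    exact: (conj_mixed_bracket hn su sv fu gv).
move=> w [_ [f fu] [g gv] wE] x p Bp xp.
apply: oppr_inj; apply: conj_mixed_derivative_unique (wE f g fu gv x p Bp xp) _.
exact: (conj_mixed_bracket hn su sv fu gv).
Qed.
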